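(* There is a universal constant $C>0$ such that the following holds. Let $X\sim N(0,\Sigma)$ be a $\kappa$-nondegenerate attractive Gaussian graphical model on $n$ nodes whose graph has maximum degree $d$, and let $\delta\in(0,1)$. Set $\nu=\kappa^2/\sqrt{32}$ and $K=64\,d\log(4/\kappa^2)+1$. If the number of i.i.d. samples satisfies $m\ge m_1$, where $m_1=\frac{C}{\kappa^2}\left(K\log(n)+\log(4/\delta)\right)$, then with probability at least $1-\delta$, for every node $i$ the algorithm \textsc{GreedyAndPrune}$(i,\nu,K)$ returns exactly the set of neighbors of $i$. The combined running time of the algorithm over all nodes is $O(K^3mn^2)$.
   Context: A Gaussian graphical model (GGM) on $n$ nodes is a Gaussian vector $X=(X_1,\dots,X_n)\sim N(0,\Sigma)$ with invertible covariance $\Sigma$ and precision matrix $\Theta=\Sigma^{-1}$. Its graph has vertex set $\{1,\dots,n\}$, with distinct $i,j$ adjacent (neighbors) iff $\Theta_{ij}\neq0$. For $\kappa\in(0,1]$, the GGM is $\kappa$-nondegenerate if $|\Theta_{ij}|/\sqrt{\Theta_{ii}\Theta_{jj}}\ge\kappa$ for all $i\ne j$ with $\Theta_{ij}\ne0$. It is attractive if $\Theta_{ij}\le0$ for all $i\neq j$. Given $m$ i.i.d. samples, let $\mathbb X$ be the $m\times n$ matrix whose rows are the samples and $\mathbb X_i$ its $i$-th column. For $S\subset\{1,\dots,n\}\setminus\{i\}$, the estimated conditional variance is $\widehat{\mathrm{Var}}(X_i\mid X_S)=\frac{1}{m-|S|}\min_{w:\,\mathrm{supp}(w)\subset S}\|\mathbb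 X_i-\mathbb Xw\|_2^2$. Orthogonal matching pursuit (OMP) run for $T$ steps to predict $\mathbb X_i$ from the other columns: $S_0=\emptyset$; for $t=1,\dots,T$ choose $j\ne i$ minimizing $\min_{w:\,\mathrm{supp}(w)\subset S_{t-1}\cup\{j\}}\|\mathbb X_i-\mathbb Xw\|_2^2$ and set $S_t=S_{t-1}\cup\{j\}$; output $S_T$. (Non-integer $T$ is rounded up; the procedure stops if all other columns have been selected.) \textsc{GreedyAndPrune}$(i,\nu,T)$: (1) run OMP for $T$ steps to predict $\mathbb X_i$ from the other columns, and let $S$ be the output; (2) define $\hat\Theta_{ii}$ by $1/\hat\Theta_{ii}=\widehat{\mathrm{Var}}(X_i\mid X_S)$; (3) for each $j$ in (the initial) $S$, one after another: let $S'=S\setminus\{j\}$ for the current $S$, and if $\widehat{\mathrm{Var}}(X_i\mid X_{S'})-\widehat{\mathrm{Var}}(X_i\mid X_S)<\nu/\hat\Theta_{ii}$, replace $S$ by $S'$; (4) return $S$. *)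

(* Defs.v *)
From mathcomp Require Export all_boot all_order all_algebra.
From mathcomp Require Export all_classical all_reals all_analysis.
Export Order.TTheory GRing.Theory Num.Theory numFieldNormedType.Exports.

Set Implicit Arguments.
Unset Strict Implicit.
Unset Printing Implicit Defensive.

Local Open Scope classical_set_scope.
Local Open Scope ring_scope.

Definition quadratic_form {R : realType} {n : nat}
    (A : 'M[R]_n) (w : 'rV[R]_n) : R := (w *m A *m w^T) 0 0.

Definition is_covariance {R : realType} {n : nat} (Sigma : 'M[R]_n) : Prop :=
  Sigma^T = Sigma /\ forall w : 'rV[R]_n, 0 <= quadratic_form Sigma w.

(* Centered Gaussian vector with covariance Sigma: every linear combination
   <w, X> has law N(0, w Sigma w^T).  The second argument of [normal_prob] is the
   standard deviation, and its value at 0 is not the Dirac mass; the (trivial)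
   null combination w = 0 is therefore left out, which loses nothing since
   this is only used with Sigma positive definite. *)
Definition gaussian_vector {R : realType} {dO : measure_display}
    {Omega : measurableType dO} (P : probability Omega R) {n : nat}
    (Sigma : 'M[R]_n) (X : Omega -> n.-tuple R) : Prop :=
  forall w : 'rV[R]_n, w != 0 ->
  forall A : set (measurableTypeR R), measurable A ->
    P ((fun omega => \sum_(i < n) w 0 i * tnth (X omega) i) @^-1` A) =
    normal_prob 0 (Num.sqrt (quadratic_form Sigma w)) A.

Definition mutually_independent {R : realType} {dO dT : measure_display}
    {Omega : measurableType dO} {T : measurableType dT}
    (P : probability Omega R) {m : nat} (X : 'I_m -> Omega -> T) : Prop :=
  forall (J : {set 'I_m}) (B : 'I_m -> set T),
    (forall k, measurable (B k)) ->
    P (\bigcap_(k in [set` J]) (X k @^-1` B k)) =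
    (\prod_(k in J) P (X k @^-1` B k))%E.

(* m i.i.d. samples from N(0, Sigma); identity in law is part of the first
   clause.  [n.-tuple (measurableTypeR R)] carries the product Borel
   sigma-algebra of R^n. *)
Definition iid_gaussian_samples {R : realType} {dO : measure_display}
    {Omega : measurableType dO} (P : probability Omega R) {n m : nat}
    (Sigma : 'M[R]_n)
    (X : 'I_m -> {RV P >-> n.-tuple (measurableTypeR R)}) : Prop :=
  (forall k, gaussian_vector P Sigma (X k)) /\
  mutually_independent P (fun k => X k : Omega -> n.-tuple (measurableTypeR R)).

Definition data_matrix {R : realType} {dO : measure_display}
    {Omega : measurableType dO} {P : probability Omega R} {n m : nat}
    (X : 'I_m -> {RV P >-> n.-tuple (measurableTypeR R)}) (omega : Omega) :
    'M[R]_(m, n) := \matrix_(k < m, i < n) (tnth (X k omega) i : R).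

Definition neighbors {R : realType} {n : nat} (Theta : 'M[R]_n) (i : 'I_n) :
    {set 'I_n} := [set j | (j != i) && (Theta i j != 0)]%SET.

Definition max_degree {R : realType} {n : nat} (Theta : 'M[R]_n) : nat :=
  \max_(i < n) #|neighbors Theta i|.

Definition nondegenerate {R : realType} {n : nat} (kappa : R)
    (Theta : 'M[R]_n) : Prop :=
  forall i j : 'I_n, i != j -> Theta i j != 0 ->
    kappa <= `|Theta i j| / Num.sqrt (Theta i i * Theta j j).

Definition attractive {R : realType} {n : nat} (Theta : 'M[R]_n) : Prop :=
  forall i j : 'I_n, i != j -> Theta i j <= 0.

Definition sqnorm {R : realType} {m : nat} (v : 'cV[R]_m) : R :=
  \sum_(k < m) v k 0 ^+ 2.

(* The infimum is a minimum. *)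
Definition min_rss {R : realType} {m n : nat} (D : 'M[R]_(m, n)) (i : 'I_n)
    (S : {set 'I_n}) : R :=
  inf [set sqnorm (col i D - D *m w) |
        w in [set w : 'cV[R]_n | forall j, w j 0 != 0 -> j \in S]].

Definition hat_var {R : realType} {m n : nat} (D : 'M[R]_(m, n)) (i : 'I_n)
    (S : {set 'I_n}) : R :=
  (m%:R - #|S|%:R)^-1 * min_rss D i S.

(* [omp D i t S]: S is a possible value of S_t.  Ties in the minimization are
   not resolved, so this is a relation. *)
Inductive omp {R : realType} {m n : nat} (D : 'M[R]_(m, n)) (i : 'I_n) :
    nat -> {set 'I_n} -> Prop :=
| omp_init : omp D i 0 finset.set0
| omp_select t S j :
    omp D i t S -> S != [set~ i]%SET ->
    j != i ->
    (forall j', j' != i -> min_rss D i (j |: S)%SET <= min_rss D i (j' |: S)%SET) ->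
    omp D i t.+1 (j |: S)%SET
| omp_stop t S :
    omp D i t S -> S = [set~ i]%SET -> omp D i t.+1 S.

Definition hat_Theta {R : realType} {m n : nat} (D : 'M[R]_(m, n)) (i : 'I_n)
    (S : {set 'I_n}) : R := (hat_var D i S)^-1.

Definition prune_step {R : realType} {m n : nat} (D : 'M[R]_(m, n)) (i : 'I_n)
    (threshold : R) (S : {set 'I_n}) (j : 'I_n) : {set 'I_n} :=
  if hat_var D i (S :\ j)%SET - hat_var D i S < threshold
  then (S :\ j)%SET else S.

Definition num_steps {R : realType} (T : R) : nat := `|Num.ceil T|%N.

(* [greedy_and_prune D i nu T S]: S is a possible output of GreedyAndPrune, for
   some tie-breaking in OMP and some order [s] of traversal of the OMP output. *)
Definition greedy_and_prune {R : realType} {m n : nat} (D : 'M[R]_(m, n))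
    (i : 'I_n) (nu T : R) (S : {set 'I_n}) : Prop :=
  exists (S0 : {set 'I_n}) (s : seq 'I_n),
    [/\ omp D i (num_steps T) S0,
        uniq s, s =i S0 &
        S = foldl (prune_step D i (nu / hat_Theta D i S0)) S0 s].

(* Machine model for the running time: a real RAM.  It has registers holding
   natural numbers or reals, addressed by constants, and two infinite memories,
   one of natural numbers and one of reals, addressed by natural numbers.  Natural
   numbers are only added, subtracted (with truncation) and compared; reals
   support the field operations, exact comparison and conversion from a natural
   number.  Every operation has unit cost.  A program is a fixed finite piece of
   syntax, independent of the input and of its dimensions. *)
Inductive iexp :=
| IConst of nat
| IReg of nat
| IMem of iexp
| IAdd of iexp & iexp
| ISub of iexp & iexp.

Inductive rexp :=
| RReg of nat
| RMem of iexp
| ROfNat of iexp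
| RAdd of rexp & rexp
| RSub of rexp & rexp
| RMul of rexp & rexp
| RDiv of rexp & rexp.

Inductive bexp :=
| ILt of iexp & iexp
| IEq of iexp & iexp
| RLt of rexp & rexp
| REq of rexp & rexp.

Inductive prog :=
| Skip
| SetIReg of nat & iexp
| SetRReg of nat & rexp
| SetIMem of iexp & iexp
| SetRMem of iexp & rexp
| Seq of prog & prog
| If of bexp & prog & prog
| While of bexp & prog.

Record state (R : realType) := State {
  ireg : nat -> nat;
  rreg : nat -> R;
  imem : nat -> nat;
  rmem : nat -> R }.

Fixpoint ieval {R : realType} (s : state R) (e : iexp) : nat :=
  match e with
  | IConst c => c
  | IReg a => ireg s a
  | IMem e => imem s (ieval s e)
  | IAdd e1 e2 => (ieval s e1 + ieval s e2)%N
  | ISub e1 e2 => (ieval s e1 - ieval s e2)%N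
  end.

Fixpoint reval {R : realType} (s : state R) (e : rexp) : R :=
  match e with
  | RReg a => rreg s a
  | RMem e => rmem s (ieval s e)
  | ROfNat e => (ieval s e)%:R
  | RAdd e1 e2 => reval s e1 + reval s e2
  | RSub e1 e2 => reval s e1 - reval s e2
  | RMul e1 e2 => reval s e1 * reval s e2
  | RDiv e1 e2 => reval s e1 / reval s e2
  end.

Definition beval {R : realType} (s : state R) (b : bexp) : bool :=
  match b with
  | ILt e1 e2 => (ieval s e1 < ieval s e2)%N
  | IEq e1 e2 => ieval s e1 == ieval s e2
  | RLt e1 e2 => reval s e1 < reval s e2
  | REq e1 e2 => reval s e1 == reval s e2
  end.

Fixpoint icost (e : iexp) : nat :=
  match e with
  | IConst _ | IReg _ => 1
  | IMem e => (icost e).+1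
  | IAdd e1 e2 | ISub e1 e2 => (icost e1 + icost e2).+1
  end.

Fixpoint rcost (e : rexp) : nat :=
  match e with
  | RReg _ => 1
  | RMem e | ROfNat e => (icost e).+1
  | RAdd e1 e2 | RSub e1 e2 | RMul e1 e2 | RDiv e1 e2 =>
      (rcost e1 + rcost e2).+1
  end.

Definition bcost (b : bexp) : nat :=
  match b with
  | ILt e1 e2 | IEq e1 e2 => (icost e1 + icost e2).+1
  | RLt e1 e2 | REq e1 e2 => (rcost e1 + rcost e2).+1
  end.

(* [exec c s s' t]: started in state s, program c halts in state s' after t
   elementary operations. *)
Inductive exec {R : realType} : prog -> state R -> state R -> nat -> Prop :=
| exec_skip s : exec Skip s s 1
| exec_ireg s a e :
    exec (SetIReg a e) s
      (State [eta ireg s with a |-> ieval s e] (rreg s) (imem s) (rmem s))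
      (icost e).+1
| exec_rreg s a e :
    exec (SetRReg a e) s
      (State (ireg s) [eta rreg s with a |-> reval s e] (imem s) (rmem s))
      (rcost e).+1
| exec_imem s a e :
    exec (SetIMem a e) s
      (State (ireg s) (rreg s)
         [eta imem s with ieval s a |-> ieval s e] (rmem s))
      (icost a + icost e).+1
| exec_rmem s a e :
    exec (SetRMem a e) s
      (State (ireg s) (rreg s) (imem s)
         [eta rmem s with ieval s a |-> reval s e])
      (icost a + rcost e).+1
| exec_seq c1 c2 s1 s2 s3 t1 t2 :
    exec c1 s1 s2 t1 -> exec c2 s2 s3 t2 ->
    exec (Seq c1 c2) s1 s3 (t1 + t2)%N
| exec_if b c1 c2 s s' t :
    exec (if beval s b then c1 else c2) s s' t ->
    exec (If b c1 c2) s s' (bcost b + t)%N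
| exec_while_false b c s :
    ~~ beval s b -> exec (While b c) s s (bcost b)
| exec_while_true b c s1 s2 s3 t1 t2 :
    beval s1 b -> exec c s1 s2 t1 -> exec (While b c) s2 s3 t2 ->
    exec (While b c) s1 s3 (bcost b + t1 + t2)%N.

(* Input: n, m, i and the number T of OMP steps in the integer registers 0 to 3,
   nu in the real register 0, and the data matrix in row-major order at the start
   of the real memory; all else is 0. *)
Definition input_state {R : realType} {m n : nat} (D : 'M[R]_(m, n)) (i : 'I_n)
    (nu : R) (T : nat) : state R :=
  State (nth 0%N [:: n; m; (i : nat); T])
        (nth 0 [:: nu])
        (fun=> 0%N)
        (fun a => if (insub (a %/ n)%N, insub (a %% n)%N) is (Some k, Some j)
                  then D k j else 0).

(* Output: the indicator function of a set of nodes, at the start of the integer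
   memory. *)
Definition output_set {R : realType} {n : nat} (s : state R) : {set 'I_n} :=
  [set j : 'I_n | imem s j != 0%N]%SET.

(* On the data D, the runs of [c] for all the nodes halt on outputs of
   GreedyAndPrune(i, nu, T), after [t] elementary operations altogether. *)
Definition runs_greedy_and_prune {R : realType} {m n : nat} (c : prog)
    (D : 'M[R]_(m, n)) (nu T : R) (t : nat) : Prop :=
  exists (final : 'I_n -> state R) (time : 'I_n -> nat),
    [/\ forall i, exec c (input_state D i nu (num_steps T)) (final i) (time i),
        forall i, greedy_and_prune D i nu T (output_set (final i)) &
        t = \sum_(i < n) time i]%N.

(* Main.v *)
(* On the span of e_i, of the noise direction eps_i = Theta_i / Theta_ii and of
   the columns of a set of at most T nodes, the empirical quadratic form is
   within relative error kappa / 100 of the population form, for all such spans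
   at once: chi-square concentration on a grid net and a union bound, for which
   m of order K log n / kappa^2 suffices. Everything else is deterministic.
   The residual of X_i on S is eps_i + y, where the population energy of y is at
   least kappa^2 / Theta_ii as long as S misses a neighbor of i. Conditional
   covariances are nonnegative because Theta is an M-matrix, so averaging the
   one-column improvements over the missing neighbors shows that a greedy step
   multiplies the excess risk by at most 1 - 1/(3d); after K steps no neighbor
   is missing, and the same two bounds put the pruning threshold strictly between
   the variance changes caused by neighbors and by other nodes.
   For the running time, the program recomputes every residual by Gram-Schmidt
   in O(T^2 m) operations, where x / 0 = 0 takes care of dependent columns. *)

Require Import Defs.
From mathcomp Require Import zify ring lra finmap.
From mathcomp Require Import measurable_realfun lebesgue_integral.
Import HBSimple HBNNSimple.

Set Implicit Arguments.
Unset Strict Implicit.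
Unset Printing Implicit Defensive.

Local Open Scope classical_set_scope.
Local Open Scope ring_scope.

(** * Positive semidefinite forms and Gram-Schmidt *)

(** Two scales must be reconciled. A missing neighbor is worth kappa^2 / Theta_ii in risk, while the
    isometry controls a risk of size 1 / Theta_ii only up to kappa / 100 of it. Hence every risk is
    measured against the empirical energy of eps_i, which is common to all sets S and cancels; what
    remains is the cross term between eps_i and y, and the energy of y. These two directions are
    orthogonal for the population, and polarizing with kappa eps_i + y and kappa eps_i - y makes the
    cross term small against kappa^2 / Theta_ii plus the energy of y. This is how a sample size in 1
    / kappa^2 rather than 1 / kappa^4 suffices. The contraction also needs a starting level, as
    Var(X_i) may be arbitrarily large compared with 1 / Theta_ii. In an attractive model a single
    neighbor already explains X_i up to variance 1 / (kappa^2 Theta_ii), so the contraction is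
    counted from the first selected column; the + 1 in K pays for this step. That the algorithm has
    an output at all is read off the program, whose runs halt on such outputs. *)

Section psd_form.
Context (R : rcfType) (V : lmodType R) (B : V -> V -> R).

(** Definiteness is left out: the empirical form has a kernel as soon as columns of the data are
    dependent. The same lemmas then serve data columns, empirical covariances and population
    covariances. *)
Record psd_form : Prop := PsdForm {
  formC : forall x y, B x y = B y x;
  formDl : forall x y z, B (x + y) z = B x z + B y z;
  formZl : forall a x y, B (a *: x) y = a * B x y;
  form_ge0 : forall x, 0 <= B x x }.

Hypothesis HB : psd_form.

Lemma formDr x y z : B x (y + z) = B x y + B x z.
Proof. by rewrite (formC HB) (formDl HB) !(formC HB x). Qed.

Lemma formZr a x y : B x (a *: y) = a * B x y.
Proof. by rewrite (formC HB) (formZl HB) (formC HB x). Qed.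

Lemma form0l y : B 0 y = 0.
Proof. by rewrite -(scale0r (0 : V)) (formZl HB) mul0r. Qed.

Lemma form0r y : B y 0 = 0.
Proof. by rewrite (formC HB) form0l. Qed.

Lemma formNl x y : B (- x) y = - B x y.
Proof. by rewrite -scaleN1r (formZl HB) mulN1r. Qed.

Lemma formNr x y : B x (- y) = - B x y.
Proof. by rewrite (formC HB) formNl (formC HB x). Qed.

Lemma formBl x y z : B (x - y) z = B x z - B y z.
Proof. by rewrite (formDl HB) formNl. Qed.

Lemma formBr x y z : B x (y - z) = B x y - B x z.
Proof. by rewrite formDr formNr. Qed.

Lemma form_suml I (r : seq I) (P : pred I) (F : I -> V) y :
  B (\sum_(i <- r | P i) F i) y = \sum_(i <- r | P i) B (F i) y.
Proof.
by elim/big_rec2 : _ => [|i a b _ <-]; [exact: form0l|rewrite (formDl HB)].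
Qed.

Lemma form_sumr I (r : seq I) (P : pred I) (F : I -> V) y :
  B y (\sum_(i <- r | P i) F i) = \sum_(i <- r | P i) B y (F i).
Proof. by rewrite (formC HB) form_suml; apply: eq_bigr => i _;
  exact: (formC HB). Qed.

Lemma form_sqrD x y : B (x + y) (x + y) = B x x + 2 * B x y + B y y.
Proof. by rewrite (formDl HB) !formDr (formC HB y x); ring. Qed.

Lemma form_sqrB x y : B (x - y) (x - y) = B x x - 2 * B x y + B y y.
Proof. by rewrite formBl !formBr (formC HB y x); ring. Qed.

Lemma form_sqrZ a x : B (a *: x) (a *: x) = a ^+ 2 * B x x.
Proof. by rewrite (formZl HB) formZr mulrA. Qed.

Lemma form_cauchy_schwarz x y : B x y ^+ 2 <= B x x * B y y.
Proof.
have [y0|y0] := eqVneq (B y y) 0.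
  have h l : 2 * l * B x y <= B x x.
    have := form_ge0 HB (x - l *: y).
    by rewrite form_sqrB form_sqrZ formZr y0; lra.
  have [->|xy] := eqVneq (B x y) 0; first by rewrite y0 expr0n mulr0.
  (* This multiplier would give B x x + 1 <= B x x. *)
  have := h ((B x x + 1) / (2 * B x y)).
  rewrite (_ : 2 * _ * _ = B x x + 1); first lra.
  by field.
have yp : 0 < B y y by rewrite lt_neqAle eq_sym y0 form_ge0.
have := form_ge0 HB (x - (B x y / B y y) *: y).
rewrite form_sqrB form_sqrZ formZr (_ : _ + _ = B x x - B x y ^+ 2 / B y y).
  by rewrite subr_ge0 ler_pdivrMr.
by field.
Qed.

Lemma form_null x y : B y y = 0 -> B x y = 0.
Proof.
move=> y0; apply/eqP; rewrite -sqrf_eq0 eq_le sqr_ge0 andbT.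
by have := form_cauchy_schwarz x y; rewrite y0 mulr0.
Qed.

(** Modified Gram-Schmidt: each coefficient is taken from the vector already reduced, as the program
    does in place. A null [q] gets coefficient 0, and nothing is normalized, so that field
    operations suffice. *)
Definition gs_residual (qs : seq V) (v : V) : V :=
  foldl (fun v q => v - (B v q / B q q) *: q) v qs.

Definition gram_schmidt (vs : seq V) : seq V :=
  foldl (fun qs v => rcons qs (gs_residual qs v)) [::] vs.

Definition orthogonal_seq (qs : seq V) := pairwise (fun p q => B p q == 0) qs.

Definition linear_subspace (W : V -> Prop) : Prop :=
  W 0 /\ forall a x y, W x -> W y -> W (a *: x + y).

Lemma gs_residual_orthogonal qs v q :
  orthogonal_seq qs -> q \in qs -> B (gs_residual qs v) q = 0.
Proof.
move=> oqs qqs.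
(* The first clause, that reduction by vectors orthogonal to [p] keeps the product with [p],
   protects an orthogonality once it is achieved. *)
suff H (s : seq V) : orthogonal_seq s ->
    (forall p, all (fun r => B p r == 0) s -> forall u,
       B (gs_residual s u) p = B u p) /\
    (forall u r, r \in s -> B (gs_residual s u) r = 0).
  by have [_] := H _ oqs; apply.
elim: s => [//|r s IH] /= /andP[rs /IH[IH1 IH2]]; split.
  move=> p /andP[/eqP pr ps] u; rewrite IH1// formBl// (formZl HB).
  by rewrite (formC HB r) pr mulr0 subr0.
move=> u p; rewrite in_cons => /predU1P[->|/IH2//].
rewrite IH1// formBl// (formZl HB).
(* For a null [r] nothing is subtracted, but Cauchy-Schwarz makes every product with [r] vanish. *)
have [r0|r0] := eqVneq (B r r) 0; last by rewrite divfK// subrr.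
by rewrite r0 mulr0 subr0 form_null.
Qed.

Lemma gram_schmidt_rcons vs v : gram_schmidt (rcons vs v) =
  rcons (gram_schmidt vs) (gs_residual (gram_schmidt vs) v).
Proof. by rewrite /gram_schmidt -cats1 foldl_cat. Qed.

Lemma size_gram_schmidt vs : size (gram_schmidt vs) = size vs.
Proof.
elim/last_ind: vs => // vs v IH.
by rewrite gram_schmidt_rcons !size_rcons IH.
Qed.

Lemma gram_schmidt_orthogonal vs : orthogonal_seq (gram_schmidt vs).
Proof.
elim/last_ind: vs => [//|vs v IH]; rewrite gram_schmidt_rcons /orthogonal_seq.
rewrite -cats1 pairwise_cat -[pairwise _ (gram_schmidt vs)]/(orthogonal_seq _)
  IH/= !andbT allrel1r.
by apply/allP => q qs; rewrite /= (formC HB) gs_residual_orthogonal.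
Qed.

Lemma linear_subspaceD W x y : linear_subspace W -> W x -> W y -> W (x + y).
Proof. by move=> [_ h] Wx Wy; rewrite -[x]scale1r; exact: h. Qed.

Lemma linear_subspaceZ W a x : linear_subspace W -> W x -> W (a *: x).
Proof. by move=> [W0 h] Wx; rewrite -[_ *: _]addr0; exact: h. Qed.

Lemma linear_subspaceB W x y : linear_subspace W -> W x -> W y -> W (x - y).
Proof.
by move=> hW Wx Wy; rewrite -scaleN1r; apply: linear_subspaceD => //;
  exact: linear_subspaceZ.
Qed.

Lemma linear_subspace_sum W I (r : seq I) (P : pred I) (F : I -> V) :
  linear_subspace W -> (forall i, P i -> W (F i)) ->
  W (\sum_(i <- r | P i) F i).
Proof.
move=> hW hF; elim/big_rec : _ => [|i x Pi Wx]; first by case: hW.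
by apply: linear_subspaceD => //; exact: hF.
Qed.

Lemma gs_residual_sub W qs v : linear_subspace W ->
  (forall q, q \in qs -> W q) -> W (v - gs_residual qs v).
Proof.
move=> hW; elim: qs v => [|q qs IH] v hq; first by rewrite subrr; case: hW.
rewrite /= (_ : v - _ = (B v q / B q q) *: q +
  (v - (B v q / B q q) *: q - gs_residual qs (v - (B v q / B q q) *: q))).
  apply: linear_subspaceD => //; first apply: linear_subspaceZ => //.
    by apply: hq; exact: mem_head.
  by apply: IH => p pq; apply: hq; rewrite in_cons pq orbT.
by rewrite addrA subrKC.
Qed.

(** Both families have the same span, expressed as lying in the same subspaces. Subspaces stay
    predicates, so that [W] can be a coordinate subspace, an orthogonal complement or the set of
    vectors with a given expansion. *)
Lemma gram_schmidt_span W vs : linear_subspace W ->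
  (forall v, v \in vs -> W v) <-> (forall q, q \in gram_schmidt vs -> W q).
Proof.
move=> hW; elim/last_ind: vs => [//|vs v [IH1 IH2]].
rewrite gram_schmidt_rcons; split => h.
  have hv : forall q, q \in gram_schmidt vs -> W q.
    by apply: IH1 => u us; apply: h; rewrite mem_rcons in_cons us orbT.
  move=> q; rewrite mem_rcons in_cons => /predU1P[->|/hv//].
  rewrite -[gs_residual _ _](subKr v); apply: linear_subspaceB => //.
    by apply: h; rewrite mem_rcons mem_head.
  exact: gs_residual_sub.
have hq : forall q, q \in gram_schmidt vs -> W q.
  by move=> u us; apply: h; rewrite mem_rcons in_cons us orbT.
move=> u; rewrite mem_rcons in_cons => /predU1P[->|us]; last exact: IH2.
rewrite -(subrK (gs_residual (gram_schmidt vs) v) v).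
apply: linear_subspaceD => //; first exact: gs_residual_sub.
by apply: h; rewrite mem_rcons mem_head.
Qed.

Lemma orthogonal_subspace x : linear_subspace (fun y => B x y = 0).
Proof.
split=> [|a y z yx zx]; first by rewrite form0r.
by rewrite formDr formZr yx zx mulr0 addr0.
Qed.

Lemma gs_projection W vs v : linear_subspace W ->
  (forall u, u \in vs -> W u) ->
  W (v - gs_residual (gram_schmidt vs) v) /\
  forall u, u \in vs -> B (gs_residual (gram_schmidt vs) v) u = 0.
Proof.
move=> hW hv; split.
  by apply: gs_residual_sub => //; apply/(gram_schmidt_span vs hW).
apply/(gram_schmidt_span _ (orthogonal_subspace _)) => q qs.
by apply: gs_residual_orthogonal => //; exact: gram_schmidt_orthogonal.
Qed.

End psd_form.

(** * Least squares *)

Section dot_product.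
Context (R : realType) (m : nat).

Definition dotcol (u v : 'cV[R]_m) : R := \sum_(k < m) u k 0 * v k 0.

Lemma dotcol_psd : psd_form dotcol.
Proof.
split=> [x y|x y z|a x y|x].
- by apply: eq_bigr => k _; exact: mulrC.
- by rewrite -big_split; apply: eq_bigr => k _; rewrite mxE mulrDl.
- by rewrite mulr_sumr; apply: eq_bigr => k _; rewrite mxE mulrA.
- by apply: sumr_ge0 => k _; rewrite -expr2 sqr_ge0.
Qed.

Lemma sqnormE (v : 'cV[R]_m) : sqnorm v = dotcol v v.
Proof. by apply: eq_bigr => k _; rewrite expr2. Qed.

End dot_product.

Section supported.
Context (R : realType) (n : nat).

Definition supported (S : {set 'I_n}) (v : 'rV[R]_n) : Prop :=
  forall j, v 0 j != 0 -> j \in S.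

Notation e_ j := (delta_mx 0 j : 'rV[R]_n).

Lemma supported_subspace S : linear_subspace (supported S).
Proof.
split=> [j|a x y hx hy j]; first by rewrite mxE eqxx.
rewrite !mxE; have [xj|xj _] := eqVneq (x 0 j) 0; last exact: hx.
by rewrite xj mulr0 add0r => /hy.
Qed.

Lemma supportedD S u v : supported S u -> supported S v -> supported S (u + v).
Proof. exact: (linear_subspaceD (supported_subspace S)). Qed.

Lemma supportedZ S a v : supported S v -> supported S (a *: v).
Proof. exact: (linear_subspaceZ a (supported_subspace S)). Qed.

Lemma supportedN S v : supported S v -> supported S (- v).
Proof. by move=> hv; rewrite -scaleN1r; exact: supportedZ. Qed.

Lemma supportedB S u v : supported S u -> supported S v -> supported S (u - v).
Proof. by move=> hu hv; apply: supportedD => //; exact: supportedN. Qed.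

Lemma supported_bigsum S I (r : seq I) (P : pred I) (F : I -> 'rV[R]_n) :
  (forall i, P i -> supported S (F i)) ->
  supported S (\sum_(i <- r | P i) F i).
Proof.
move=> hF; elim/big_rec : _ => [|i x Pi]; first by case: (supported_subspace S).
by apply: supportedD; exact: hF.
Qed.

Lemma supported_delta (S : {set 'I_n}) j : j \in S -> supported S (e_ j).
Proof.
by move=> jS k; rewrite mxE eqxx/=; have [->//|_] := eqVneq k j; rewrite eqxx.
Qed.

Lemma supported0 (S : {set 'I_n}) : supported S 0.
Proof. by case: (supported_subspace S). Qed.

Lemma supportedS (S S' : {set 'I_n}) v :
  S \subset S' -> supported S v -> supported S' v.
Proof. by move=> /fintype.subsetP SS' hv j /hv /SS'. Qed.

Lemma supported_eq0 (S : {set 'I_n}) v j : supported S v ->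
  j \notin S -> v 0 j = 0.
Proof. by move=> hv; apply: contraNeq => /hv. Qed.

Lemma supported_sum S v : supported S v -> v = \sum_(j in S) v 0 j *: e_ j.
Proof.
move=> hv; rewrite [LHS]row_sum_delta (bigID (mem S))/=
  [X in _ + X]big1 ?addr0//.
by move=> j /(supported_eq0 hv) ->; rewrite scale0r.
Qed.

Lemma form_supported (B : 'rV[R]_n -> 'rV[R]_n -> R) S x v : psd_form B ->
  supported S v -> (forall j, j \in S -> B x (e_ j) = 0) -> B x v = 0.
Proof.
move=> hB /supported_sum -> h; rewrite (form_sumr hB) big1// => j jS.
by rewrite (formZr hB) h// mulr0.
Qed.

(** Gram-Schmidt yields a projection without inverting the Gram matrix, which may be singular; the
    projection need not be unique. *)
Lemma form_projection (B : 'rV[R]_n -> 'rV[R]_n -> R) S x : psd_form B ->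
  exists2 v, supported S v & forall j, j \in S -> B (x - v) (e_ j) = 0.
Proof.
move=> hB; pose vs := [seq e_ j | j <- enum S].
have [|hv ho] := gs_projection hB (vs := vs) x (supported_subspace S).
  by move=> u /mapP[j]; rewrite mem_enum => jS ->; exact: supported_delta.
exists (x - gs_residual B (gram_schmidt B vs) x) => // j jS.
by rewrite subKr ho//; apply: map_f; rewrite mem_enum.
Qed.

Lemma form_projection_min (B : 'rV[R]_n -> 'rV[R]_n -> R) S x v u :
  psd_form B ->
  supported S v -> (forall j, j \in S -> B (x - v) (e_ j) = 0) ->
  supported S u -> B (x - v) (x - v) <= B (x - u) (x - u).
Proof.
move=> hB hv ho hu.
rewrite (_ : x - u = (x - v) + (v - u)); last by rewrite addrA subrK.
have hvu : supported S (v - u).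
  exact: supportedB.
rewrite [leRHS](form_sqrD hB) (form_supported hB hvu ho) mulr0 addr0.
by rewrite lerDl (form_ge0 hB).
Qed.

End supported.

Notation "''e_' j" := (delta_mx 0 j) (at level 8, j at level 2,
  format "''e_' j") : ring_scope.

(** * The empirical form and its least squares *)

Section empirical.
Context (R : realType) (m n : nat) (D : 'M[R]_(m, n)).

Definition empirical_form (x y : 'rV[R]_n) : R :=
  dotcol (D *m x^T) (D *m y^T).

Lemma empirical_form_psd : psd_form empirical_form.
Proof.
have h := dotcol_psd R m; split=> [x y|x y z|a x y|x].
- exact: (formC h).
- by rewrite /empirical_form linearD/= mulmxDr (formDl h).
- by rewrite /empirical_form linearZ/= -scalemxAr (formZl h).
- exact: (form_ge0 h).
Qed.

Lemma col_residual i (v : 'rV[R]_n) :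
  col i D - D *m v^T = D *m ('e_i - v)^T.
Proof.
rewrite linearB/= mulmxBr; congr (_ - _).
by rewrite trmx_delta -colE.
Qed.

(** Any solution of the normal equations attains the infimum, by Pythagoras. So [min_rss] can be
    evaluated at whichever solution is at hand, including the one found by the program. *)
Lemma min_rss_projection i S v : supported S v ->
  (forall j, j \in S -> empirical_form ('e_i - v) 'e_j = 0) ->
  min_rss D i S = empirical_form ('e_i - v) ('e_i - v).
Proof.
move=> hv ho; apply/eqP; rewrite eq_le; apply/andP; split.
  apply: ge_inf.
    by exists 0 => _ [w _ <-]; rewrite sqnormE (form_ge0 (dotcol_psd _ _)).
  exists v^T; last by rewrite sqnormE col_residual.
  by move=> j /=; rewrite mxE; exact: hv.
apply: lb_le_inf.
  by exists (sqnorm (col i D - D *m 0)); exists 0 => //= j; rewrite mxE eqxx.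
move=> _ [w hw <-]; rewrite -[w]trmxK sqnormE col_residual.
apply: (form_projection_min empirical_form_psd hv ho).
by move=> j; rewrite mxE; exact: hw.
Qed.

Lemma min_rss_attained i S : exists v, [/\ supported S v,
  forall j, j \in S -> empirical_form ('e_i - v) 'e_j = 0 &
  min_rss D i S = empirical_form ('e_i - v) ('e_i - v)].
Proof.
have [v hv ho] := form_projection S 'e_i empirical_form_psd.
by exists v; split => //; exact: min_rss_projection.
Qed.

Lemma min_rss_le i S v : supported S v ->
  min_rss D i S <= empirical_form ('e_i - v) ('e_i - v).
Proof.
move=> hv; have [u [hu ho ->]] := min_rss_attained i S.
exact: (form_projection_min empirical_form_psd hu ho hv).
Qed.

Lemma min_rss_ge0 i S : 0 <= min_rss D i S.
Proof.
by have [u [_ _ ->]] := min_rss_attained i S;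
  exact: (form_ge0 empirical_form_psd).
Qed.

Lemma min_rss_anti i (S S' : {set 'I_n}) : S \subset S' ->
  min_rss D i S' <= min_rss D i S.
Proof.
move=> SS'; have [u [hu _ ->]] := min_rss_attained i S.
by apply: min_rss_le; exact: supportedS hu.
Qed.

End empirical.

(** * The population covariance form *)

Section population.
Context (R : realType) (n : nat) (Sigma : 'M[R]_n).

Definition population_form (x y : 'rV[R]_n) : R := (x *m Sigma *m y^T) 0 0.

Lemma population_form_psd : is_covariance Sigma -> psd_form population_form.
Proof.
move=> [sym ge0]; split=> [x y|x y z|a x y|x]; last exact: ge0.
- rewrite /population_form -[in LHS](trmxK (x *m Sigma *m y^T)) mxE.
  by rewrite !trmx_mul trmxK sym mulmxA.
- by rewrite /population_form !mulmxDl mxE.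
- by rewrite /population_form -!scalemxAl mxE.
Qed.

Lemma population_form_delta x j : population_form x 'e_j = (x *m Sigma) 0 j.
Proof. by rewrite /population_form trmx_delta -colE mxE. Qed.

Lemma population_form_definite : is_covariance Sigma -> Sigma \in unitmx ->
  forall x, x != 0 -> 0 < population_form x x.
Proof.
move=> cov uS x x0; have h := population_form_psd cov.
rewrite lt_neqAle (form_ge0 h) andbT eq_sym; apply: contraNneq x0 => x0.
have : x *m Sigma = 0.
  by apply/rowP => j;
    rewrite -population_form_delta (formC h) (form_null h)// mxE.
by move=> /(congr1 (mulmx^~ (invmx Sigma))); rewrite mulmxK// mul0mx => ->.
Qed.

End population.

(** * Attractive Gaussian graphical models *)

Lemma quotient_sqr_le (F : realFieldType) (a b k t : F) :
  0 < a -> k * (a * b) <= t ^+ 2 -> b * (k / a) <= (- t / a) ^+ 2.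
Proof.
move=> a0 h; rewrite (_ : b * _ = k * (a * b) / a ^+ 2); last first.
  by field; rewrite gt_eqF.
by rewrite exprMn sqrrN exprVn ler_wpM2r// invr_ge0 sqr_ge0.
Qed.

Section ggm.
Context (R : realType) (n : nat) (Sigma : 'M[R]_n) (kappa : R).
Hypothesis cov : is_covariance Sigma.
Hypothesis uS : Sigma \in unitmx.
Local Notation Theta := (invmx Sigma).
Local Notation pop := (population_form Sigma).
Let hp : psd_form pop := population_form_psd cov.

(** Row i of Theta represents the i-th coordinate for the population form. Positivity of the
    diagonal, the bound on coordinates and the orthogonality of the noise direction are instances of
    this duality. *)
Lemma population_form_precision i (x : 'rV[R]_n) : pop (row i Theta) x = x 0 i.
Proof. by rewrite /population_form -row_mul mulVmx// row1 -rowE !mxE. Qed.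

Lemma precision_diag_gt0 i : 0 < Theta i i.
Proof.
have -> : Theta i i = pop (row i Theta) (row i Theta).
  by rewrite population_form_precision mxE.
apply: population_form_definite => //; apply/eqP => h.
have : row i Theta *m Sigma = 0 by rewrite h mul0mx.
rewrite -row_mul mulVmx// row1 => /rowP/(_ i); rewrite !mxE !eqxx/=.
by move/eqP; rewrite oner_eq0.
Qed.

Lemma coordinate_le i (x : 'rV[R]_n) : x 0 i ^+ 2 <= Theta i i * pop x x.
Proof.
have := form_cauchy_schwarz hp (row i Theta) x.
by rewrite !population_form_precision mxE.
Qed.

Definition noise i : 'rV[R]_n := (Theta i i)^-1 *: row i Theta.

Lemma population_form_noise i (x : 'rV[R]_n) : pop (noise i) x =
  x 0 i / Theta i i.
Proof. by rewrite /noise (formZl hp) population_form_precision mulrC. Qed.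

(** Coefficients of the population regression of X_i on all other nodes: - Theta_ij / Theta_ii at j,
    hence supported on the neighbors, and nonnegative in an attractive model. *)
Definition regressor i : 'rV[R]_n := 'e_i - noise i.

Lemma regressorE i j : i != j -> regressor i 0 j = - Theta i j / Theta i i.
Proof.
move=> /negPf ij; rewrite !mxE eq_sym ij andbF sub0r mulrC.
by rewrite mulNr.
Qed.

Lemma regressor_diag i : regressor i 0 i = 0.
Proof. by rewrite !mxE !eqxx/= mulVf ?subrr// gt_eqF// precision_diag_gt0. Qed.

Lemma noise_diag i : noise i 0 i = 1.
Proof. by rewrite !mxE mulVf// gt_eqF// precision_diag_gt0. Qed.

Lemma regressor_supported i : supported (neighbors Theta i) (regressor i).
Proof.
move=> j; rewrite finset.inE; have [->|ij] := eqVneq j i.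
  by rewrite regressor_diag eqxx.
rewrite regressorE; last by rewrite eq_sym.
by apply: contraNneq => ->; rewrite oppr0 mul0r.
Qed.

Hypothesis kappa0 : 0 < kappa.
Hypothesis nondeg : nondegenerate kappa Theta.

Lemma nondegenerate_sqr i j : j \in neighbors Theta i ->
  kappa ^+ 2 * (Theta i i * Theta j j) <= Theta i j ^+ 2.
Proof.
rewrite finset.inE => /andP[ji tij].
have p0 : 0 < Theta i i * Theta j j by rewrite mulr_gt0 ?precision_diag_gt0.
have := nondeg _ tij; rewrite eq_sym => /(_ ji).
rewrite ler_pdivlMr ?sqrtr_gt0// => h.
have : (kappa * Num.sqrt (Theta i i * Theta j j)) ^+ 2 <= `|Theta i j| ^+ 2.
  by apply: lerXn2r; rewrite ?nnegrE ?mulr_ge0 ?sqrtr_ge0 ?(ltW kappa0).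
by rewrite exprMn (sqr_sqrtr (ltW p0)) -normrX ger0_norm ?sqr_ge0.
Qed.

(** Outside S the vector y still carries the coefficient - Theta_ij / Theta_ii of the regressor, and
    [coordinate_le] turns a large coordinate into a large energy. *)
Lemma missing_neighbor_variance i j (S : {set 'I_n}) (y : 'rV[R]_n) :
  j \in neighbors Theta i -> j \notin S -> supported S (y - regressor i) ->
  kappa ^+ 2 / Theta i i <= pop y y.
Proof.
move=> jN jS hy; have ij : i != j.
  by move: jN; rewrite finset.inE eq_sym => /andP[].
have ti := precision_diag_gt0 i; have tj := precision_diag_gt0 j.
have yj : y 0 j = - Theta i j / Theta i i.
  have := supported_eq0 hy jS; rewrite mxE [X in _ + X]mxE => /eqP.
  by rewrite subr_eq0 => /eqP ->; exact: regressorE.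
have := coordinate_le j y; rewrite yj => h.
rewrite -(ler_pM2l tj); apply: le_trans h.
exact: quotient_sqr_le (nondegenerate_sqr jN).
Qed.

Hypothesis attr : attractive Theta.

Lemma regressor_ge0 i j : 0 <= regressor i 0 j.
Proof.
have [->|ij] := eqVneq i j; first by rewrite regressor_diag.
by rewrite regressorE// divr_ge0 ?oppr_ge0 ?attr// ltW// precision_diag_gt0.
Qed.

(* Minimum principle for the M-matrix Theta: test the equation
   [(q Sigma) Theta = q] against the negative part of [q Sigma]. *)
Lemma residual_covariance_ge0 j (S : {set 'I_n}) (v : 'rV[R]_n) k :
  j \notin S -> supported S v ->
  (forall s, s \in S -> pop ('e_j - v) 'e_s = 0) ->
  0 <= pop ('e_j - v) 'e_k.
Proof.
move=> jS hv ho; set q := 'e_j - v; pose y := q *m Sigma.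
have yE l : y 0 l = pop q 'e_l by rewrite population_form_delta.
have yT : y *m Theta = q by rewrite mulmxK.
pose u : 'rV[R]_n := \row_l Num.max (- y 0 l) 0.
have u0 l : 0 <= u 0 l by rewrite mxE le_max lexx orbT.
have uy l : - u 0 l <= y 0 l by rewrite lerNl [u 0 l]mxE le_max lexx.
have uS0 l : l \in S -> u 0 l = 0.
  by move=> lS; rewrite mxE yE ho// oppr0 maxxx.
have uyl l : u 0 l * y 0 l = - (u 0 l * u 0 l).
  rewrite mxE; have [h|h] := leP (- y 0 l) 0; first by rewrite !mul0r oppr0.
  by rewrite mulrNN mulNr.
have h1 : 0 <= \sum_l q 0 l * u 0 l.
  apply: sumr_ge0 => l _; have [lS|lS] := boolP (l \in S).
    by rewrite uS0// mulr0.
  by rewrite mulr_ge0// /q !mxE (supported_eq0 hv lS) subr0 eqxx/=;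
    case: (l == j).
(* Diagonal terms are exact, as u_l y_l = - u_l^2. Off the diagonal the difference is a product of
   the nonnegative factors - Theta_al, u_l and y_a + u_a. *)
have h2 : (u *m Theta *m u^T) 0 0 <= - \sum_l q 0 l * u 0 l.
  rewrite mxE -sumrN; apply: ler_sum => l _.
  have -> : q 0 l = \sum_a y 0 a * Theta a l by rewrite -yT mxE.
  have -> : (u *m Theta) 0 l * u^T l 0 = \sum_a u 0 a * Theta a l * u 0 l.
    by rewrite [(u *m _) 0 l]mxE [u^T l 0]mxE mulr_suml.
  rewrite mulr_suml -sumrN; apply: ler_sum => a _.
  have [->|al] := eqVneq a l.
    have -> : - (y 0 l * Theta l l * u 0 l) = - (u 0 l * y 0 l) * Theta l l
      by ring.
    by rewrite uyl opprK mulrAC.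
  rewrite -subr_ge0.
  rewrite (_ : _ - _ = - Theta a l * u 0 l * (y 0 a + u 0 a)); last by ring.
  rewrite !mulr_ge0 ?oppr_ge0 ?attr//.
  by rewrite -lerBlDr sub0r.
(* The quadratic form of Theta at u is the population energy of u Theta, so that definiteness will
   force u = 0. *)
have h3 : pop (u *m Theta) (u *m Theta) <= 0.
  rewrite /population_form mulmxKV// trmx_mul mulmxA.
  rewrite (_ : Theta^T = Theta); last by rewrite trmx_inv; case: cov => ->.
  by apply: (le_trans h2); rewrite oppr_le0.
have : u *m Theta = 0.
  by apply: contra_leP h3 => /eqP h; exact: population_form_definite.
move/(congr1 (mulmx^~ Sigma)); rewrite mulmxKV// mul0mx => /rowP/(_ k).
by rewrite mxE [in RHS]mxE -yE => h; have := uy k; rewrite mxE h oppr0.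
Qed.

(** Starting level of the greedy selection. Let q be the residual of X_i on X_j and y = q Sigma,
    which is nonnegative with y_j = 0. In entry j of y Theta = q all terms but that of i are
    nonpositive, hence y_i |Theta_ij| <= a. As a^2 <= Theta_jj y_i by [coordinate_le], the variance
    y_i of q is at most Theta_jj / Theta_ij^2, and nondegeneracy concludes. *)
Lemma neighbor_variance i j : j \in neighbors Theta i ->
  exists a, pop ('e_i - a *: 'e_j) ('e_i - a *: 'e_j) <=
    (kappa ^+ 2 * Theta i i)^-1.
Proof.
move=> jN; have := jN; rewrite finset.inE => /andP[ji _].
have ti := precision_diag_gt0 i; have tj := precision_diag_gt0 j.
have [v hv ho] := form_projection [set j]%SET 'e_i hp.
have vE : v = v 0 j *: 'e_j by rewrite {1}(supported_sum hv) big_set1.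
exists (v 0 j); rewrite -vE; set q := 'e_i - v; set a := v 0 j in vE *.
have iS : i \notin [set j]%SET by rewrite finset.inE eq_sym.
have q0 k : 0 <= pop q 'e_k by exact: (residual_covariance_ge0 _ iS hv ho).
pose y := q *m Sigma.
have yE l : y 0 l = pop q 'e_l by rewrite population_form_delta.
have yT : y *m Theta = q by rewrite mulmxK.
have qq : pop q q = y 0 i.
  rewrite {2}/q (formBr hp) (form_supported hp hv ho) subr0 yE.
  by [].
have qj : q 0 j = - a by rewrite !mxE eqxx/= (negPf ji) sub0r.
have ha : y 0 i * - Theta i j <= a.
  have : (y *m Theta) 0 j <= y 0 i * Theta i j.
    rewrite mxE (bigD1 i)//= gerDl; apply: sumr_le0 => l li.
    have [->|lj] := eqVneq l j; first by rewrite yE ho ?mul0r// finset.inE.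
    by rewrite mulr_ge0_le0// ?yE// attr.
  by rewrite yT qj mulrN; lra.
have hc := coordinate_le j q; rewrite qj sqrrN qq in hc.
have hN := nondegenerate_sqr jN.
rewrite qq.
have y0 : 0 <= y 0 i by rewrite yE.
have hT : 0 <= - Theta i j by rewrite oppr_ge0 attr// eq_sym.
have h2 : (y 0 i * - Theta i j) ^+ 2 <= a ^+ 2.
  apply: lerXn2r; rewrite ?nnegrE ?mulr_ge0//.
  by apply: (le_trans _ ha); rewrite mulr_ge0.
have k2 : 0 < kappa ^+ 2 * Theta i i by rewrite mulr_gt0// exprn_gt0.
rewrite -[leRHS]mul1r ler_pdivlMr//.
have [->|yN0] := eqVneq (y 0 i) 0; first by rewrite mul0r.
have yp : 0 < y 0 i by rewrite lt_neqAle eq_sym yN0.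
rewrite -(ler_pM2l yp) -(ler_pM2l tj) mulr1; apply: (le_trans _ hc).
apply: (le_trans _ h2); rewrite exprMn sqrrN.
have : y 0 i ^+ 2 * (kappa ^+ 2 * (Theta i i * Theta j j)) <=
    y 0 i ^+ 2 * Theta i j ^+ 2 by apply: ler_wpM2l => //; exact: sqr_ge0.
by apply: le_trans; rewrite le_eqVlt; apply/orP; left; apply/eqP; ring.
Qed.

End ggm.

(** * Greedy selection and pruning under a restricted isometry *)

Lemma psd_form_scale (R : rcfType) (V : lmodType R) (B : V -> V -> R) c :
  0 <= c -> psd_form B -> psd_form (fun x y => c * B x y).
Proof.
move=> c0 h; split=> [x y|x y z|a x y|x].
- by rewrite (formC h).
- by rewrite (formDl h) mulrDr.
- by rewrite (formZl h) mulrCA.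
- by rewrite mulr_ge0// (form_ge0 h).
Qed.

Lemma sqrt32_inv (F : rcfType) :
  1 / 6 <= (Num.sqrt 32 : F)^-1 /\ (Num.sqrt 32 : F)^-1 <= 1 / 5.
Proof.
have h0 : 0 < Num.sqrt 32 :> F by rewrite sqrtr_gt0.
have h2 : Num.sqrt 32 ^+ 2 = 32 :> F by rewrite sqr_sqrtr.
have h5 : 5 <= Num.sqrt 32 :> F.
  by rewrite -(ler_pXn2r (n := 2)) ?nnegrE ?ltW// h2; lra.
have h6 : Num.sqrt 32 <= 6 :> F.
  by rewrite -(ler_pXn2r (n := 2)) ?nnegrE ?ltW// h2; lra.
by split; rewrite div1r lef_pV2 ?posrE.
Qed.

(** Meant for the degrees-of-freedom factor m / (m - |S|) of the variance estimate. *)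
Lemma ratio_bounds (F : realFieldType) (a M : F) :
  0 < M -> 0 <= a -> 10 * a <= M ->
  1 <= M / (M - a) /\ M / (M - a) <= 10 / 9.
Proof.
move=> M0 a0 aM; have d : 0 < M - a by lra.
by rewrite ler_pdivlMr// ler_pdivrMr//; split; lra.
Qed.

Section greedy.
Context (R : realType) (n m T : nat) (Sigma : 'M[R]_n) (kappa : R)
  (D : 'M[R]_(m, n)) (i : 'I_n).
Hypothesis cov : is_covariance Sigma.
Hypothesis uS : Sigma \in unitmx.
Local Notation Theta := (invmx Sigma).
Local Notation pop := (population_form Sigma).
Local Notation N := (neighbors Theta i).
Local Notation eps := (noise Sigma i).
Local Notation reg := (regressor Sigma i).
Hypothesis kappa01 : 0 < kappa <= 1.
Hypothesis nondeg : nondegenerate kappa Theta.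
Hypothesis attr : attractive Theta.
Hypothesis m0 : (0 < m)%N.
Local Notation M := (m%:R : R).
Hypothesis rip : forall (S : {set 'I_n}) a b v z,
  i \notin S -> (#|S| <= T)%N -> supported S v ->
  z = a *: 'e_i + b *: eps + v ->
  `|empirical_form D z z - M * pop z z| <= kappa / 100 * (M * pop z z).

Let hp : psd_form pop := population_form_psd cov.

Definition mean_form (x y : 'rV[R]_n) := M^-1 * empirical_form D x y.
Local Notation emp := mean_form.

Let Mp : 0 < M. Proof. by rewrite ltr0n. Qed.

Lemma mean_form_psd : psd_form emp.
Proof.
by apply: psd_form_scale; [rewrite invr_ge0 ltW|exact: empirical_form_psd].
Qed.
Let he : psd_form emp := mean_form_psd.

Definition mean_rss (S : {set 'I_n}) : R := M^-1 * min_rss D i S.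
Local Notation h := mean_rss.

Lemma mean_rss_le S v : supported S v -> h S <= emp ('e_i - v) ('e_i - v).
Proof.
move=> hv; apply: ler_wpM2l; first by rewrite invr_ge0 ltW.
exact: min_rss_le.
Qed.

Lemma mean_rss_attained S : exists v, [/\ supported S v,
  forall j, j \in S -> emp ('e_i - v) 'e_j = 0 &
  h S = emp ('e_i - v) ('e_i - v)].
Proof.
have [v [hv ho hm]] := min_rss_attained D i S.
exists v; split => //; last by rewrite /mean_rss hm.
by move=> j /ho; rewrite /mean_form => ->; rewrite mulr0.
Qed.

Lemma mean_rss_ge0 S : 0 <= h S.
Proof. by rewrite mulr_ge0 ?min_rss_ge0// invr_ge0 ltW. Qed.

Let s2 : R := (Theta i i)^-1.

Let s2_gt0 : 0 < s2.
Proof. by rewrite invr_gt0; exact: precision_diag_gt0. Qed.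

Let pop_eps : pop eps eps = s2.
Proof. by rewrite population_form_noise// noise_diag// mul1r. Qed.

Let k2 : R := kappa ^+ 2.

Let k2_01 : 0 < k2 <= 1.
Proof.
have /andP[k0 k1] := kappa01; rewrite exprn_gt0//=.
by rewrite /k2 expr_le1// ltW.
Qed.

Let iN : i \notin N.
Proof. by rewrite finset.inE eqxx. Qed.

Lemma mean_form_rip (S : {set 'I_n}) a b v z : i \notin S -> (#|S| <= T)%N ->
  supported S v -> z = a *: 'e_i + b *: eps + v ->
  (1 - kappa / 100) * pop z z <= emp z z <= (1 + kappa / 100) * pop z z.
Proof.
move=> iS ST hv hz; have := rip iS ST hv hz; rewrite /mean_form.
rewrite ler_norml => /andP[h1 h2].
by rewrite ler_pdivlMl// ler_pdivrMl//; apply/andP; split; lra.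
Qed.

Lemma residual_rip (S : {set 'I_n}) y : i \notin S -> (#|S| <= T)%N ->
  supported S (y - reg) ->
  (99 / 100) * pop y y <= emp y y <= (101 / 100) * pop y y.
Proof.
move=> iS ST hy.
have yE : y = 1 *: 'e_i + (-1) *: eps + (y - reg).
  by rewrite scale1r scaleN1r addrC -/(regressor Sigma i) subrK.
have := mean_form_rip iS ST hy yE.
have := form_ge0 hp y; have /andP[k0 k1] := kappa01.
move: (pop y y) (emp y y) => p e p0 /andP[h1 h2].
have hk : kappa * p <= p by rewrite ler_piMl.
by apply/andP; split; lra.
Qed.

(** Polarization with kappa eps + y and kappa eps - y: both have population energy k2 s2 + pop y y
    since pop eps y = 0, and dividing the relative error kappa / 100 by the weight kappa leaves an
    absolute constant. Weight 1 would leave an error of order kappa s2. *)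
Lemma noise_cross_le (S : {set 'I_n}) y : i \notin S -> (#|S| <= T)%N ->
  supported S (y - reg) ->
  `|emp eps y| <= (k2 * s2 + pop y y) / 200.
Proof.
move=> iS ST hy; have /andP[k0 k1] := kappa01.
have y0 : pop eps y = 0.
  rewrite population_form_noise//.
  have := supported_eq0 hy iS; rewrite mxE [X in _ + X]mxE regressor_diag//.
  by rewrite subr0 => ->; rewrite mul0r.
have hNy : supported S (- (y - reg)).
  exact: supportedN.
have yEp : kappa *: eps + y = 1 *: 'e_i + (kappa - 1) *: eps + (y - reg).
  by apply/rowP => k; rewrite !mxE; ring.
have yEm : kappa *: eps - y = (-1) *: 'e_i + (kappa + 1) *: eps + (- (y - reg)).
  by apply/rowP => k; rewrite !mxE; ring.
have := mean_form_rip iS ST hy yEp.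
have := mean_form_rip iS ST hNy yEm.
rewrite (form_sqrB hp) (form_sqrB he) (form_sqrD hp) (form_sqrD he).
rewrite !(formZl hp kappa) !(formZl he kappa) y0 !(formZr hp kappa)
  !(formZr he kappa).
rewrite pop_eps.
rewrite /k2; move: (pop y y) (emp y y) (emp eps eps) (emp eps y) s2 =>
  p e a b s.
move=> /andP[h1 h2] /andP[h3 h4].
rewrite -(ler_pM2l k0) -{1}(gtr0_norm k0) -normrM ler_norml.
by apply/andP; split; lra.
Qed.

(* The residual of X_i on S is eps + y with y in reg + R^S, which splits the
   excess risk into a cross term and the energy of y. *)
Lemma excess_decomposition (S : {set 'I_n}) : i \notin S -> (#|S| <= T)%N ->
  exists y, [/\ supported S (y - reg),
    (forall j, j \in S -> emp (eps + y) 'e_j = 0),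
    h S = emp (eps + y) (eps + y) &
    h S - emp eps eps = 2 * emp eps y + emp y y].
Proof.
move=> iS ST; have [v [hv ho hm]] := mean_rss_attained S.
exists (reg - v).
have eE : eps + (reg - v) = 'e_i - v by apply/rowP => k; rewrite !mxE; ring.
split.
- by rewrite addrAC subrr sub0r; exact: supportedN.
- by rewrite eE.
- by rewrite eE.
- by rewrite hm -eE (form_sqrD he); ring.
Qed.

(** The regressor is then an admissible choice, with residual eps. *)
Lemma excess_le0 (S : {set 'I_n}) : N \subset S -> h S <= emp eps eps.
Proof.
move=> NS; have -> : eps = 'e_i - reg by rewrite /regressor opprB subrKC.
by apply: mean_rss_le; apply: (supportedS NS); exact: regressor_supported.
Qed.

(** Bounds the overfitting: the energy of y absorbs the cross term except for its part in k2 s2. *)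
Lemma excess_ge (S : {set 'I_n}) : i \notin S -> (#|S| <= T)%N ->
  emp eps eps - k2 * s2 / 100 <= h S.
Proof.
move=> iS ST; have [y [hy _ _ hF]] := excess_decomposition iS ST.
have /andP[h1 _] := residual_rip iS ST hy.
have := noise_cross_le iS ST hy; rewrite ler_norml => /andP[h2 _].
by have := form_ge0 hp y; lra.
Qed.

Lemma excess_missing (S : {set 'I_n}) : i \notin S -> (#|S| <= T)%N ->
  ~~ (N \subset S) ->
  97 / 100 * (k2 * s2) <= h S - emp eps eps.
Proof.
move=> iS ST /fintype.subsetPn[j jN jS].
have [y [hy _ _ hF]] := excess_decomposition iS ST.
have /andP[h1 _] := residual_rip iS ST hy.
have := noise_cross_le iS ST hy; rewrite ler_norml => /andP[h2 _].
have := missing_neighbor_variance cov uS (andP kappa01).1 nondeg jN jS hy.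
by rewrite hF -/k2 -/s2; lra.
Qed.

Lemma noise_energy : 99 / 100 * s2 <= emp eps eps <= 101 / 100 * s2.
Proof.
have S0 : i \notin (finset.set0 : {set 'I_n}) by rewrite finset.inE.
have e : eps = 0 *: 'e_i + 1 *: eps + 0 by rewrite scale0r add0r scale1r addr0.
have := mean_form_rip S0 _ (supported0 _) e; rewrite cards0 => /(_ isT).
rewrite pop_eps; have /andP[k0 k1] := kappa01.
have hk : kappa * s2 <= s2 by rewrite ler_piMl// ltW.
by move=> /andP[h1 h2]; apply/andP; split; lra.
Qed.

(* Averaging over the missing neighbors: perturb the residual r = eps + y along
   w_j q_j, where q_j is the population residual of X_j on S. Nonnegativity of
   the covariances of the q_j bounds the sum of the quadratic terms by the
   energy of y. *)
Lemma greedy_progress (S : {set 'I_n}) : i \notin S -> (#|S| < T)%N ->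
  ~~ (N \subset S) -> exists2 j, j \in N :\: S &
    h (j |: S)%SET <= h S - (h S - emp eps eps) / (3 * #|N|%:R).
Proof.
move=> iS ST NS; have ST' := ltnW ST.
have [j0 j0N j0S] := fintype.subsetPn NS.
have [y [hy ho hm hF]] := excess_decomposition iS ST'.
have /andP[h1 h1'] := residual_rip iS ST' hy.
have := noise_cross_le iS ST' hy; rewrite ler_norml => /andP[h2 h2'].
have hk := missing_neighbor_variance cov uS (andP kappa01).1 nondeg j0N j0S hy.
rewrite -/k2 -/s2 in hk.
have N0 : 0 < #|N|%:R :> R by rewrite ltr0n; apply/card_gt0P; exists j0.
set p := pop y y in h1 h1' h2 h2' hk.
have p0 : 0 < p.
  by apply: lt_le_trans hk; rewrite mulr_gt0//; case/andP: k2_01.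
have Fp : h S - emp eps eps <= 103 / 100 * p by rewrite hF; lra.
(* Otherwise every missing neighbor improves the risk by less than p / (2 |N|), as 103 / 300 <= 1 /
   2. *)
apply: contrapT => hno.
have hgt j : j \in N :\: S -> h S - p / (2 * #|N|%:R) < h (j |: S)%SET.
  move=> jNS; rewrite ltNge; apply/negP => hle; apply: hno; exists j => //.
  apply: (le_trans hle); rewrite lerD2l lerN2.
  rewrite !invfM !mulrA ler_pM2r ?invr_gt0//; lra.
have proj j : exists v, supported S v /\
    (forall k, k \in S -> pop ('e_j - v) 'e_k = 0).
  by have [v hv hv'] := form_projection S 'e_j hp; exists v.
have {proj}/choice[v hv] := proj.
pose q j := 'e_j - v j.
pose w j := reg 0 j.
have w0 j : 0 <= w j by exact: regressor_ge0.
have qemp j : emp (eps + y) (q j) = emp (eps + y) 'e_j.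
  have [hvj _] := hv j.
  by rewrite /q (formBr he) (form_supported he hvj ho) subr0.
have step j : j \in N :\: S -> - (p / (2 * #|N|%:R)) <
    w j ^+ 2 * emp (q j) (q j) - 2 * (w j * emp (eps + y) 'e_j).
  move=> jNS; have := hgt j jNS.
  have hs : supported (j |: S)%SET (reg - y + w j *: q j).
    apply: supportedD; last apply: supportedZ.
      rewrite -[_ - _]opprB; apply: supportedN.
      by apply: supportedS hy; exact: finset.subsetUr.
    apply: supportedB.
      by apply: supported_delta; rewrite finset.inE finset.set11.
    by case: (hv j) => hvj _; apply: supportedS hvj; exact: finset.subsetUr.
  have := mean_rss_le hs.
  rewrite (_ : 'e_i - _ = eps + y - w j *: q j); last first.
    by apply/rowP => k; rewrite !mxE; ring.
  by rewrite (form_sqrB he) (form_sqrZ he) (formZr he) qemp -hm; lra.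
have rip_q j : j \in N :\: S -> emp (q j) (q j) <= 101 / 100 * pop (q j) (q j).
  rewrite finset.inE => /andP[jS jN].
  have iSj : i \notin (j |: S)%SET.
    by rewrite !finset.inE negb_or iS andbT; apply/eqP => ij;
      move: jN; rewrite -ij (negPf iN).
  have cSj : (#|j |: S|%SET <= T)%N by rewrite cardsU1 jS.
  have hsq : supported (j |: S)%SET (q j).
    apply: supportedB.
      by apply: supported_delta; rewrite finset.inE finset.set11.
    by case: (hv j) => hvj _; apply: supportedS hvj; exact: finset.subsetUr.
  have e : q j = 0 *: 'e_i + 0 *: eps + q j by rewrite !scale0r !add0r.
  have /andP[_] := mean_form_rip iSj cSj hsq e.
  have := form_ge0 hp (q j); have /andP[k0 k1] := kappa01.
  move: (pop (q j) (q j)) (emp (q j) (q j)) => a b a0.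
  have hka : kappa * a <= a by rewrite ler_piMl.
  lra.
(* The part of y that is population-orthogonal to the columns of S, because y - Q is supported on
   S. *)
pose Q := \sum_(j in N :\: S) w j *: q j.
have QE : supported S (y - Q).
  have -> : y - Q = (y - reg) + (reg - \sum_(j in N :\: S) w j *: 'e_j) +
      \sum_(j in N :\: S) w j *: v j.
    rewrite addrA subrK -addrA; congr (_ + _);
      rewrite /Q -sumrN -[X in X + _]sumrN -big_split/=.
    by apply: eq_bigr => j _; rewrite /q scalerBr opprB addrC.
  apply: supportedD; first apply: supportedD => //.
    rewrite {1}(supported_sum (@regressor_supported _ _ _ cov uS i)).
    rewrite (finset.big_setID S)/= addrK.
    apply: supported_bigsum => j.
    rewrite finset.inE => /andP[_ jS].
    by apply: supportedZ; exact: supported_delta.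
  apply: supported_bigsum => j _.
  by apply: supportedZ; case: (hv j).
have qS j u : supported S u -> pop (q j) u = 0.
  by move=> hu; apply: (form_supported hp hu); case: (hv j).
have Qenergy : \sum_(j in N :\: S) w j ^+ 2 * pop (q j) (q j) <= p.
  have QS : pop Q (y - Q) = 0.
    rewrite (form_suml hp) big1// => j _.
    by rewrite (formZl hp (w j)) qS ?mulr0.
  have -> : p = pop Q Q + pop (y - Q) (y - Q).
    by rewrite /p -{1 2}(subrK Q y) addrC (form_sqrD hp) QS; ring.
  apply: (@le_trans _ _ (pop Q Q)); last by rewrite lerDl (form_ge0 hp).
  rewrite {1}/Q (form_suml hp); apply: ler_sum => j jNS.
  rewrite (formZl hp (w j)) /Q (form_sumr hp) (bigD1 j)//= mulrDr.
  rewrite (formZr hp (w j)) mulrA -expr2 lerDl mulr_ge0// sumr_ge0// => k _.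
  rewrite (formZr hp (w k)) mulr_ge0//.
  have [hvk _] := hv k.
  rewrite [q k]/q (formBr hp) (qS j _ hvk) subr0.
  move: jNS; rewrite finset.inE => /andP[jS _].
  by case: (hv j) => h3 h4;
    exact: (residual_covariance_ge0 cov uS attr k jS h3 h4).
(* As eps + y is empirically orthogonal to S, its weighted correlations with the missing columns add
   up to emp (eps + y) y, whose main part is the energy of y. *)
have cross : 98 / 100 * p <= \sum_(j in N :\: S) w j * emp (eps + y) 'e_j.
  have <- : emp (eps + y) y = \sum_(j in N :\: S) w j * emp (eps + y) 'e_j.
    rewrite -[X in mean_form _ X = _](subrK Q) (formDr he)
      (form_supported he QE ho) add0r.
    rewrite (form_sumr he); apply: eq_bigr => j _.
    by rewrite (formZr he (w j)) qemp.
  by rewrite (formDl he); lra.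
(* The left side is at least - p / 2 and the right side at most 101/100 p - 196/100 p, a
   contradiction. *)
have : \sum_(j in N :\: S) - (p / (2 * #|N|%:R)) <
    \sum_(j in N :\: S)
      (w j ^+ 2 * emp (q j) (q j) - 2 * (w j * emp (eps + y) 'e_j)).
  apply: ltr_sum; last exact: step.
  apply/hasP; exists j0; first by rewrite mem_index_enum.
  by rewrite finset.inE j0N j0S.
rewrite sumrB -mulr_sumr sumr_const.
have : \sum_(j in N :\: S) w j ^+ 2 * emp (q j) (q j) <= 101 / 100 * p.
  apply: (@le_trans _ _
    (101 / 100 * \sum_(j in N :\: S) w j ^+ 2 * pop (q j) (q j))).
    rewrite mulr_sumr; apply: ler_sum => j jNS.
    by rewrite [leRHS]mulrCA ler_wpM2l ?sqr_ge0// rip_q.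
  by rewrite ler_pM2l//; lra.
have : - (p / 2) <= - (p / (2 * #|N|%:R)) *+ #|N :\: S|.
  rewrite -[_ *+ #|_|]mulr_natr mulNr lerN2.
  have hc : #|N :\: S|%:R <= #|N|%:R :> R.
    by rewrite ler_nat; apply: subset_leq_card; exact: finset.subsetDl.
  move: N0 hc; move: (#|N|%:R) (#|N :\: S|%:R) => a c a0 ca.
  rewrite (_ : p / 2 = p / (2 * a) * a); last by field; rewrite gt_eqF.
  by rewrite ler_wpM2l// divr_ge0// ?ltW// mulr_gt0.
lra.
Qed.

Let E0 : R := emp eps eps.

Lemma first_step j : (0 < T)%N -> j \in N ->
  h [set j]%SET <= 101 / 100 * (s2 / k2).
Proof.
move=> T0 jN;
  have [a ha] := neighbor_variance cov uS (andP kappa01).1 nondeg attr jN.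
have ij : i \notin [set j]%SET.
  by rewrite finset.inE; apply: contraTneq jN => <-.
have hs : supported [set j]%SET (a *: 'e_j).
  by apply: supportedZ; apply: supported_delta; rewrite finset.set11.
apply: (le_trans (mean_rss_le hs)).
have zE : 'e_i - a *: 'e_j = 1 *: 'e_i + 0 *: eps + - (a *: 'e_j).
  by rewrite scale1r scale0r addr0.
have c1 : (#|[set j]%SET| <= T)%N by rewrite cards1.
have := mean_form_rip ij c1 (supportedN hs) zE.
move: ha; rewrite invfM mulrC -/s2 -/k2.
have := form_ge0 hp ('e_i - a *: 'e_j); have /andP[k0 k1] := kappa01.
move: (pop _ _) (emp _ _) => p e p0 hpa /andP[_ hpe].
have hk : kappa * p <= p by rewrite ler_piMl.
lra.
Qed.

Lemma omp_card t S : omp D i t S -> i \notin S /\ (#|S| <= t)%N.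
Proof.
elim=> {t S} [|t S j _ [iS St] _ ji _|t S _ [iS St] _].
- by rewrite finset.inE cards0.
- rewrite !finset.inE negb_or eq_sym ji iS; split => //.
  by rewrite cardsU1; case: (j \notin S); rewrite /= ?add1n ?add0n// leqW.
- by split => //; exact: leqW.
Qed.

(** The exponent is t - 1 because the first selected column only brings the risk down to the level
    of [first_step]. A neighbor missing at the end was missing all along, so every later step made
    the progress of [greedy_progress], whose column the greedy choice can only improve upon. *)
Lemma omp_contraction t S : omp D i t S -> (0 < t <= T)%N ->
  ~~ (N \subset S) ->
  h S - E0 <= (1 - (3 * #|N|%:R)^-1) ^+ t.-1 * (101 / 100 * (s2 / k2)).
Proof.
(* In the stopping case all other columns are selected and no neighbor can be missing. *)
elim=> {t S} [//|t S j hS IH _ ji hmin /andP[_ tT] NS|t S _ _ -> _]; last first.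
  by move=> /fintype.subsetPn[j jN]; rewrite !finset.inE negbK => /eqP ji;
    move: jN; rewrite ji (negPf iN).
have [iS St] := omp_card hS.
have hmin' k : k != i -> h (j |: S)%SET <= h (k |: S)%SET.
  by move=> ki; apply: ler_wpM2l; [rewrite invr_ge0 ltW|exact: hmin].
have [j0 j0N _] := fintype.subsetPn NS.
have j0i : j0 != i by move: j0N; rewrite finset.inE => /andP[].
have E00 : 0 <= E0 by exact: (form_ge0 he).
have [t0|t0] := posnP t.
  move: St; rewrite t0 leqn0 cards_eq0 => /eqP S0.
  rewrite /= expr0 mul1r; apply: (@le_trans _ _ (h (j |: S)%SET)).
    by rewrite gerDl oppr_le0.
  apply: (le_trans (hmin' j0 j0i)); rewrite S0 finset.setU0.
  by apply: first_step => //; exact: leq_ltn_trans tT.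
have NS' : ~~ (N \subset S).
  by apply: contra NS => h'; apply: (fintype.subset_trans h');
    exact: finset.subsetUr.
have {IH} := IH _ NS'; rewrite t0 ltnW// => /(_ isT) IH.
have [k kNS hk] := greedy_progress iS (leq_ltn_trans St tT) NS'.
have ki : k != i by move: kNS; rewrite !finset.inE => /andP[_ /andP[]].
have N0 : 1 <= #|N|%:R :> R by rewrite ler1n; apply/card_gt0P; exists j0.
have rho0 : 0 <= 1 - (3 * #|N|%:R)^-1 :> R.
  by rewrite subr_ge0 invf_le1; lra.
rewrite /= -(prednK t0) exprS -mulrA.
apply: (@le_trans _ _ ((1 - (3 * #|N|%:R)^-1) * (h S - E0))); last first.
  by rewrite ler_wpM2l.
have := hmin' _ ki => hjk.
move: hk; rewrite -/E0; lra.
Qed.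

Lemma omp_neighbors (d : nat) S : (#|N| <= d)%N ->
  64 * d%:R * ln (4 / k2) + 1 <= T%:R -> omp D i T S -> N \subset S.
Proof.
move=> Nd hT hS; apply/negPn/negP => NS.
have [iS ST] := omp_card hS.
have [j0 j0N _] := fintype.subsetPn NS.
have N0 : 1 <= #|N|%:R :> R by rewrite ler1n; apply/card_gt0P; exists j0.
have Ndr : #|N|%:R <= d%:R :> R by rewrite ler_nat.
have /andP[k20 k21] := k2_01.
have k4 : 0 < 4 / k2 by rewrite divr_gt0.
have k41 : 1 <= 4 / k2 by rewrite ler_pdivlMr; lra.
have L0 : 0 <= ln (4 / k2) by exact: ln_ge0.
have T0 : (0 < T)%N.
  rewrite -(ltr_nat R); apply: lt_le_trans hT.
  by rewrite ltr_wpDl// !mulr_ge0.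
have hF := excess_missing iS ST NS.
have := omp_contraction hS; rewrite T0 leqnn => /(_ isT NS) hC.
(* Through exp(- (T - 1) / (3 |N|)) <= exp(- 2 log (4 / k2)). Times the starting level s2 / k2 this
   is about k2 s2 / 16, below the 97/100 k2 s2 that a missing neighbor costs. *)
have rho : (1 - (3 * #|N|%:R)^-1) ^+ T.-1 <= (k2 / 4) ^+ 2.
  have h1 : (1 - (3 * #|N|%:R)^-1) ^+ T.-1 <=
      expR (- (3 * #|N|%:R)^-1) ^+ T.-1 :> R.
    apply: lerXn2r; [|exact: expR_ge0|exact: expR_ge1Dx].
    by rewrite nnegrE subr_ge0 invf_le1; lra.
  apply: (le_trans h1).
  rewrite -expRM_natl.
  have -> : k2 / 4 = expR (- ln (4 / k2)).
    by rewrite expRN lnK ?posrE// invf_div.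
  rewrite -expRM_natl ler_expR !mulrN lerN2.
  have hT1 : 64 * d%:R * ln (4 / k2) <= T.-1%:R :> R.
    by move: hT; rewrite -[in T%:R](prednK T0) -natr1; lra.
  rewrite ler_pdivlMr; last lra.
  apply: le_trans hT1; rewrite mulrC mulrA.
  rewrite ler_wpM2r//; lra.
have c0 : 0 < s2 / k2 by rewrite divr_gt0.
have : h S - E0 <= (k2 / 4) ^+ 2 * (101 / 100 * (s2 / k2)).
  by apply: (le_trans hC); rewrite ler_wpM2r// mulr_ge0 ?ltW//.
have -> : (k2 / 4) ^+ 2 * (101 / 100 * (s2 / k2)) = 101 / 1600 * (k2 * s2).
  by field; rewrite gt_eqF.
have : 0 < k2 * s2 by rewrite mulr_gt0.
by move: hF; rewrite -/E0; lra.
Qed.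


(** * Pruning with the threshold of the greedy output *)

Section prune.
Hypothesis size_le : forall S : {set 'I_n}, i \notin S -> (#|S| <= T)%N ->
  10 * #|S|%:R <= M.
Hypothesis m_large : 20 <= k2 * M.

Lemma hat_varE S : hat_var D i S = M / (M - #|S|%:R) * h S.
Proof.
by rewrite /hat_var /mean_rss [M / _]mulrC -mulrA mulVKf// gt_eqF.
Qed.

Let thr (S0 : {set 'I_n}) := kappa ^+ 2 / Num.sqrt 32 / hat_Theta D i S0.

(** In units of k2 s2, this window separates the change due to a node outside N, at most 1 / 50,
    from the change due to a neighbor, at least 1 / 2. *)
Lemma threshold_bounds (S0 : {set 'I_n}) : i \notin S0 -> (#|S0| <= T)%N ->
  N \subset S0 -> 8 / 50 * (k2 * s2) <= thr S0 <= 1 / 4 * (k2 * s2).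
Proof.
move=> iS ST NS; rewrite /thr /hat_Theta invrK hat_varE.
have := size_le iS ST; move: (#|S0|%:R) (ler0n R #|S0|) => a a0 aM.
have := excess_le0 NS; have := excess_ge iS ST.
move: (h S0) => x h1 h2; have /andP[e1 e2] := noise_energy.
have /andP[k20 k21] := k2_01.
have ks : k2 * s2 <= s2 by rewrite ler_piMl// ltW.
have ks0 : 0 < k2 * s2 by rewrite mulr_gt0.
have [q1 q2] := sqrt32_inv R; rewrite -/k2.
have [r1 r2] := ratio_bounds Mp a0 aM.
move: (M / (M - a)) r1 r2 => r r1 r2.
have x1 : 98 / 100 * s2 <= x by lra.
have x2 : x <= 101 / 100 * s2 by lra.
have y1 : 98 / 100 * s2 <= r * x.
  by apply: (le_trans x1); rewrite ler_peMl//; lra.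
have y2 : r * x <= 10 / 9 * (101 / 100 * s2).
  by apply: ler_pM => //; lra.
move: (r * x) y1 y2 => y y1 y2; move: (Num.sqrt 32)^-1 q1 q2 => q q1 q2.
rewrite -mulrA; apply/andP; split.
  have : k2 * (1 / 6 * (98 / 100 * s2)) <= k2 * (q * y).
    by rewrite ler_pM2l//; apply: ler_pM => //; lra.
  lra.
have : k2 * (q * y) <= k2 * (1 / 5 * (10 / 9 * (101 / 100 * s2))).
  by rewrite ler_pM2l//; apply: ler_pM => //; lra.
lra.
Qed.

Lemma prune_nonneighbor (S : {set 'I_n}) j : i \notin S -> (#|S| <= T)%N ->
  N \subset S -> j \notin N -> j \in S ->
  hat_var D i (S :\ j)%SET - hat_var D i S <= 1 / 50 * (k2 * s2).
Proof.
move=> iS ST NS jN jS; rewrite !hat_varE.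
have NSj : N \subset (S :\ j)%SET by rewrite finset.subsetD1 NS.
have := excess_le0 NSj; have := excess_ge iS ST; have := mean_rss_ge0 S.
have cS : #|S|%:R = 1 + #|(S :\ j)%SET|%:R :> R
  by rewrite (cardsD1 j S) jS natrD.
have := size_le iS ST; rewrite cS.
move: (#|(S :\ j)%SET|%:R) (ler0n R #|(S :\ j)%SET|) => a a0 aM.
move: (h S) (h (S :\ j)%SET) => x y x0 h1 h2.
have /andP[k20 k21] := k2_01.
have ks0 : 0 < k2 * s2 by rewrite mulr_gt0.
(* Dropping a column shrinks the degrees-of-freedom factor, which acts in favor of the upper
   bound. *)
have r1 : M / (M - a) <= M / (M - (1 + a)).
  by rewrite ler_pM2l// lef_pV2 ?posrE; lra.
have aM' : 10 * a <= M by lra.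
have [r0 r2] := ratio_bounds Mp a0 aM'.
move: (M / (M - a)) (M / (M - (1 + a))) r0 r1 r2 => r r' r0 r1 r2.
have : r * x <= r' * x by rewrite ler_wpM2r.
have : r * (y - x) <= r * (k2 * s2 / 100) by rewrite ler_wpM2l//; lra.
have : r * (k2 * s2 / 100) <= 10 / 9 * (k2 * s2 / 100).
  by rewrite ler_wpM2r//; lra.
lra.
Qed.

Lemma prune_neighbor (S : {set 'I_n}) j : i \notin S -> (#|S| <= T)%N ->
  N \subset S -> j \in N ->
  1 / 2 * (k2 * s2) <= hat_var D i (S :\ j)%SET - hat_var D i S.
Proof.
move=> iS ST NS jN; rewrite !hat_varE.
have jS : j \in S by exact: (fintype.subsetP NS).
have NSj : ~~ (N \subset (S :\ j)%SET).
  by rewrite finset.subsetD1 jN andbF.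
have iSj : i \notin (S :\ j)%SET by rewrite !finset.inE negb_and iS orbT.
have cSj : (#|(S :\ j)%SET| <= T)%N.
  by apply: leq_trans ST; apply: subset_leq_card; exact: finset.subD1set.
have := excess_missing iSj cSj NSj; have := excess_le0 NS;
  have := mean_rss_ge0 S.
have cS : #|S|%:R = 1 + #|(S :\ j)%SET|%:R :> R
  by rewrite (cardsD1 j S) jS natrD.
have := size_le iS ST; rewrite cS.
move: (#|(S :\ j)%SET|%:R) (ler0n R #|(S :\ j)%SET|) => a a0 aM.
move: (h S) (h (S :\ j)%SET) => x y x0 h1 h2.
have /andP[k20 k21] := k2_01; have /andP[_ e2] := noise_energy.
have ks0 : 0 < k2 * s2 by rewrite mulr_gt0.
have d1 : 0 < M - a by lra.
have d2 : 0 < M - (1 + a) by lra.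
(* Here the shrinking factor acts against the bound and costs x / (M - (1 + a)), of order s2 / M;
   [m_large] makes it at most k2 s2 / 10. *)
have E : M / (M - a) * y - M / (M - (1 + a)) * x =
    M / (M - a) * (y - x - x / (M - (1 + a))).
  by field; rewrite !gt_eqF.
have hx : x / (M - (1 + a)) <= 1 / 10 * (k2 * s2).
  rewrite ler_pdivrMr//.
  have : 18 * s2 <= k2 * s2 * (M - (1 + a)).
    have h9 : 9 / 10 * M <= M - (1 + a) by lra.
    have : k2 * s2 * (9 / 10 * M) <= k2 * s2 * (M - (1 + a))
      by rewrite ler_pM2l.
    have : 20 * s2 <= k2 * M * s2 by rewrite ler_pM2r.
    lra.
  lra.
have aM' : 10 * a <= M by lra.
have [r1 _] := ratio_bounds Mp a0 aM'.
rewrite E; apply: (@le_trans _ _ (y - x - x / (M - (1 + a)))); first lra.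
by rewrite ler_peMl//; lra.
Qed.

(** Generalized for the induction: S is the current set and s the nodes still to be tested, while
    the threshold remains that of S0. *)
Lemma prune_correct (S0 S : {set 'I_n}) s : i \notin S0 -> (#|S0| <= T)%N ->
  N \subset S0 -> N \subset S -> S \subset S0 -> uniq s ->
  {subset s <= S} -> (forall x, x \in S -> x \notin N -> x \in s) ->
  foldl (prune_step D i (thr S0)) S s = N.
Proof.
move=> iS0 S0T NS0.
have /andP[t1 t2] := threshold_bounds iS0 S0T NS0.
have /andP[k20 k21] := k2_01.
have ks0 : 0 < k2 * s2 by rewrite mulr_gt0.
elim: s S => [|j s IH] S NS SS0 /=.
  move=> _ _ hN; apply/eqP; rewrite finset.eqEsubset NS andbT.
  by apply/fintype.subsetP => x xS; apply/negPn/negP => /(hN _ xS).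
move=> /andP[js us] sS hN.
have iS : i \notin S by apply: contra iS0; exact: (fintype.subsetP SS0).
have ST : (#|S| <= T)%N by apply: leq_trans S0T; exact: subset_leq_card.
have jS : j \in S by apply: sS; exact: mem_head.
have sS' : {subset s <= S} by move=> x xs; apply: sS; rewrite in_cons xs orbT.
have [jN|jN] := boolP (j \in N).
  have -> : prune_step D i (thr S0) S j = S.
    rewrite /prune_step; case: ifPn => // hlt; exfalso.
    by have := prune_neighbor iS ST NS jN; lra.
  apply: IH => // x xS xN; have := hN x xS xN;
    rewrite in_cons => /predU1P[xj|//].
  by move: xN; rewrite xj jN.
have -> : prune_step D i (thr S0) S j = (S :\ j)%SET.
  rewrite /prune_step; case: ifPn => // hlt; exfalso; rewrite -leNgt in hlt.
  by have := prune_nonneighbor iS ST NS jN jS; lra.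
apply: IH => //.
- by rewrite finset.subsetD1 NS.
- by apply: fintype.subset_trans SS0; exact: finset.subD1set.
- move=> x xs; rewrite !finset.inE sS' // andbT.
  by apply: contraNneq js => <-.
- move=> x /finset.setD1P[xj xS] xN.
  by have := hN x xS xN; rewrite in_cons (negPf xj).
Qed.

End prune.

End greedy.

(** * A grid net for quadratic forms *)

Lemma halving_step (F : realFieldType) (t a : F) : 0 < t -> 0 <= a ->
  t + (2 * t + a) / 4 <= 2 * t + a / 2.
Proof. by move=> t0 a0; lra. Qed.

Section net.
Context (R : realType) (V : lmodType R) (Q : V -> V -> R).
Hypothesis hQ : psd_form Q.
Hypothesis Qdef : forall x, Q x x = 0 -> x = 0.
Variable vs : seq V.
Local Notation k := (size vs).

Let q (a : 'I_k) : V := nth 0 (gram_schmidt Q vs) a.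

(** Zero where [vs] is dependent: the family is orthonormal up to zeros, and its size is always
    k. *)
Definition orthonormal_vector (a : 'I_k) : V := (Num.sqrt (Q (q a) (q a)))^-1 *:
  q a.
Local Notation b := orthonormal_vector.

Let q_orth a c : a != c -> Q (q a) (q c) = 0.
Proof.
move=> ac; wlog lac : a c ac / (a < c)%N => [hw|].
  have [/hw|lca|/val_inj] := ltngtP a c; first exact.
    by rewrite (formC hQ); apply: hw => //; rewrite eq_sym.
  by move/eqP: ac.
have := gram_schmidt_orthogonal hQ vs.
move=> /(pairwiseP 0)/(_ a c); rewrite !inE !size_gram_schmidt.
by move=> /(_ (ltn_ord a) (ltn_ord c) lac)/eqP.
Qed.

Let b_orth a c : a != c -> Q (b a) (b c) = 0.
Proof.
move=> ac; rewrite /orthonormal_vector (formZl hQ) (formZr hQ).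
by rewrite (q_orth ac) !mulr0.
Qed.

Let b_norm a : Q (b a) (b a) <= 1.
Proof.
rewrite (form_sqrZ hQ); have [->|h] := eqVneq (Q (q a) (q a)) 0.
  by rewrite mulr0.
by rewrite exprVn sqr_sqrtr ?(form_ge0 hQ)// mulVf.
Qed.

(** Stands for membership in the span of [vs], in the form that gives coordinates. *)
Definition expanded (z : V) := z = \sum_a Q z (b a) *: b a.

Lemma expanded_subspace : linear_subspace expanded.
Proof.
split; first by rewrite /expanded big1// => a _; rewrite form0l// scale0r.
move=> c x y hx hy; rewrite /expanded {1}hx {1}hy scaler_sumr -big_split/=.
by apply: eq_bigr => a _; rewrite (formDl hQ) (formZl hQ) scalerDl scalerA.
Qed.

Let expanded_q a : expanded (q a).
Proof.
rewrite /expanded (bigD1 a)//= big1 ?addr0; last first.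
  move=> c; rewrite eq_sym => ac.
  by rewrite (formZr hQ) (q_orth ac) mulr0 scale0r.
rewrite (formZr hQ) scalerA mulrAC -expr2 exprVn sqr_sqrtr ?(form_ge0 hQ)//.
have [h|h] := eqVneq (Q (q a) (q a)) 0; last by rewrite mulVf// scale1r.
by rewrite (Qdef h) scaler0.
Qed.

Let expanded_b a : expanded (b a).
Proof. exact: (linear_subspaceZ _ expanded_subspace (expanded_q a)). Qed.

Lemma expanded_span v : v \in vs -> expanded v.
Proof.
move: v; apply/(@gram_schmidt_span _ _ Q expanded vs expanded_subspace) => u us.
have hu : (index u (gram_schmidt Q vs) < k)%N.
  by rewrite -(size_gram_schmidt Q vs) index_mem.
have -> : u = q (Ordinal hu) by rewrite /q /= nth_index.
exact: expanded_q.
Qed.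

Let Q_expanded z : expanded z -> Q z z = \sum_a Q z (b a) ^+ 2.
Proof.
move=> hz; rewrite {2}hz (form_sumr hQ); apply: eq_bigr => a _.
by rewrite (formZr hQ) expr2.
Qed.

Let Q_comb (c : 'I_k -> R) :
  Q (\sum_a c a *: b a) (\sum_a c a *: b a) <= \sum_a c a ^+ 2.
Proof.
rewrite (form_suml hQ); apply: ler_sum => a _.
rewrite (form_sumr hQ) (bigD1 a)//= big1 ?addr0; last first.
  move=> d; rewrite eq_sym => ad.
  by rewrite (formZl hQ (c a)) (formZr hQ (c d)) (b_orth ad) !mulr0.
by rewrite (form_sqrZ hQ) ler_piMr ?sqr_ge0.
Qed.

Let expanded_comb (c : 'I_k -> R) : expanded (\sum_a c a *: b a).
Proof.
apply: (linear_subspace_sum _ expanded_subspace) => a _.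
exact: (linear_subspaceZ _ expanded_subspace).
Qed.

(** Rounding coordinates to multiples of 1 / g makes a squared error of at most k / g^2 <= 1 / 64.
    The net has (2 (g + 1))^k points, more than a volumetric net, but it is explicit, and the
    additional log k will be absorbed by log n. *)
Let g : nat := 8 * k.+1.

Definition grid_value (c : 'I_g.+1 * bool) : R := (-1) ^+ c.2 * (c.1%:R / g%:R).

Definition net_point (f : {ffun 'I_k -> 'I_g.+1 * bool}) : V :=
  \sum_a grid_value (f a) *: b a.

Let g0 : 0 < g%:R :> R. Proof. by rewrite ltr0n. Qed.

(** Rounding goes toward 0, with the sign kept apart, so that rounding a unit vector stays in the
    unit ball, where the error on the net is at most tau. *)
Lemma grid_round (x : R) : `|x| <= 1 -> exists c : 'I_g.+1 * bool,
  `|grid_value c| <= `|x| /\ `|x - grid_value c| <= g%:R^-1.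
Proof.
move=> x1; pose t := Num.truncn (`|x| * g%:R).
have xg0 : 0 <= `|x| * g%:R by rewrite mulr_ge0// ltW.
have /andP[t1 t2] := Num.Theory.truncn_itv xg0.
have tg : (t < g.+1)%N.
  rewrite ltnS -(ler_nat R); apply: (le_trans t1).
  by rewrite ler_piMl// ltW.
exists (Ordinal tg, x < 0); rewrite /grid_value /=.
have h1 : t%:R / g%:R <= `|x| by rewrite ler_pdivrMr.
have h2 : `|x| <= t%:R / g%:R + g%:R^-1.
  by rewrite -[X in _ + X]mul1r -mulrDl ler_pdivlMr// natr1 ltW.
have h0 : 0 <= t%:R / g%:R :> R by rewrite divr_ge0.
rewrite normrM normr_sign mul1r (ger0_norm h0); split => //.
clear t1 t2 xg0 tg; move: h0 h1 h2; move: g%:R^-1 (t%:R / g%:R) => e y h0.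
have [x0|x0] := ltP x 0.
  rewrite (ltr0_norm x0) expr1 mulN1r => h1 h2.
  by rewrite ler_norml; apply/andP; split; lra.
rewrite (ger0_norm x0) expr0 mul1r => h1 h2.
by rewrite ler_norml; apply/andP; split; lra.
Qed.

Variables (B : V -> V -> R) (tau : R).
Hypothesis hB : psd_form B.
Hypothesis tau0 : 0 < tau.
Hypothesis net_le : forall f,
  `|B (net_point f) (net_point f) - Q (net_point f) (net_point f)| <=
  tau * Q (net_point f) (net_point f).

Let M x y := B x y - Q x y.

Let bound (A : R) := forall z, expanded z -> `|M z z| <= A * Q z z.

(** A crude finite constant that starts the improvement below; this replaces a supremum over the
    sphere. *)
Let bound_exists : exists2 A, 0 <= A & bound A.
Proof.
exists (\sum_a \sum_c `|M (b a) (b c)|).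
  by apply: sumr_ge0 => a _; apply: sumr_ge0.
move=> z hz.
have expand F : psd_form F ->
    F z z = \sum_a \sum_c Q z (b a) * Q z (b c) * F (b a) (b c).
  move=> hF.
  transitivity (F (\sum_a Q z (b a) *: b a) (\sum_a Q z (b a) *: b a)).
    by rewrite -hz.
  rewrite (form_suml hF); apply: eq_bigr => a _.
  rewrite (formZl hF (Q z (b a))) (form_sumr hF) mulr_sumr.
  by apply: eq_bigr => c _; rewrite (formZr hF (Q z (b c))) mulrA.
have -> : M z z = \sum_a \sum_c Q z (b a) * Q z (b c) * M (b a) (b c).
  rewrite /M (expand B hB) (expand Q hQ) -sumrB; apply: eq_bigr => a _.
  by rewrite -sumrB; apply: eq_bigr => c _; rewrite -mulrBr.
apply: (le_trans (ler_norm_sum _ _ _)); rewrite mulr_suml.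
apply: ler_sum => a _; apply: (le_trans (ler_norm_sum _ _ _));
  rewrite mulr_suml.
apply: ler_sum => c _; rewrite normrM mulrC ler_wpM2l//.
have ha d : Q z (b d) ^+ 2 <= Q z z.
  rewrite (Q_expanded hz) (bigD1 d)//= lerDl sumr_ge0// => e _.
  exact: sqr_ge0.
have := ha a; have := ha c; move: (Q z _) (Q z _) (Q z z) => x y p.
have := sqr_ge0 (x - y); have := sqr_ge0 (x + y).
rewrite !expr2 => *; rewrite ler_norml; apply/andP; split; lra.
Qed.

(** For a unit vector z with rounding z', M z z = M z' z' + M (z - z') (z + z'). The first term is
    at most tau. The second is polarized through 4 (z - z') and (z + z') / 4, whose energies are at
    most 1 / 4 each, which gives A / 4. *)
Let bound_improve A : 0 <= A -> bound A -> bound (tau + A / 4).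
Proof.
move=> A0 hA z hz.
wlog z1 : z hz / Q z z = 1.
  move=> hw; have [z0|z0] := eqVneq (Q z z) 0.
    by rewrite (Qdef z0) /M (form0l hB) (form0l hQ) subr0 normr0 mulr0.
  have zp : 0 < Q z z by rewrite lt_neqAle eq_sym z0 (form_ge0 hQ).
  pose s := (Num.sqrt (Q z z))^-1.
  have s2 : s ^+ 2 = (Q z z)^-1 by rewrite exprVn sqr_sqrtr// ltW.
  have := hw (s *: z) (linear_subspaceZ _ expanded_subspace hz).
  rewrite /M (form_sqrZ hQ) (form_sqrZ hB) s2 mulVf// mulr1 => /(_ erefl).
  rewrite -[X in _ - X](mulVf z0) -mulrBr normrM gtr0_norm ?invr_gt0//.
  by rewrite ler_pdivrMl// => h; rewrite [leRHS]mulrC.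
rewrite z1 mulr1.
pose x a := Q z (b a).
have x2 : \sum_a x a ^+ 2 = 1 by rewrite -z1 (Q_expanded hz).
have x1 a : `|x a| <= 1.
  rewrite -(ler_pXn2r (n := 2)) ?nnegrE// expr1n -normrX ger0_norm ?sqr_ge0//.
  by rewrite -x2 (bigD1 a)//= lerDl sumr_ge0// => c _; exact: sqr_ge0.
have /choice[c hc] : forall a, exists c : 'I_g.+1 * bool,
   `|grid_value c| <= `|x a| /\ `|x a - grid_value c| <= g%:R^-1.
  by move=> a; exact: grid_round.
pose f := [ffun a => c a]; pose y a := grid_value (f a).
have hy a : `|y a| <= `|x a| by rewrite /y ffunE; case: (hc a).
have hxy a : `|x a - y a| <= g%:R^-1 by rewrite /y ffunE; case: (hc a).
pose z' := net_point f.
have hz' : expanded z' by exact: expanded_comb.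
have Qz' : Q z' z' <= 1.
  apply: (le_trans (Q_comb y)); rewrite -x2; apply: ler_sum => a _.
  by rewrite -[leLHS]real_normK ?num_real// -[leRHS]real_normK ?num_real//;
    rewrite lerXn2r ?nnegrE.
have Qd : Q (z - z') (z - z') <= 1 / 64.
  have -> : z - z' = \sum_a (x a - y a) *: b a.
    rewrite {1}hz /z' /net_point -sumrB.
    by apply: eq_bigr => a _; rewrite scalerBl.
  apply: (le_trans (Q_comb _)).
  apply: (@le_trans _ _ (\sum_(a < k) g%:R^-1 ^+ 2)).
    apply: ler_sum => a _; rewrite -[leLHS]real_normK ?num_real//.
    by apply: lerXn2r; rewrite ?nnegrE ?invr_ge0 ?(ltW g0)//; exact: hxy.
  rewrite sumr_const card_ord -[_ *+ k]mulr_natl /g natrM.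
  have k0 : 0 < (k.+1)%:R :> R by rewrite ltr0n.
  have kk : k%:R <= (k.+1)%:R :> R by rewrite ler_nat.
  have k1 : 1 <= (k.+1)%:R :> R by rewrite ler1n.
  move: (k.+1%:R) (k%:R) k0 kk k1 => a e a0 ea a1.
  rewrite exprVn ler_pdivrMr ?exprn_gt0 ?mulr_gt0//.
  rewrite exprMn expr2; have : a <= a ^+ 2 by rewrite expr2 ler_peMl// ltW.
  lra.
have Qs : Q (z + z') (z + z') <= 4.
  have := form_ge0 hQ (z - z').
  by rewrite (form_sqrB hQ) (form_sqrD hQ); lra.
have hd : expanded (z - z') by exact: (linear_subspaceB expanded_subspace).
have hs : expanded (z + z') by exact: (linear_subspaceD expanded_subspace).
have : M (z - z') (z + z') = M z z - M z' z'.
  rewrite /M (formBl hB) (formBl hQ) !(formDr hB) !(formDr hQ).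
  by rewrite (formC hB z' z) (formC hQ z' z); ring.
move: Qd Qs hd hs; move: (z - z') (z + z') => u w hu hw eu ew hM.
have eu4 : expanded (4 *: u) by exact: (linear_subspaceZ _ expanded_subspace).
have ew4 : expanded (4^-1 *: w)
  by exact: (linear_subspaceZ _ expanded_subspace).
have := hA _ (linear_subspaceD expanded_subspace eu4 ew4).
have := hA _ (linear_subspaceB expanded_subspace eu4 ew4).
have := net_le f; rewrite -/z'.
have -> : M z z = M u w + M z' z' by rewrite hM subrK.
rewrite /M (form_sqrB hB) (form_sqrB hQ) (form_sqrD hB) (form_sqrD hQ).
rewrite !(form_sqrZ hB) !(form_sqrZ hQ).
rewrite !(formZl hB 4) !(formZl hQ 4) !(formZr hB 4^-1) !(formZr hQ 4^-1).
have tp : tau * Q z' z' <= tau by rewrite ler_piMr// ltW.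
have Au : A * Q u u <= A * (1 / 64) by rewrite ler_wpM2l.
have Aw : A * Q w w <= A * 4 by rewrite ler_wpM2l.
rewrite !ler_norml => /andP[n1 n2] /andP[h1 h2] /andP[h3 h4].
by apply/andP; split; lra.
Qed.

(** Each use of [bound_improve] halves the excess over 2 tau; finitely many bring it below tau,
    hence the constant 3. *)
Lemma net_form_le z : expanded z -> `|B z z - Q z z| <= 3 * tau * Q z z.
Proof.
have [A0 A00 hA0] := bound_exists.
have hj j : bound (2 * tau + A0 / 2 ^+ j).
  elim: j => [|j IH].
    move=> z' hz'; apply: (le_trans (hA0 z' hz')).
    rewrite expr0 divr1 ler_wpM2r ?(form_ge0 hQ)//.
    by rewrite lerDr mulr_ge0// ltW.
  have p0 : 0 <= A0 / 2 ^+ j by rewrite divr_ge0// exprn_ge0.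
  move=> z' hz'; apply: (le_trans (bound_improve _ IH hz')).
    by rewrite addr_ge0// mulr_ge0// ltW.
  have -> : A0 / 2 ^+ j.+1 = (A0 / 2 ^+ j) / 2 by rewrite exprSr invfM mulrA.
  rewrite ler_wpM2r ?(form_ge0 hQ)//.
  exact: halving_step.
(* So j exceeds A0 / tau, and 2 ^ j exceeds j. *)
move=> hz; pose j := (Num.truncn (A0 / tau)).+1.
have hA : A0 / 2 ^+ j <= tau.
  rewrite ler_pdivrMr ?exprn_gt0// mulrC -ler_pdivrMr//.
  apply: (@le_trans _ _ j%:R).
    have At : 0 <= A0 / tau by rewrite divr_ge0// ltW.
    by have /andP[_ /ltW] := Num.Theory.truncn_itv At.
  by rewrite -natrX ler_nat ltnW// ltn_expl.
apply: (le_trans (hj j z hz)); rewrite ler_wpM2r ?(form_ge0 hQ)//.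
lra.
Qed.

End net.

(** * Chi-square concentration *)

Section weighted_law.
Local Open Scope ereal_scope.
Context d' (T : measurableType d') (R : realType).
Variable f : T -> R.
Hypothesis mf : measurable_fun [set: T] f.
Hypothesis f0 : forall x, (0 <= f x)%R.
Let mfE : measurable_fun [set: T] (EFin \o f).
Proof. exact/measurable_EFinP. Qed.
Let g := nnsfun_approx measurableT mfE.

Let mS n r : measurable (g n @^-1` [set r]).
Proof. exact: measurable_sfunP. Qed.

Let pos n r x : (0 <= r * \1_(g n @^-1` [set r]) x)%R.
Proof.
have [->|/set0P[y]] := eqVneq (g n @^-1` [set r]) set0.
  by rewrite indic0 mulr0.
by move=> <-; rewrite mulr_ge0.
Qed.

Let gE n x : g n x =
  (\sum_(r <- fset_set (range (g n))) (r * \1_(g n @^-1` [set r]) x))%R.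
Proof. by rewrite fimfunE fsbig_finite. Qed.

Let r0 n r : r \in fset_set (range (g n)) -> (0 <= r)%R.
Proof. by rewrite in_fset_set// => /set_mem[x _ <-]. Qed.

Let mcomp d (Omega : measurableType d) (Z : Omega -> T) (u : T -> R) :
  measurable_fun [set: Omega] Z -> measurable_fun [set: T] u ->
  measurable_fun [set: Omega] (fun x => u (Z x)).
Proof. by move=> mZ mu; exact: measurableT_comp mu mZ. Qed.

Let weighted_simple d (Omega : measurableType d)
    (P : {measure set Omega -> \bar R}) (Z : Omega -> T) (h : Omega -> R) n :
  measurable_fun [set: Omega] Z -> measurable_fun [set: Omega] h ->
  (forall x, 0 <= h x)%R ->
  \int[P]_x (g n (Z x) * h x)%:E = \sum_(r <- fset_set (range (g n)))
    r%:E * \int[P]_x (\1_(g n @^-1` [set r]) (Z x) * h x)%:E.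
Proof.
move=> mZ mh h0.
have mI r : measurable_fun [set: Omega] (fun x =>
  \1_(g n @^-1` [set r]) (Z x) : R).
  by apply: mcomp => //; exact: measurable_indic (mS n r).
transitivity (\int[P]_x (\sum_(r <- fset_set (range (g n)))
    (r * \1_(g n @^-1` [set r]) (Z x) * h x)%:E)).
  by apply: eq_integral => x _; rewrite gE mulr_suml sumEFin.
rewrite ge0_integral_sum//; first last.
- by move=> r x _; rewrite lee_fin mulr_ge0.
- move=> r; apply/measurable_EFinP; apply: measurable_funM => //.
  by apply: measurable_funM => //; exact: mI.
rewrite big_seq [RHS]big_seq; apply: eq_bigr => r /r0 r_ge0.
under eq_integral do rewrite -mulrA EFinM.
rewrite ge0_integralZl//.
- by apply/measurable_EFinP; apply: measurable_funM => //; exact: mI.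
- by move=> x _; rewrite lee_fin mulr_ge0.
Qed.

Let weighted_cvg d (Omega : measurableType d)
    (P : {measure set Omega -> \bar R}) (Z : Omega -> T) (h : Omega -> R) :
  measurable_fun [set: Omega] Z -> measurable_fun [set: Omega] h ->
  (forall x, 0 <= h x)%R ->
  \int[P]_x (g n (Z x) * h x)%:E @[n --> \oo] --> \int[P]_x (f (Z x) * h x)%:E.
Proof.
move=> mZ mh h0.
have mg n : measurable_fun [set: Omega] (fun x => g n (Z x)).
  by apply: mcomp => //; exact: measurable_funPT.
rewrite (_ : \int[P]_x (f (Z x) * h x)%:E =
   \int[P]_x limn (fun n => (g n (Z x) * h x)%:E)).
  apply: cvg_monotone_convergence => //.
  - by move=> n; apply/measurable_EFinP; exact: measurable_funM.
  - by move=> n x _; rewrite lee_fin mulr_ge0.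
  - move=> x _ a b ab; rewrite lee_fin ler_wpM2r//.
    by have /lefP := nd_nnsfun_approx measurableT mfE ab; exact.
apply: eq_integral => x _; apply/esym/cvg_lim => //.
apply: cvg_EFin; [exact: nearW|apply: cvgM; last exact: cvg_cst].
have : (g n (Z x))%:E @[n --> \oo] --> (f (Z x))%:E.
  by apply: (@cvg_nnsfun_approx _ _ _ setT measurableT (EFin \o f) mfE) =>
    // y _;
    rewrite lee_fin.
by move=> /fine_cvgP[_]; exact.
Qed.

(** Passes from indicators to nonnegative functions by simple approximation and monotone
    convergence. The weights give two uses: a density replaces a Gaussian law by Lebesgue measure,
    and the product of the other factors splits off one independent factor. *)
Lemma eq_integral_weighted_law d1 d2 (Omega1 : measurableType d1)
    (Omega2 : measurableType d2) (P1 : {measure set Omega1 -> \bar R})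
    (P2 : {measure set Omega2 -> \bar R}) (Z1 : Omega1 -> T) (Z2 : Omega2 -> T)
    (h1 : Omega1 -> R) (h2 : Omega2 -> R) :
  measurable_fun [set: Omega1] Z1 -> measurable_fun [set: Omega1] h1 ->
  (forall x, 0 <= h1 x)%R ->
  measurable_fun [set: Omega2] Z2 -> measurable_fun [set: Omega2] h2 ->
  (forall x, 0 <= h2 x)%R ->
  (forall B, measurable B -> \int[P1]_x (\1_B (Z1 x) * h1 x)%:E =
                             \int[P2]_x (\1_B (Z2 x) * h2 x)%:E) ->
  \int[P1]_x (f (Z1 x) * h1 x)%:E = \int[P2]_x (f (Z2 x) * h2 x)%:E.
Proof.
move=> mZ1 mh1 h10 mZ2 mh2 h20 hB.
have H1 := @weighted_cvg _ _ P1 _ _ mZ1 mh1 h10.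
have H2 := @weighted_cvg _ _ P2 _ _ mZ2 mh2 h20.
apply: cvg_unique H1 _; first exact: ereal_hausdorff.
rewrite (_ : (fun n => _) = (fun n => \int[P2]_x (g n (Z2 x) * h2 x)%:E))//.
apply/funext => n; rewrite !weighted_simple//.
by apply: eq_bigr => r _; rewrite hB.
Qed.

End weighted_law.

(** * Expectation of a product of independent factors *)

Section product_expectation.
Local Open Scope ereal_scope.

Lemma integral_prod_independent d d' (Omega : measurableType d)
    (T : measurableType d') (R : realType) (P : probability Omega R)
    (m : nat) (Z : 'I_m -> Omega -> T) :
  (forall k, measurable_fun [set: Omega] (Z k)) ->
  (forall B : 'I_m -> set T, (forall k, measurable (B k)) ->
     P (\bigcap_k (Z k @^-1` B k)) = \prod_(k < m) P (Z k @^-1` B k)) ->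
  forall (f : 'I_m -> T -> R) (e : 'I_m -> R),
  (forall k, measurable_fun [set: T] (f k)) -> (forall k x, 0 <= f k x)%R ->
  (forall k, \int[P]_x (f k (Z k x))%:E = (e k)%:E) ->
  \int[P]_x (\prod_(k < m) f k (Z k x))%:E = (\prod_(k < m) e k)%:E.
Proof.
move=> mZ indep.
have mZB k B : measurable B -> measurable (Z k @^-1` B).
  by move=> mB; rewrite -[X in measurable X]setTI; exact: mZ.
have indE k B x : \1_B (Z k x) = \1_(Z k @^-1` B) x :> R by [].
have indP k B : measurable B ->
    \int[P]_x (\1_B (Z k x))%:E = (fine (P (Z k @^-1` B)))%:E.
  move=> mB; under eq_integral do rewrite indE.
  by rewrite integral_indic ?setIT ?fineK ?fin_num_measure//; exact: mZB.
(* Indicators are traded for general functions one index at a time: the first n factors are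
   arbitrary, the others still indicators. *)
suff Q n : (n <= m)%N -> forall (f : 'I_m -> T -> R) (e : 'I_m -> R),
  (forall k, measurable_fun [set: T] (f k)) -> (forall k x, 0 <= f k x)%R ->
  (forall k, \int[P]_x (f k (Z k x))%:E = (e k)%:E) ->
  (forall k : 'I_m, (n <= k)%N -> exists2 B, measurable B & f k = \1_B) ->
  \int[P]_x (\prod_(k < m) f k (Z k x))%:E = (\prod_(k < m) e k)%:E.
  move=> f e mf f0 fe; apply: (Q m) => // k.
  by rewrite leqNgt ltn_ord.
elim: n => [_ f e mf f0 fe fB|n IH nm f e mf f0 fe fB].
  have /choice[B BP] : forall k, exists B, measurable B /\ f k = \1_B.
    by move=> k; have [//|B mB ->] := fB k; exists B.
  have mB k : measurable (B k) by case: (BP k).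
  transitivity (\int[P]_x (\1_(\bigcap_k (Z k @^-1` B k)) x)%:E).
    apply: eq_integral => x _; congr _%:E.
    rewrite indicE; case: (boolP (x \in _)) => [|].
      move=> /set_mem xB; rewrite big1// => k _.
      by case: (BP k) => _ ->; rewrite indE indicE mem_set//; exact: xB.
    move=> /negP xB; apply/eqP; rewrite prodf_seq_eq0; apply/hasP.
    apply: contrapT => H; apply: xB; apply/mem_set => k _.
    apply: contrapT => xk; apply: H; exists k; first by rewrite mem_index_enum.
    case: (BP k) => _ ->; rewrite indE indicE memNset//=.
  rewrite integral_indic//; last first.
    by apply: fin_bigcap_measurable => // k _; exact: mZB.
  rewrite setIT; transitivity (\prod_(k < m) P (Z k @^-1` B k));
    first exact: indep.
  rewrite -prodEFin; apply: eq_bigr => k _.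
  rewrite -fe; case: (BP k) => _ ->.
  by rewrite indP// fineK// fin_num_measure//; exact: mZB.
pose k0 := Ordinal nm.
have e0 k : (0 <= e k)%R.
  by rewrite -lee_fin -fe integral_ge0// => x _; rewrite lee_fin.
pose h x := (\prod_(k < m | k != k0) f k (Z k x))%R.
have mfZ k : measurable_fun [set: Omega] (fun x => f k (Z k x)).
  exact: measurableT_comp (mf k) (mZ k).
have mh : measurable_fun [set: Omega] h.
  rewrite /h; under eq_fun do rewrite -big_filter.
  by apply: measurable_prod => k _; exact: mfZ.
have h0 x : (0 <= h x)%R by apply: prodr_ge0.
pose c := (\prod_(k < m | k != k0) e k)%R.
have c0 : (0 <= c)%R by apply: prodr_ge0.
transitivity (\int[P]_x (f k0 (Z k0 x) * c)%:E); last first.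
  under eq_integral do rewrite EFinM.
  rewrite ge0_integralZr//; first last.
  - by move=> x _; rewrite lee_fin.
  - exact/measurable_EFinP.
  by rewrite fe -EFinM [in RHS](bigD1 k0).
under eq_integral do rewrite (bigD1 k0)//=.
(* Against each indicator of Z_n, the weight h may be replaced by the constant c: this is the
   induction hypothesis with factor n turned into that indicator. *)
apply: (@eq_integral_weighted_law _ T R (f k0) (mf k0) (f0 k0) _ _ _ _
  P P (Z k0) (Z k0) h (fun=> c)) => //.
move=> B mB.
under [RHS]eq_integral do rewrite EFinM.
rewrite ge0_integralZr//; first last.
- apply/measurable_EFinP.
  by apply: (@measurableT_comp _ _ _ _ _ _ (\1_B : T -> R)) => //;
    exact: measurable_indic.
rewrite indP//.
pose f' k := if k == k0 then \1_B : T -> R else f k.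
pose e' k := if k == k0 then fine (P (Z k0 @^-1` B)) else e k.
have IH' : \int[P]_x (\prod_(k < m) f' k (Z k x))%:E = (\prod_(k < m) e' k)%:E.
  apply: (IH (ltnW nm)) => //.
  - by move=> k; rewrite /f'; case: ifP => // _; exact: measurable_indic.
  - by move=> k x; rewrite /f'; case: ifP.
  - by move=> k; rewrite /f' /e'; case: eqP => [->|_]; [rewrite indP|exact: fe].
  - move=> k nk; rewrite /f'; case: ifPn => [_|kk0]; first by exists B.
    apply: fB; rewrite ltn_neqAle nk andbT; apply: contraNneq kk0 => nk'.
    by apply/eqP/val_inj.
rewrite -EFinM.
transitivity (\prod_(k < m) e' k)%:E; last first.
  rewrite (bigD1 k0)//= /e' eqxx; congr (_ * _)%:E.
  by apply: eq_bigr => k /negPf ->.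
rewrite -IH'; apply: eq_integral => x _.
rewrite [in RHS](bigD1 k0)//= /f' eqxx; congr (_ * _)%:E.
by apply: eq_bigr => k /negPf ->.
Qed.

End product_expectation.

Lemma tilted_exponent (F : realFieldType) (a s x : F) :
  a != 0 -> 1 - 2 * s * a ^+ 2 != 0 ->
  s * x ^+ 2 + - x ^+ 2 / (a ^+ 2 *+ 2) =
  - x ^+ 2 / (a ^+ 2 / (1 - 2 * s * a ^+ 2) *+ 2).
Proof. by move=> a0 q0; field; rewrite q0 a0. Qed.

(** Tilting the density of N(0, sigma^2) by exp(s x^2) gives a multiple of the density of N(0,
    sigma^2 / (1 - 2 s sigma^2)), which has mass 1. *)
Lemma normal_sqr_mgf (R : realType) (sigma s : R) :
  0 < sigma -> 2 * s * sigma ^+ 2 < 1 ->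
  (\int[lebesgue_measure]_x (expR (s * x ^+ 2) * normal_pdf 0 sigma x)%:E =
  (Num.sqrt (1 - 2 * s * sigma ^+ 2))^-1%:E)%E.
Proof.
move=> s0 h; pose q := 1 - 2 * s * sigma ^+ 2.
have q0 : 0 < q by rewrite subr_gt0.
pose t := sigma / Num.sqrt q.
have t0 : 0 < t by rewrite divr_gt0// sqrtr_gt0.
have t2 : t ^+ 2 = sigma ^+ 2 / q by rewrite exprMn exprVn sqr_sqrtr// ltW.
have peak : normal_peak t = Num.sqrt q * normal_peak sigma.
  rewrite /normal_peak t2 -[_ / q * pi *+ 2]mulr_natr.
  rewrite (_ : _ * 2%:R = (sigma ^+ 2 * pi *+ 2) * q^-1); last first.
    by move: (sigma ^+ 2) q^-1 (@pi R) => a b c; ring.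
  have h2 : 0 <= sigma ^+ 2 * pi *+ 2.
    by apply/mulrn_wge0/mulr_ge0; [exact: sqr_ge0|exact: pi_ge0].
  rewrite sqrtrM//.
  by rewrite invfM sqrtrV ?ltW// invrK mulrC.
have sN0 : sigma != 0 by rewrite gt_eqF.
have qN0 : q != 0 by rewrite gt_eqF.
have pdfE u y : 0 < u -> normal_pdf 0 u y = normal_peak u * normal_fun 0 u y.
  by move=> u0; rewrite /normal_pdf gt_eqF.
transitivity (\int[lebesgue_measure]_x
   ((Num.sqrt q)^-1%:E * (normal_pdf 0 t x)%:E))%E.
  apply: eq_integral => x _; rewrite -EFinM; congr _%:E.
  rewrite !pdfE// peak -[in RHS]mulrA mulKf ?gt_eqF ?sqrtr_gt0//.
  rewrite mulrCA; congr (_ * _); rewrite /normal_fun -expRD; congr expR.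
  by rewrite t2 subr0; exact: tilted_exponent.
rewrite ge0_integralZl//.
- by rewrite integral_normal_pdf mule1.
- by apply/measurable_EFinP; exact: measurable_normal_pdf.
- by move=> x _; rewrite lee_fin normal_pdf_ge0.
Qed.

Lemma invr_sqrt_expn_le (R : realType) (q y : R) m :
  0 < q -> 1 <= expR y ^+ 2 * q -> (Num.sqrt q)^-1 ^+ m <= expR (m%:R * y).
Proof.
move=> q0 h; rewrite expRM_natl.
apply: lerXn2r; rewrite ?nnegrE ?invr_ge0 ?sqrtr_ge0 ?expR_ge0//.
rewrite -[leLHS]mul1r ler_pdivrMr ?sqrtr_gt0//.
rewrite -(sqrtr1) -[expR y]gtr0_norm ?expR_gt0// -sqrtr_sqr -sqrtrM ?sqr_ge0//.
exact: ler_wsqrtr.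
Qed.

(** This is - log (1 - u) <= u + u^2 in exponential form; the next lemma is - log (1 + u) <= u^2 -
    u. The quadratic terms govern the t^2 of the tail exponent. *)
Lemma expR_sqr_upper (R : realType) (u : R) : 0 <= u <= 1 / 4 ->
  1 <= expR ((u + u ^+ 2) / 2) ^+ 2 * (1 - u).
Proof.
move=> /andP[u0 u1].
have := expR_ge1Dx ((u + u ^+ 2) / 2).
set e := expR _ => he.
have u20 : 0 <= u ^+ 2 by exact: sqr_ge0.
have he2 : (1 + (u + u ^+ 2) / 2) ^+ 2 <= e ^+ 2.
  by apply: lerXn2r; rewrite ?nnegrE//; lra.
have : (1 + (u + u ^+ 2) / 2) ^+ 2 * (1 - u) <= e ^+ 2 * (1 - u).
  by apply: ler_wpM2r => //; lra.
apply: le_trans.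
rewrite -subr_ge0
  (_ : _ - 1 = u ^+ 2 * (1 / 4 - 3 / 4 * u - u ^+ 2 / 4 - u ^+ 3 / 4)).
  apply: mulr_ge0; first exact: sqr_ge0.
  have u2 : 0 <= u * (1 / 4 - u) by apply: mulr_ge0; lra.
  have u3 : 0 <= u ^+ 2 * (1 / 4 - u) by apply: mulr_ge0; lra.
  lra.
by field.
Qed.

Lemma expR_sqr_lower (R : realType) (u : R) : 0 <= u <= 1 / 4 ->
  1 <= expR ((u ^+ 2 - u) / 2) ^+ 2 * (1 + u).
Proof.
move=> /andP[u0 u1].
rewrite -expRM_natl (_ : 2 * _ = u ^+ 2 - u); last by field.
have h : 1 + (u ^+ 2 - u) <= expR (u ^+ 2 - u) by exact: expR_ge1Dx.
have : (1 + (u ^+ 2 - u)) * (1 + u) <= expR (u ^+ 2 - u) * (1 + u).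
  by apply: ler_wpM2r => //; lra.
by apply: le_trans; have : 0 <= u ^+ 3 by [apply: exprn_ge0]; lra.
Qed.

Section chi_square.
Context (R : realType) d (Omega : measurableType d) (P : probability Omega R).
Variables (m : nat) (Z : 'I_m -> Omega -> R) (sigma : R).
Hypothesis sigma0 : 0 < sigma.
Hypothesis mZ : forall k, measurable_fun [set: Omega] (Z k).
Hypothesis lawZ : forall k (B : set R), measurable B ->
  P (Z k @^-1` B) = normal_prob 0 sigma B.
Hypothesis indepZ : forall B : 'I_m -> set R, (forall k, measurable (B k)) ->
  (P (\bigcap_k (Z k @^-1` B k)) = \prod_(k < m) P (Z k @^-1` B k))%E.

Let mexp s : measurable_fun [set: R] (fun x : R => expR (s * x ^+ 2)).
Proof.
apply: (measurableT_comp (@measurable_expR R)).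
by apply: measurable_funM => //; exact: measurable_funX.
Qed.

Let mgf_Z s k : 2 * s * sigma ^+ 2 < 1 ->
  (\int[P]_x (expR (s * Z k x ^+ 2))%:E =
   (Num.sqrt (1 - 2 * s * sigma ^+ 2))^-1%:E)%E.
Proof.
move=> hs; rewrite -normal_sqr_mgf//.
under eq_integral do rewrite -[expR _]mulr1.
apply: (@eq_integral_weighted_law _ R R (fun x => expR (s * x ^+ 2)) (mexp s)
  (fun x => expR_ge0 _)
  _ _ _ _ P lebesgue_measure (Z k) id (fun=> 1) (normal_pdf 0 sigma)) => //.
- exact: measurable_normal_pdf.
- by move=> x; exact: normal_pdf_ge0.
move=> B mB; under eq_integral do rewrite mulr1.
transitivity (P (Z k @^-1` B)).
  rewrite -[in RHS](setIT (Z k @^-1` B)) -integral_indic//.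
  by rewrite -[X in measurable X]setTI; exact: mZ.
rewrite lawZ// /normal_prob.
rewrite [LHS]integral_mkcond; apply: eq_integral => x _.
by rewrite patchE indicE; case: (x \in B); rewrite ?mul1r ?mul0r.
Qed.

(** The sign of s is free: positive s serves the upper tail and negative s the lower one. *)
Lemma chernoff_sum_sqr (s b : R) : 2 * s * sigma ^+ 2 < 1 ->
  (P [set x | b <= s * \sum_(k < m) Z k x ^+ 2]%R <=
   (expR (- b) * (Num.sqrt (1 - 2 * s * sigma ^+ 2))^-1 ^+ m)%:E)%E.
Proof.
move=> hs; set A := [set x | _].
have mS : measurable_fun [set: Omega] (fun x => s * \sum_(k < m) Z k x ^+ 2).
  apply: measurable_funM => //; apply: measurable_sum => k.
  exact: measurable_funX.
have mA : measurable A.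
  have := mS measurableT `[b, +oo[%classic (measurable_itv _).
  by rewrite setTI (_ : _ @^-1` _ = A)//; apply/seteqP; split => x;
    rewrite /A /= in_itv/= andbT.
have I : (\int[P]_x (expR (s * \sum_(k < m) Z k x ^+ 2))%:E =
   ((Num.sqrt (1 - 2 * s * sigma ^+ 2))^-1 ^+ m)%:E)%E.
  transitivity (\int[P]_x (\prod_(k < m) expR (s * Z k x ^+ 2))%:E)%E.
    by apply: eq_integral => x _; rewrite mulr_sumr expR_sum.
  rewrite (@integral_prod_independent _ _ Omega R R P m Z mZ indepZ
     (fun _ x => expR (s * x ^+ 2))
     (fun=> (Num.sqrt (1 - 2 * s * sigma ^+ 2))^-1))//.
  - by rewrite prodr_const card_ord.
  - by move=> k; exact: mgf_Z.
rewrite EFinM -I -lee_pdivrMl ?expR_gt0//.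
rewrite -expRN opprK.
rewrite -[X in P X]setIT -integral_indic// -ge0_integralZl//; first last;
  try by [rewrite lee_fin expR_ge0|
          apply/measurable_EFinP; exact: measurable_indic].
apply: ge0_le_integral => //.
- by apply/measurable_EFinP; apply: measurable_funM => //;
    exact: measurable_indic.
- by apply/measurable_EFinP; exact: measurableT_comp.
- move=> x _; rewrite -EFinM lee_fin indicE.
  case: (boolP (x \in A)) => [/set_mem xA|_]; rewrite ?mulr1 ?mulr0 ?expR_ge0//.
  by rewrite ler_expR.
Qed.

Lemma measurable_sum_sqr :
  measurable_fun [set: Omega] (fun x => \sum_(k < m) Z k x ^+ 2).
Proof. by apply: measurable_sum => k; exact: measurable_funX. Qed.

Lemma chi_square_tail (t : R) : 0 < t <= 1 / 2 ->
  (P [set x | t * (m%:R * sigma ^+ 2) <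
      `|\sum_(k < m) Z k x ^+ 2 - m%:R * sigma ^+ 2|]%R <=
   (2 * expR (- (m%:R * t ^+ 2 / 8)))%:E)%E.
Proof.
move=> /andP[t0 t1].
have s20 : 0 < sigma ^+ 2 by rewrite exprn_gt0.
have sN0 : sigma != 0 by rewrite gt_eqF.
(* So 2 s sigma^2 = t / 2. The exponents per sample are - t (1 + t) / 4 + (t / 4 + t^2 / 8) and t (1
   - t) / 4 - (t / 4 - t^2 / 8), both equal to - t^2 / 8. *)
pose s := t / (4 * sigma ^+ 2).
have s0 : 0 < s by rewrite divr_gt0// mulr_gt0.
have u01 : 0 <= t / 2 <= 1 / 4 by lra.
pose U := [set x | m%:R * (t * (1 + t) / 4) <= s * \sum_(k < m) Z k x ^+ 2].
pose L := [set x | m%:R * (- (t * (1 - t) / 4)) <=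
  - s * \sum_(k < m) Z k x ^+ 2].
have mSc c : measurable_fun [set: Omega] (fun x => c * \sum_(k < m) Z k x ^+ 2).
  by apply: measurable_funM => //; exact: measurable_sum_sqr.
have mge c b : measurable [set x | b <= c * \sum_(k < m) Z k x ^+ 2].
  have := mSc c measurableT `[b, +oo[%classic (measurable_itv _).
  by rewrite setTI (_ : _ @^-1` _ =
    [set x | b <= c * \sum_(k < m) Z k x ^+ 2])//;
    apply/seteqP; split => x; rewrite /= in_itv/= andbT.
have sub : [set x | t * (m%:R * sigma ^+ 2) <
      `|\sum_(k < m) Z k x ^+ 2 - m%:R * sigma ^+ 2|] `<=` U `|` L.
  move=> x /=; set S := \sum_(k < m) _ => h.
  have sS : s * (m%:R * sigma ^+ 2) = m%:R * (t / 4).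
    by rewrite /s; field; rewrite sN0.
  have [h'|h'] := leP 0 (S - m%:R * sigma ^+ 2).
    left; rewrite /U/=; rewrite ger0_norm// in h.
    have : s * ((1 + t) * (m%:R * sigma ^+ 2)) <= s * S.
      by rewrite ler_pM2l//; lra.
    by apply: le_trans; rewrite [X in _ <= X]mulrCA sS; lra.
  right; rewrite /L/= -/S; rewrite ltr0_norm// in h.
  have : s * S <= s * ((1 - t) * (m%:R * sigma ^+ 2)).
    by rewrite ler_pM2l//; lra.
  by rewrite [X in _ <= X]mulrCA sS => h2; rewrite mulNr; lra.
apply: (@le_trans _ _ (P (U `|` L))).
  apply: le_measure sub; apply/mem_set; last by apply: measurableU; exact: mge.
  have mD : measurable_fun [set: Omega]
      (fun x => `|\sum_(k < m) Z k x ^+ 2 - m%:R * sigma ^+ 2|).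
    apply: (measurableT_comp (@normr_measurable R _)).
    by apply: measurable_funB => //; exact: measurable_sum_sqr.
  have := mD measurableT `]t * (m%:R * sigma ^+ 2),
    +oo[%classic (measurable_itv _).
  rewrite setTI (_ : _ @^-1` _ = [set x | t * (m%:R * sigma ^+ 2) <
      `|\sum_(k < m) Z k x ^+ 2 - m%:R * sigma ^+ 2|])//.
  by apply/seteqP; split => x; rewrite /= in_itv/= andbT.
apply: (le_trans (measureU2 _ _ _)); [exact: mge|exact: mge|].
rewrite mulr2n mulrDl mul1r EFinD; apply: leeD.
  have hs : 2 * s * sigma ^+ 2 = t / 2 by rewrite /s; field; rewrite sN0.
  have hs1 : 2 * s * sigma ^+ 2 < 1 by rewrite hs; lra.
  apply: (le_trans (chernoff_sum_sqr _ hs1)).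
  rewrite lee_fin hs.
  have /(invr_sqrt_expn_le m) : 1 <=
    expR ((t / 2 + (t / 2) ^+ 2) / 2) ^+ 2 * (1 - t / 2).
    exact: expR_sqr_upper.
  have q0 : 0 < 1 - t / 2 by lra.
  move=> /(_ q0) h.
  apply: (le_trans (ler_wpM2l (expR_ge0 _) h)).
  by rewrite -expRD ler_expR; lra.
have hs : 2 * (- s) * sigma ^+ 2 = - (t / 2) by rewrite /s; field; rewrite sN0.
have hs1 : 2 * (- s) * sigma ^+ 2 < 1 by rewrite hs; lra.
apply: (le_trans (chernoff_sum_sqr _ hs1)).
rewrite lee_fin hs opprK.
have /(invr_sqrt_expn_le m) : 1 <=
  expR (((t / 2) ^+ 2 - t / 2) / 2) ^+ 2 * (1 + t / 2).
  exact: expR_sqr_lower.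
have q0 : 0 < 1 + t / 2 by lra.
move=> /(_ q0) h.
apply: (le_trans (ler_wpM2l (expR_ge0 _) h)).
by rewrite -expRD ler_expR; lra.
Qed.

End chi_square.

(** * Concentration of the empirical form on finitely many vectors *)

Section empirical_form.
Context (R : realType) (dO : measure_display) (Omega : measurableType dO)
  (P : probability Omega R) (n m : nat) (Sigma : 'M[R]_n)
  (X : 'I_m -> {RV P >-> n.-tuple (measurableTypeR R)}).
Hypothesis iidX : iid_gaussian_samples Sigma X.

Let Z (w : 'rV[R]_n) (k : 'I_m) (x : Omega) : R :=
  \sum_(i < n) w 0 i * tnth (X k x) i.

Lemma sqnorm_data_matrix w x :
  sqnorm (data_matrix X x *m w^T) = \sum_(k < m) Z w k x ^+ 2.
Proof.
apply: eq_bigr => k _; congr (_ ^+ 2); rewrite mxE; apply: eq_bigr => i _.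
by rewrite !mxE mulrC.
Qed.

Let lin (w : 'rV[R]_n) (y : n.-tuple (measurableTypeR R)) : R :=
  \sum_(i < n) w 0 i * tnth y i.

Let mlin w : measurable_fun [set: n.-tuple (measurableTypeR R)] (lin w).
Proof.
apply: measurable_sum => i; apply: measurable_funM => //.
exact: measurable_tnth.
Qed.

Let mZ w k : measurable_fun [set: Omega] (Z w k).
Proof.
exact: (measurableT_comp (mlin w) (measurable_funPT (X k))).
Qed.

Lemma empirical_form_measurable w :
  measurable_fun [set: Omega] (fun x => sqnorm (data_matrix X x *m w^T)).
Proof.
rewrite (_ : (fun x => _) = (fun x => \sum_(k < m) Z w k x ^+ 2)).
  exact: measurable_sum_sqr.
by apply/funext => x; exact: sqnorm_data_matrix.
Qed.

Lemma empirical_form_tail (w : 'rV[R]_n) (t : R) :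
  0 < quadratic_form Sigma w -> 0 < t <= 1 / 2 ->
  (P [set x | t * (m%:R * quadratic_form Sigma w) <
     `|sqnorm (data_matrix X x *m w^T) - m%:R * quadratic_form Sigma w|]%R <=
   (2 * expR (- (m%:R * t ^+ 2 / 8)))%:E)%E.
Proof.
move=> q0 t01; case: iidX => gX iX.
pose s := Num.sqrt (quadratic_form Sigma w).
have s0 : 0 < s by rewrite sqrtr_gt0.
have s2 : s ^+ 2 = quadratic_form Sigma w by rewrite sqr_sqrtr ?ltW.
rewrite -s2.
have lawZ k (B : set R) : measurable B -> P (Z w k @^-1` B) = normal_prob 0 s B.
  move=> mB; apply: (gX k w) => //; apply/eqP => w0.
  by move: q0; rewrite w0 /quadratic_form mul0mx mul0mx mxE ltxx.
have indZ (B : 'I_m -> set R) : (forall k, measurable (B k)) ->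
    (P (\bigcap_k (Z w k @^-1` B k)) = \prod_(k < m) P (Z w k @^-1` B k))%E.
  move=> mB; have mB' k : measurable (lin w @^-1` B k).
    by rewrite -[X in measurable X]setTI; exact: (mlin w).
  have := iX [set: 'I_m]%SET (fun k => lin w @^-1` B k) mB'.
  rewrite (eq_bigl xpredT); last by move=> k; rewrite finset.in_setT.
  move=> <-; congr (P _); apply/seteqP; split => x h k _ /=.
    exact: (h k I).
  by apply: (h k); rewrite /= finset.in_setT.
have := chi_square_tail s0 (mZ w) lawZ indZ t01.
apply: le_trans; rewrite le_eqVlt; apply/orP; left; apply/eqP; congr (P _).
by apply/seteqP; split => x /=; rewrite sqnorm_data_matrix.
Qed.

Lemma empirical_form_event (I : finType) (w : I -> 'rV[R]_n) (t : R) :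
  (forall v, v != 0 -> 0 < quadratic_form Sigma v) -> 0 < t <= 1 / 2 ->
  exists E : set Omega, [/\ measurable E,
    ((1 - #|I|%:R * (2 * expR (- (m%:R * t ^+ 2 / 8))))%:E <= P E)%E &
    forall x, E x -> forall i,
     `|sqnorm (data_matrix X x *m (w i)^T) - m%:R * quadratic_form Sigma (w i)|
       <= t * (m%:R * quadratic_form Sigma (w i))].
Proof.
move=> pd t01; have /andP[t0 _] := t01.
pose bad i := [set x | t * (m%:R * quadratic_form Sigma (w i)) <
  `|sqnorm (data_matrix X x *m (w i)^T) - m%:R * quadratic_form Sigma (w i)|].
have mbad i : measurable (bad i).
  have mD : measurable_fun [set: Omega] (fun x =>
      `|sqnorm (data_matrix X x *m (w i)^T) - m%:R * quadratic_form
        Sigma (w i)|).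
    apply: (measurableT_comp (@normr_measurable R _)).
    by apply: measurable_funB => //; exact: empirical_form_measurable.
  have := mD measurableT `]t * (m%:R * quadratic_form Sigma (w i)), +oo[%classic
    (measurable_itv _).
  rewrite setTI (_ : _ @^-1` _ = bad i)//.
  by apply/seteqP; split => x; rewrite /bad /= in_itv/= andbT.
have Pbad i : (P (bad i) <= (2 * expR (- (m%:R * t ^+ 2 / 8)))%:E)%E.
  (* The net contains 0, about which [gaussian_vector] says nothing; there both forms vanish. *)
  have [w0|/pd q0] := eqVneq (w i) 0; last exact: empirical_form_tail.
  rewrite (_ : bad i = set0) ?measure0 ?lee_fin ?mulr_ge0 ?expR_ge0//.
  apply/seteqP; split => x //=.
  rewrite /bad /= w0 /quadratic_form trmx0 !mulmx0 mxE !mulr0 subr0.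
  rewrite /sqnorm big1 ?normr0 ?ltxx// => k _.
  by rewrite mxE expr0n.
pose B := \big[setU/set0]_(i : I) bad i.
have mB : measurable B by apply: bigsetU_measurable => i _; exact: mbad.
have PB : (P B <= (#|I|%:R * (2 * expR (- (m%:R * t ^+ 2 / 8))))%:E)%E.
  apply: (@le_trans _ _ (\sum_(i : I) (2 * expR (- (m%:R * t ^+ 2 / 8)))%:E)%E).
    rewrite /B.
    (* Measurability is carried along the induction, since subadditivity for two sets asks for
       it. *)
    apply: (@proj2 (measurable (\big[setU/set0]_(i : I) bad i))).
    elim/big_ind2 : _ => [|A a C c [mA hA] [mC hC]|i _]; last by split.
      by split; rewrite ?measure0.
    split; first exact: measurableU.
    by apply: (le_trans (measureU2 _ mA mC)); exact: leeD.
  by rewrite sumEFin sumr_const -[X in (X%:E <= _)%E]mulr_natl lexx.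
exists (~` B); split; first exact: measurableC.
  rewrite probability_setC// EFinB; apply: leeB => //.
move=> x xB i; rewrite leNgt; apply/negP => h; apply: xB.
by rewrite /B (bigD1 i)//=; left.
Qed.

End empirical_form.

(** * The restricted isometry holds with high probability *)

Lemma half_le_ln2 (R : realType) : 1 / 2 <= ln 2 :> R.
Proof.
rewrite -ler_expR lnK ?posrE//.
have := expR_ge1Dx (- (1 / 2) : R); rewrite expRN.
have e0 : 0 < expR (1 / 2) :> R by exact: expR_gt0.
rewrite -(ler_pM2r e0) mulVf ?gt_eqF//; lra.
Qed.

Lemma ler_ln_nat (R : realType) (a b : nat) : (0 < a)%N -> (a <= b)%N ->
  ln a%:R <= ln b%:R :> R.
Proof.
move=> a0 ab; rewrite ler_ln ?posrE ?ltr0n ?ler_nat//.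
exact: leq_trans ab.
Qed.

Lemma ln_nat_ge0 (R : realType) (a : nat) : (0 < a)%N -> 0 <= ln a%:R :> R.
Proof. by move=> a0; apply: ln_ge0; rewrite ler1n. Qed.

(** The left side counts the choices of i, of s columns and of a grid point for s + 2 vectors. Since
    s < n, each grid factor 16 s + 50 is at most 64 n. *)
Lemma net_size_le (R : realType) (n s : nat) (K : R) :
  (0 < n)%N -> (s <= n.-1)%N -> s%:R <= K + 1 -> 1 <= K ->
  (n * n ^ s * (2 * (8 * s.+3).+1) ^ s.+2)%N%:R <=
  expR (19 * (K * ln n%:R) + 6 * ln 4) :> R.
Proof.
move=> n0 sn sK K1.
have L0 : 0 <= ln n%:R :> R by exact: ln_nat_ge0.
have nE : n%:R = expR (ln n%:R) :> R by rewrite lnK// posrE ltr0n.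
have h2 : s%:R * ln 2 <= s%:R * ln n%:R :> R.
  case: s sn {sK} => [|s] sn; first by rewrite !mul0r.
  apply: ler_wpM2l => //; apply: ler_ln_nat => //.
  by case: n n0 sn {L0 nE} => [|[|n]].
have h4 : ln 4 = 2 * ln 2 :> R.
  by rewrite (_ : 4 = 2 ^+ 2) ?lnXn// ?mulr_natl//; ring.
have h64 : (2 * (8 * s.+3).+1)%:R <= expR (ln n%:R + 6 * ln 2) :> R.
  rewrite expRD -nE -[6]/(6%:R) expRM_natl lnK ?posrE//.
  rewrite -natrX -natrM ler_nat.
  rewrite (_ : 2 ^ 6 = 64)%N//; lia.
rewrite natrM natrM !natrX.
apply: (@le_trans _ _ (expR (ln n%:R) * expR (ln n%:R) ^+ s *
    expR (ln n%:R + 6 * ln 2) ^+ s.+2)).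
  rewrite -nE ler_wpM2l ?mulr_ge0 ?exprn_ge0//.
  by apply: lerXn2r; rewrite ?nnegrE ?expR_ge0.
rewrite -!expRM_natl -!expRD ler_expR h4 -addn2 natrD.
have sL : s%:R * ln n%:R <= (K + 1) * ln n%:R by rewrite ler_wpM2r.
have KL : ln n%:R <= K * ln n%:R by rewrite ler_peMl.
move: (ln n%:R) (ln 2) (s%:R) L0 h2 sL KL => L l2 t L0 h2 sL KL.
lra.
Qed.

Section good_event.
Context (R : realType) (n m : nat) (Sigma : 'M[R]_n) (kappa delta K : R)
  (dO : measure_display) (Omega : measurableType dO)
  (P : probability Omega R)
  (X : 'I_m -> {RV P >-> n.-tuple (measurableTypeR R)}).
Hypothesis n0 : (0 < n)%N.
Hypothesis cov : is_covariance Sigma.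
Hypothesis uS : Sigma \in unitmx.
Hypothesis kappa01 : 0 < kappa <= 1.
Hypothesis K1 : 1 <= K.
Hypothesis delta01 : 0 < delta < 1.
Hypothesis iidX : iid_gaussian_samples Sigma X.
Hypothesis m_ge :
  200 * 300 ^+ 2 / kappa ^+ 2 * (K * ln n%:R + ln (4 / delta)) <= m%:R.

Let L0 : 0 <= ln n%:R :> R. Proof. exact: ln_nat_ge0. Qed.

Let k0 : 0 < kappa. Proof. by case/andP: kappa01. Qed.

Let ln4_delta : ln 4 <= ln (4 / delta) :> R.
Proof.
have /andP[d0 d1] := delta01.
rewrite ler_ln ?posrE ?divr_gt0// ler_pdivlMr//.
by rewrite ger_pMr// ltW.
Qed.

Let ln4_ge1 : 1 <= ln 4 :> R.
Proof.
have -> : ln 4 = 2 * ln 2 :> R.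
  by rewrite (_ : 4 = 2 ^+ 2) ?lnXn// ?mulr_natl//; ring.
by have := half_le_ln2 R; lra.
Qed.

Let m_ge' : 200 * 300 ^+ 2 * (K * ln n%:R + ln (4 / delta)) <=
  kappa ^+ 2 * m%:R.
Proof.
move: m_ge; rewrite mulrAC ler_pdivrMr ?exprn_gt0// => h.
by rewrite [leRHS]mulrC.
Qed.

Let KL0 : 0 <= K * ln n%:R.
Proof. by rewrite mulr_ge0//; apply: le_trans K1. Qed.

Lemma sample_size_large : 20 <= kappa ^+ 2 * m%:R.
Proof.
apply: le_trans m_ge'; move: KL0 ln4_delta ln4_ge1.
by move: (K * ln n%:R) (ln (4 / delta)) (ln 4) => a b c *; lra.
Qed.

Lemma sample_size_gt0 : (0 < m)%N.
Proof.
rewrite lt0n; apply/eqP => m0; have := sample_size_large.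
by rewrite m0 mulr0; lra.
Qed.

Lemma kappa2_le1 : kappa ^+ 2 <= 1.
Proof. by have /andP[h0 h1] := kappa01; rewrite expr_le1// ltW. Qed.

Lemma num_steps_le : (num_steps K)%:R <= K + 1.
Proof.
have K0 : 0 <= K by apply: le_trans K1.
rewrite /num_steps natr_absz ger0_norm ?ceil_ge0 ?(lt_le_trans _ K0)//.
  by have := ceilB1_lt K; lra.
Qed.

Lemma num_steps_ge : K <= (num_steps K)%:R.
Proof.
have K0 : 0 <= K by apply: le_trans K1.
rewrite /num_steps natr_absz ger0_norm ?ceil_ge0 ?(lt_le_trans _ K0)//.
exact: ceil_ge.
Qed.

Lemma selected_le_sample (i : 'I_n) (S : {set 'I_n}) :
  i \notin S -> (#|S| <= num_steps K)%N -> 10 * #|S|%:R <= m%:R :> R.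
Proof.
move=> iS ST; have Sn : (#|S| < n)%N.
  rewrite -[X in (_ < X)%N](card_ord n); apply: proper_card.
  by apply/fintype.properP; split; [exact/fintype.subsetP|exists i].
(* A nonempty S forces n >= 2, so that K <= 2 K log n; for n = 1 the logarithm vanishes. *)
case: (posnP #|S|) => [->|S0]; first by rewrite mulr0.
have l2 : ln 2 <= ln n%:R :> R by apply: ler_ln_nat => //;
  exact: leq_ltn_trans Sn.
have h1 : #|S|%:R <= 2 * K.
  apply: (@le_trans _ _ (num_steps K)%:R); first by rewrite ler_nat.
  by have := num_steps_le; have := K1; lra.
have h2 : K <= 2 * (K * ln n%:R).
  rewrite mulrCA ler_peMr//; first by apply: le_trans K1.
  by have := half_le_ln2 R; lra.
have h3 : kappa ^+ 2 * m%:R <= m%:R by rewrite ler_piMl// kappa2_le1.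
have h4 : 0 <= ln (4 / delta).
  by apply: le_trans ln4_delta; apply: le_trans ln4_ge1.
move: m_ge' KL0 h1 h2 h3 h4.
move: (K * ln n%:R) (ln (4 / delta)) (kappa ^+ 2 * m%:R) (#|S|%:R) (m%:R) => *.
lra.
Qed.

(** A set that avoids i has at most n - 1 elements; the cap keeps the grid parameter 8 (s + 3) of
    order n even when K is larger. *)
Let s := minn (num_steps K) n.-1.
(** Becomes kappa / 100 after the factor 3 lost in [net_form_le]. *)
Let tau := kappa / 300.
Local Notation M := (m%:R : R).

Let Q (x y : 'rV[R]_n) := M * population_form Sigma x y.

Let M0 : 0 < M. Proof. by rewrite ltr0n sample_size_gt0. Qed.

Let hQ : psd_form Q.
Proof. by apply: psd_form_scale; [exact: ltW|exact: population_form_psd]. Qed.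

Let Qdef x : Q x x = 0 -> x = 0.
Proof.
move=> /eqP; rewrite mulf_eq0 gt_eqF//= => /eqP h.
apply/eqP/negPn/negP => x0.
by have := population_form_definite cov uS x0; rewrite h ltxx.
Qed.

(** Sets of columns are enumerated by functions, repetitions allowed, so that all lists have the
    same length. *)
Let vs (p : 'I_n * {ffun 'I_s -> 'I_n}) : seq 'rV[R]_n :=
  [:: 'e_p.1, noise Sigma p.1 & [seq 'e_(p.2 a) | a <- enum 'I_s]].

Let size_vs p : size (vs p) = s.+2.
Proof. by rewrite /= size_map size_enum_ord. Qed.

Let I := {p : 'I_n * {ffun 'I_s -> 'I_n} &
  {ffun 'I_(size (vs p)) -> 'I_(8 * (size (vs p)).+1).+1 * bool}}.

Let w (x : I) : 'rV[R]_n := net_point Q (tagged x).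

Let card_I : #|{: I}| = (n * n ^ s * (2 * (8 * s.+3).+1) ^ s.+2)%N.
Proof.
rewrite card_tagged sumnE big_map.
rewrite (eq_bigr (fun=> (2 * (8 * s.+3).+1) ^ s.+2)%N).
  rewrite big_const_seq count_predT -cardE iter_addn_0.
  by rewrite card_prod card_ffun !card_ord mulnC.
by move=> p _; rewrite card_ffun card_prod card_bool !card_ord size_vs mulnC.
Qed.

Lemma failure_probability_le :
  #|{: I}|%:R * (2 * expR (- (M * tau ^+ 2 / 8))) <= delta.
Proof.
have /andP[d0 d1] := delta01.
have hs : s%:R <= K + 1.
  apply: le_trans num_steps_le; rewrite ler_nat; exact: geq_minl.
have := net_size_le n0 (geq_minr _ _) hs K1; rewrite -card_I => hI.
(* Origin of 200 * 300^2: the exponent 25 (K log n + log (4 / delta)) beats the logarithm 19 K log n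
   + 6 log 4 of the number of net points with log (4 / delta) to spare. *)
have hE : 25 * (K * ln n%:R + ln (4 / delta)) <= M * tau ^+ 2 / 8.
  rewrite /tau exprMn exprVn ler_pdivlMr ?ltr0n// mulrA
    ler_pdivlMr ?exprn_gt0 ?ltr0n//.
  by rewrite mulrC -mulrA; move: m_ge'; rewrite [M * _]mulrC; lra.
have h1 : expR (- (M * tau ^+ 2 / 8)) <=
    expR (- (25 * (K * ln n%:R + ln (4 / delta)))).
  by rewrite ler_expR lerN2.
apply: (@le_trans _ _ (expR (19 * (K * ln n%:R) + 6 * ln 4) *
   (2 * expR (- (25 * (K * ln n%:R + ln (4 / delta))))))).
  by rewrite ler_pM// ?mulr_ge0 ?expR_ge0// ler_pM2l.
rewrite mulrCA -expRD.
apply: (@le_trans _ _ (2 * expR (- ln (4 / delta)))).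
  rewrite ler_pM2l// ler_expR; move: KL0 ln4_delta ln4_ge1.
  by move: (K * ln n%:R) (ln (4 / delta)) (ln 4) => *; lra.
rewrite expRN lnK ?posrE ?divr_gt0// invf_div; lra.
Qed.

Lemma good_event : exists E : set Omega,
  [/\ measurable E, ((1 - delta)%:E <= P E)%E &
  forall omega, E omega -> forall i (S : {set 'I_n}) a b v z,
    i \notin S -> (#|S| <= num_steps K)%N -> supported S v ->
    z = a *: 'e_i + b *: noise Sigma i + v ->
    `|empirical_form (data_matrix X omega) z z - M * population_form Sigma z z|
      <= kappa / 100 * (M * population_form Sigma z z)].
Proof.
have t0 : 0 < tau by apply: divr_gt0; [exact: (andP kappa01).1|rewrite ltr0n].
have t01 : 0 < tau <= 1 / 2.
  by rewrite t0 /tau; have /andP[_ h1] := kappa01; lra.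
have [E [mE PE hE]] := empirical_form_event iidX w
  (population_form_definite cov uS) t01.
exists E; split => //.
  by apply: le_trans PE; rewrite lee_fin lerD2l lerN2 failure_probability_le.
move=> omega Eo i S a b v z iS ST hv hz.
have Sn : (#|S| <= s)%N.
  rewrite leq_min ST -ltnS prednK//.
  rewrite -[X in (_ < X)%N](card_ord n); apply: proper_card.
  by apply/fintype.properP; split; [exact/fintype.subsetP|exists i].
(* Beyond the elements of S the list is padded with i, whose vector is in the span anyway. *)
pose f : {ffun 'I_s -> 'I_n} := [ffun c : 'I_s => nth i (enum S) c].
have net g : let y := net_point Q (vs := vs (i, f)) g in
    `|empirical_form (data_matrix X omega) y y - Q y y| <= tau * Q y y.
  by have := hE omega Eo (Tagged _ g : I); rewrite /w /= sqnormE.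
have := net_form_le hQ Qdef (empirical_form_psd _) t0 net (z := z).
have -> : 3 * tau = kappa / 100 by rewrite /tau; field.
apply.
have sub := expanded_subspace hQ (vs (i, f)).
have inV u : u \in vs (i, f) -> expanded Q (vs (i, f)) u.
  exact: expanded_span.
rewrite hz; apply: (linear_subspaceD sub); first apply: (linear_subspaceD sub).
- by apply: (linear_subspaceZ _ sub); apply: inV; rewrite !in_cons eqxx.
- by apply: (linear_subspaceZ _ sub); apply: inV; rewrite !in_cons eqxx orbT.
rewrite (supported_sum hv); apply: (linear_subspace_sum _ sub) => j jS.
apply: (linear_subspaceZ _ sub); apply: inV; rewrite !in_cons; apply/orP; right.
apply/orP; right; apply/mapP.
have hj : (index j (enum S) < s)%N.
  by apply: leq_trans Sn; rewrite cardE index_mem mem_enum.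
exists (Ordinal hj); first by rewrite mem_enum.
by rewrite /= ffunE /= nth_index// mem_enum.
Qed.

End good_event.

(** * Running time: executing programs *)

Section runs.
Context (R : realType).
Implicit Types (c : prog) (s : state R) (b : bexp).

Fixpoint iwrites c : seq nat :=
  match c with
  | SetIReg a _ => [:: a]
  | Seq c1 c2 | If _ c1 c2 => iwrites c1 ++ iwrites c2
  | While _ c => iwrites c
  | _ => [::]
  end.

Fixpoint rwrites c : seq nat :=
  match c with
  | SetRReg a _ => [:: a]
  | Seq c1 c2 | If _ c1 c2 => rwrites c1 ++ rwrites c2
  | While _ c => rwrites c
  | _ => [::]
  end.

Fixpoint writes_imem c : bool :=
  match c with
  | SetIMem _ _ => true
  | Seq c1 c2 | If _ c1 c2 => writes_imem c1 || writes_imem c2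
  | While _ c => writes_imem c
  | _ => false
  end.

Fixpoint writes_rmem c : bool :=
  match c with
  | SetRMem _ _ => true
  | Seq c1 c2 | If _ c1 c2 => writes_rmem c1 || writes_rmem c2
  | While _ c => writes_rmem c
  | _ => false
  end.

(** What a program cannot touch is read off its syntax, so that invariants mention only what
    changes. *)
Record frame c s s' : Prop := Frame {
  frame_ireg : forall a, a \notin iwrites c -> ireg s' a = ireg s a;
  frame_rreg : forall a, a \notin rwrites c -> rreg s' a = rreg s a;
  frame_imem : ~~ writes_imem c -> imem s' = imem s;
  frame_rmem : ~~ writes_rmem c -> rmem s' = rmem s }.

Lemma frame_trans c s1 s2 s3 : frame c s1 s2 -> frame c s2 s3 -> frame c s1 s3.
Proof.
move=> [h1 h2 h3 h4] [g1 g2 g3 g4]; split.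
- by move=> a ha; rewrite g1// h1.
- by move=> a ha; rewrite g2// h2.
- by move=> hc; rewrite g3// h3.
- by move=> hc; rewrite g4// h4.
Qed.

Lemma frame_sub c c' s s' : {subset iwrites c <= iwrites c'} ->
  {subset rwrites c <= rwrites c'} -> (writes_imem c -> writes_imem c') ->
  (writes_rmem c -> writes_rmem c') -> frame c s s' -> frame c' s s'.
Proof.
move=> h1 h2 h3 h4 [g1 g2 g3 g4]; split.
- by move=> a ha; apply: g1; apply: contra ha; exact: h1.
- by move=> a ha; apply: g2; apply: contra ha; exact: h2.
- by move=> hc; apply: g3; apply: contra hc.
- by move=> hc; apply: g4; apply: contra hc.
Qed.

Lemma exec_frame c s s' t : exec c s s' t -> frame c s s'.
Proof.
elim=> {c s s' t} //.
- by move=> s a e; split => //= x; rewrite inE => /negPf ->.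
- by move=> s a e; split => //= x; rewrite inE => /negPf ->.
- move=> c1 c2 s1 s2 s3 t1 t2 _ f1 _ f2.
  by apply: (frame_trans (s2 := s2)); 
    [apply: frame_sub f1 => [a|a||]|apply: frame_sub f2 => [a|a||]];
    rewrite /= ?mem_cat => ->; rewrite ?orbT ?orTb.
- by move=> b c1 c2 s s' t _; case: (beval s b) => f;
    apply: frame_sub f => [a|a||]; rewrite /= ?mem_cat => ->;
      rewrite ?orbT ?orTb.
- move=> b c s1 s2 s3 t1 t2 _ _ f1 _ f2.
  by apply: (frame_trans _ f2); exact: frame_sub f1.
Qed.

(** The cost is bounded rather than exact, so that branches of different lengths combine. *)
Definition runs c s (n : nat) (Q : state R -> Prop) : Prop :=
  exists s' t, [/\ exec c s s' t, (t <= n)%N & Q s'].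

Lemma runs_weaken c s n n' (Q Q' : state R -> Prop) : runs c s n Q ->
  (n <= n')%N -> (forall s', frame c s s' -> Q s' -> Q' s') -> runs c s n' Q'.
Proof.
move=> [s' [t [h1 h2 h3]]] nn' QQ'; exists s', t; split => //.
  exact: leq_trans nn'.
by apply: QQ' => //; exact: exec_frame h1.
Qed.

Lemma runs_seq c1 c2 s n1 n2 (Q1 Q2 : state R -> Prop) : runs c1 s n1 Q1 ->
  (forall s1, frame c1 s s1 -> Q1 s1 -> runs c2 s1 n2 Q2) ->
  runs (Seq c1 c2) s (n1 + n2) Q2.
Proof.
move=> [s1 [t1 [e1 l1 q1]]] /(_ s1 (exec_frame e1) q1) [s2 [t2 [e2 l2 q2]]].
by exists s2, (t1 + t2)%N; split => //; [apply: exec_seq e1 e2|exact: leq_add].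
Qed.

Lemma runs_if b c1 c2 s n (Q : state R -> Prop) :
  (beval s b -> runs c1 s n Q) -> (~~ beval s b -> runs c2 s n Q) ->
  runs (If b c1 c2) s (bcost b + n) Q.
Proof.
move=> h1 h2; have [s' [t [e l q]]] : runs (if beval s b then c1 else c2) s n Q.
  by case: ifPn.
by exists s', (bcost b + t)%N; split => //; [exact: exec_if|rewrite leq_add2l].
Qed.

Fixpoint straight c : bool :=
  match c with
  | Seq c1 c2 | If _ c1 c2 => straight c1 && straight c2
  | While _ _ => false
  | _ => true
  end.

(** Symbolic execution of loop-free code, after which postconditions are proved by computation. *)
Fixpoint run_straight c s : state R :=
  match c with
  | Skip | While _ _ => s
  | SetIReg a e =>
      State [eta ireg s with a |-> ieval s e] (rreg s) (imem s) (rmem s)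
  | SetRReg a e =>
      State (ireg s) [eta rreg s with a |-> reval s e] (imem s) (rmem s)
  | SetIMem a e =>
      State (ireg s) (rreg s) [eta imem s with ieval s a |-> ieval s e] (rmem s)
  | SetRMem a e =>
      State (ireg s) (rreg s) (imem s) [eta rmem s with ieval s a |-> reval s e]
  | Seq c1 c2 => run_straight c2 (run_straight c1 s)
  | If b c1 c2 => if beval s b then run_straight c1 s else run_straight c2 s
  end.

Fixpoint straight_cost c : nat :=
  match c with
  | Skip => 1
  | SetIReg a e => (icost e).+1
  | SetRReg a e => (rcost e).+1
  | SetIMem a e => (icost a + icost e).+1
  | SetRMem a e => (icost a + rcost e).+1
  | Seq c1 c2 => straight_cost c1 + straight_cost c2
  | If b c1 c2 => bcost b + maxn (straight_cost c1) (straight_cost c2)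
  | While _ _ => 0
  end.

Lemma runs_straight c s (Q : state R -> Prop) : straight c ->
  Q (run_straight c s) -> runs c s (straight_cost c) Q.
Proof.
elim: c s Q => //=.
- by move=> s Q _ q; exists s, 1%N; split => //; exact: exec_skip.
- by move=> a e s Q _ q; eexists _, _; split; [exact: exec_ireg|by []|].
- by move=> a e s Q _ q; eexists _, _; split; [exact: exec_rreg|by []|].
- by move=> a e s Q _ q; eexists _, _; split; [exact: exec_imem|by []|].
- by move=> a e s Q _ q; eexists _, _; split; [exact: exec_rmem|by []|].
- move=> c1 IH1 c2 IH2 s Q /andP[h1 h2] q.
  apply: (runs_seq (Q1 := fun s1 => s1 = run_straight c1 s)); first exact: IH1.
  by move=> s1 _ ->; exact: IH2.
- move=> b c1 IH1 c2 IH2 s Q /andP[h1 h2]; case: ifPn => hb q;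
    apply: runs_if => hb'.
  + by apply: (runs_weaken (IH1 s Q h1 q)) => //; exact: leq_maxl.
  + by rewrite hb in hb'.
  + by rewrite hb' in hb.
  + by apply: (runs_weaken (IH2 s Q h2 q)) => //; exact: leq_maxr.
Qed.

Lemma straight_frame c s : straight c -> frame c s (run_straight c s).
Proof.
move=> h; have [s' [t [e _ ->]]] := @runs_straight c s
  (eq (run_straight c s)) h erefl.
exact: exec_frame e.
Qed.

Lemma runs_straight_seq c1 c2 s n (Q : state R -> Prop) : straight c1 ->
  runs c2 (run_straight c1 s) n Q ->
  runs (Seq c1 c2) s (straight_cost c1 + n) Q.
Proof.
move=> h1 h2; apply: (runs_seq (Q1 := fun s1 => s1 = run_straight c1 s)).
  exact: runs_straight.
by move=> s1 _ ->.
Qed.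

(** Each iteration may assume the frame from the start of the loop, so that [Inv] need not repeat
    what the loop leaves alone. *)
Lemma runs_while b c s0 (N t : nat) (Inv : nat -> state R -> Prop) :
  Inv 0%N s0 ->
  (forall k s, (k < N)%N -> frame c s0 s -> Inv k s ->
     beval s b /\ runs c s t (Inv k.+1)) ->
  (forall s, frame c s0 s -> Inv N s -> ~~ beval s b) ->
  runs (While b c) s0 (N * (bcost b + t) + bcost b) (Inv N).
Proof.
move=> I0 Istep Iend.
suff H k s : (k <= N)%N -> frame c s0 s -> Inv (N - k)%N s ->
    runs (While b c) s (k * (bcost b + t) + bcost b) (Inv N).
  by apply: H => //; rewrite subnn.
elim: k s => [|k IH] s kN fs Is.
  rewrite subn0 in Is; exists s, (bcost b); split => //.
  by apply: exec_while_false; exact: Iend.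
have lt : (N - k.+1 < N)%N by rewrite ltn_subrL (leq_ltn_trans _ kN).
have [hb [s1 [t1 [e1 l1 q1]]]] := Istep _ s lt fs Is.
have NE : (N - k.+1).+1 = (N - k)%N by rewrite subnSK.
rewrite NE in q1.
have [s2 [t2 [e2 l2 q2]]] :=
  IH s1 (ltnW kN) (frame_trans fs (exec_frame e1)) q1.
exists s2, (bcost b + t1 + t2)%N; split => //.
  exact: exec_while_true e1 e2.
by rewrite mulSn -!addnA leq_add2l leq_add.
Qed.

End runs.

(** * Running time: residuals by Gram-Schmidt *)

(** Layout shared by the programs below. Integer registers: 0 to 3 hold n, m, i, T; 4 holds m n; 5
    the number of selected nodes; 6 the number of columns to orthogonalize; 7 and 9 the indices, 8
    and 10 the addresses of the current and of an earlier vector; 11 a loop counter; 12 a data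
    address; 13 the OMP step; 14 whether a candidate was seen; 15 the candidate and 16 the best one;
    17 the cardinal of the pruned set; 18 the position in the pruning. Real registers: 0 holds nu; 1
    and 2 inner products; 3 a coefficient; 4 the best residual; 5 the current variance, 6 the
    threshold, 7 the variance without the tested node. Integer memory holds n marks, then the list
    of nodes; real memory holds the data, then the orthogonalized vectors. *)
Definition incr (a : nat) : prog := SetIReg a (IAdd (IReg a) (IConst 1)).

Definition cell (p k : nat) : rexp := RMem (IAdd (IReg p) (IReg k)).

Definition dot_body : prog :=
  Seq (SetRReg 1 (RAdd (RReg 1) (RMul (cell 8 11) (cell 10 11))))
 (Seq (SetRReg 2 (RAdd (RReg 2) (RMul (cell 10 11) (cell 10 11))))
      (incr 11)).

Definition dot_prog : prog :=
  Seq (Seq (SetRReg 1 (ROfNat (IConst 0)))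
      (Seq (SetRReg 2 (ROfNat (IConst 0)))
           (SetIReg 11 (IConst 0))))
      (While (ILt (IReg 11) (IReg 1)) dot_body).

Definition axpy_body : prog :=
  Seq (SetRMem (IAdd (IReg 8) (IReg 11))
         (RSub (cell 8 11) (RMul (RReg 3) (cell 10 11))))
      (incr 11).

Definition axpy_prog : prog :=
  Seq (SetIReg 11 (IConst 0))
      (While (ILt (IReg 11) (IReg 1)) axpy_body).

Definition current_column : iexp := IMem (IAdd (IReg 0) (IReg 7)).

(** The column is multiplied by the mark of its node: an unmarked node yields the zero vector, so
    that a node is dropped without rewriting the list. *)
Definition copy_body : prog :=
  Seq (SetRMem (IAdd (IReg 8) (IReg 11))
         (RMul (RMem (IReg 12)) (ROfNat (IMem current_column))))
 (Seq (SetIReg 12 (IAdd (IReg 12) (IReg 0)))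
      (incr 11)).

Definition copy_prog : prog :=
  Seq (Seq (SetIReg 11 (IConst 0))
           (SetIReg 12 current_column))
      (While (ILt (IReg 11) (IReg 1)) copy_body).

Definition residual_body : prog :=
  Seq dot_prog
 (Seq (SetRReg 3 (RDiv (RReg 1) (RReg 2)))
 (Seq axpy_prog
      (Seq (SetIReg 10 (IAdd (IReg 10) (IReg 1)))
           (incr 9)))).

Definition residual_prog : prog :=
  Seq (Seq (SetIReg 9 (IConst 0))
           (SetIReg 10 (IReg 4)))
      (While (ILt (IReg 9) (IReg 7)) residual_body).

Definition gs_body : prog :=
  Seq copy_prog
 (Seq residual_prog
      (Seq (SetIReg 8 (IAdd (IReg 8) (IReg 1)))
           (incr 7))).

(** The predicted column comes last in the list, so the square norm of the last orthogonalized
    vector is the residual sum of squares. The loop leaves register 8 one vector too far. *)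
Definition rss_prog : prog :=
  Seq (Seq (SetIReg 7 (IConst 0))
           (SetIReg 8 (IReg 4)))
 (Seq (While (ILt (IReg 7) (IReg 6)) gs_body)
 (Seq (Seq (SetIReg 8 (ISub (IReg 8) (IReg 1)))
           (SetIReg 10 (IReg 8)))
      dot_prog)).

Lemma iota0_rcons k : iota 0 k.+1 = rcons (iota 0 k) k.
Proof. by rewrite -addn1 iotaD cats1. Qed.

Section gram_schmidt_program.
Context (R : realType) (n m : nat).
Implicit Types (s : state R).

Definition vec s (p : nat) : 'cV[R]_m := \col_(k < m) rmem s (p + k)%N.

Lemma dotcol_vec s p q :
  dotcol (vec s p) (vec s q) =
  \sum_(0 <= k < m) rmem s (p + k)%N * rmem s (q + k)%N.
Proof. by rewrite big_mkord; apply: eq_bigr => k _; rewrite !mxE. Qed.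

Lemma runs_dot s : ireg s 1 = m ->
  runs dot_prog s (40 * m.+1) (fun s' =>
    rreg s' 1 = dotcol (vec s (ireg s 8)) (vec s (ireg s 10)) /\
    rreg s' 2 = dotcol (vec s (ireg s 10)) (vec s (ireg s 10))).
Proof.
move=> sm; rewrite !dotcol_vec.
pose Inv (k : nat) s' := [/\ ireg s' 11 = k,
  rreg s' 1 = \sum_(0 <= l < k) rmem s (ireg s 8 + l)%N * rmem s
    (ireg s 10 + l)%N &
  rreg s' 2 = \sum_(0 <= l < k) rmem s (ireg s 10 + l)%N * rmem s
    (ireg s 10 + l)%N].
apply: (runs_weaken (Q := Inv m)).
- apply: runs_straight_seq => //.
  apply: (runs_while (N := m) (Inv := Inv)).
  + by split => //=; rewrite big_geq.
  + move=> k s1 km f [h1 h2 h3]; split.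
      by rewrite /= h1 (frame_ireg f)//= sm.
    apply: runs_straight => //; split => /=; first by rewrite h1 addn1.
      rewrite big_nat_recr//= h2 (frame_rmem f)//= h1.
      by rewrite !(frame_ireg f).
    rewrite big_nat_recr//= h3 (frame_rmem f)//= h1.
    by rewrite !(frame_ireg f).
  + by move=> s1 f [h1 _ _]; rewrite /= h1 (frame_ireg f)//= sm ltnn.
- by rewrite /=; lia.
- by move=> s' _ [].
Qed.

Lemma runs_axpy s : ireg s 1 = m -> (ireg s 10 + m <= ireg s 8)%N ->
  runs axpy_prog s (40 * m.+1) (fun s' => forall x,
    rmem s' x = if (ireg s 8 <= x < ireg s 8 + m)%N
      then rmem s x - rreg s 3 * rmem s (ireg s 10 + (x - ireg s 8))%N
      else rmem s x).
Proof.
move=> sm disj.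
pose Inv (k : nat) s' := ireg s' 11 = k /\ forall x,
    rmem s' x = if (ireg s 8 <= x < ireg s 8 + k)%N
      then rmem s x - rreg s 3 * rmem s (ireg s 10 + (x - ireg s 8))%N
      else rmem s x.
apply: (runs_weaken (Q := Inv m)).
- apply: runs_straight_seq => //.
  apply: (runs_while (N := m) (Inv := Inv)).
  + by split => //= x; rewrite addn0 ltnNge andbN.
  + move=> k s1 km f [h1 h2]; split.
      by rewrite /= h1 (frame_ireg f)//= sm.
    apply: runs_straight => //; split => /=; first by rewrite h1 addn1.
    move=> x; rewrite h1 !(frame_ireg f)//= (frame_rreg f)//=.
    case: eqP => [->|xk].
      rewrite !h2 ifF; last by lia.
      rewrite ifF; last by lia.
      rewrite ifT; last by lia.
      by rewrite addKn.
    rewrite h2; case: ifP => c1; case: ifP => c2 //; lia.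
  + by move=> s1 f [h1 _]; rewrite /= h1 (frame_ireg f)//= sm ltnn.
- by rewrite /=; lia.
- by move=> s' _ [].
Qed.

Lemma runs_copy s : ireg s 0 = n -> ireg s 1 = m -> (m * n <= ireg s 8)%N ->
  let j := imem s (n + ireg s 7)%N in
  (j < n)%N ->
  runs copy_prog s (40 * m.+1) (fun s' => forall x,
    rmem s' x = if (ireg s 8 <= x < ireg s 8 + m)%N
      then rmem s (j + (x - ireg s 8) * n)%N * (imem s j)%:R
      else rmem s x).
Proof.
move=> sn sm disj j jn.
pose Inv (k : nat) s' := [/\ ireg s' 11 = k, ireg s' 12 = (j + k * n)%N &
  forall x,
    rmem s' x = if (ireg s 8 <= x < ireg s 8 + k)%N
      then rmem s (j + (x - ireg s 8) * n)%N * (imem s j)%:R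
      else rmem s x].
apply: (runs_weaken (Q := Inv m)).
- apply: runs_straight_seq => //.
  apply: (runs_while (N := m) (Inv := Inv)).
  + split => //=; first by rewrite sn mul0n addn0.
    by move=> x; rewrite addn0 ltnNge andbN.
  + move=> k s1 km f [h1 h2 h3]; split.
      by rewrite /= h1 (frame_ireg f)//= sm.
    apply: runs_straight => //; split => /=; first by rewrite h1 addn1.
      by rewrite h2 (frame_ireg f)//= sn mulSn; lia.
    move=> x; rewrite h1 h2 !(frame_ireg f)//= (frame_imem f)//= sn -/j.
    have lt : (j + k * n < m * n)%N.
      by apply: (@leq_trans (k.+1 * n));
        [rewrite mulSn ltn_add2r|rewrite leq_mul2r km orbT].
    case: eqP => [->|xk].
      rewrite h3 ifF; last by lia.
      rewrite ifT; last by lia.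
      by rewrite addKn.
    rewrite h3; case: ifP => c1; case: ifP => c2 //; lia.
  + by move=> s1 f [h1 _ _]; rewrite /= h1 (frame_ireg f)//= sm ltnn.
- by rewrite /=; lia.
- by move=> s' _ [].
Qed.

Lemma eq_vec s s' p : (forall x, (p <= x < p + m)%N -> rmem s' x = rmem s x) ->
  vec s' p = vec s p.
Proof.
by move=> h; apply/colP => k; rewrite !mxE h// leq_addr/= ltn_add2l ltn_ord.
Qed.

Lemma runs_residual s : ireg s 1 = m ->
  ireg s 8 = (ireg s 4 + ireg s 7 * m)%N ->
  runs residual_prog s (ireg s 7 * (110 * m.+1) + 100) (fun s' =>
    vec s' (ireg s 8) =
      gs_residual (@dotcol R m)
        [seq vec s (ireg s 4 + b * m) | b <- iota 0 (ireg s 7)]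
          (vec s (ireg s 8)) /\
    forall x, ~~ (ireg s 8 <= x < ireg s 8 + m)%N -> rmem s' x = rmem s x).
Proof.
move=> sm spa; set a := ireg s 7; set pa := ireg s 8.
pose Inv (b : nat) s' := [/\ ireg s' 9 = b, ireg s' 10 = (ireg s 4 + b * m)%N,
  vec s' pa = gs_residual (@dotcol R m)
    [seq vec s (ireg s 4 + b * m) | b <- iota 0 b] (vec s pa) &
  forall x, ~~ (pa <= x < pa + m)%N -> rmem s' x = rmem s x].
apply: (runs_weaken (Q := Inv a)).
- apply: runs_straight_seq => //.
  apply: (runs_while (N := a) (Inv := Inv) (t := (100 * m.+1)%N)).
  + by split => //=; rewrite mul0n addn0.
  + move=> b s1 ba f [h1 h2 h3 h4]; split.
      by rewrite /= h1 (frame_ireg f).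
    have s1m : ireg s1 1 = m by rewrite (frame_ireg f).
    have s1pa : ireg s1 8 = pa by rewrite (frame_ireg f).
    have bma : (b * m + m <= a * m)%N by rewrite addnC -mulSn leq_mul2r ba orbT.
    have disj : (ireg s 4 + b * m + m <= pa)%N.
      by rewrite /pa spa -addnA leq_add2l.
    have vq : vec s1 (ireg s 4 + b * m) = vec s (ireg s 4 + b * m).
      by apply: eq_vec => x hx; apply: h4; lia.
    apply: (runs_weaken (Q := Inv b.+1)).
    * apply: runs_seq; first exact: runs_dot.
      move=> s2 f2 [d1 d2]; apply: runs_straight_seq => //.
      apply: runs_seq; first apply: runs_axpy.
      - by rewrite /= (frame_ireg f2).
      - by rewrite /= !(frame_ireg f2)// h2 s1pa.
      move=> s3 f3 h; apply: runs_straight => //.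
      rewrite /= in h d1 d2.
      have r2 : rmem s2 = rmem s1 by rewrite (frame_rmem f2).
      have {h}h x : rmem s3 x = if (pa <= x < pa + m)%N
          then rmem s1 x - dotcol (vec s1 pa) (vec s1 (ireg s 4 + b * m)) /
             dotcol (vec s1 (ireg s 4 + b * m)) (vec s1 (ireg s 4 + b * m)) *
             rmem s1 (ireg s 4 + b * m + (x - pa))%N
          else rmem s1 x.
        by rewrite h d1 d2 r2 !(frame_ireg f2)// h2 s1pa.
      split; rewrite ?iota0_rcons /=.
      - by rewrite (frame_ireg f3)//= (frame_ireg f2)//= h1 addn1.
      - rewrite !(frame_ireg f3)//= !(frame_ireg f2)//= h2 s1m mulSn.
        by rewrite addnAC addnA.
      - rewrite map_rcons /gs_residual foldl_rcons
          -/(gs_residual _ _ _) -h3 -vq.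
        apply/colP => k; rewrite !mxE h.
        rewrite ifT; last by rewrite leq_addr ltn_add2l ltn_ord.
        by rewrite addKn.
      - by move=> x hx; rewrite h ifF ?h4//; apply/negbTE.
    * by rewrite /=; lia.
    * by [].
  + by move=> s1 f [h1 _ _ _]; rewrite /= h1 (frame_ireg f)//= ltnn.
- by rewrite /=; lia.
- by move=> s' _ [].
Qed.

Definition selected_column s (c : nat) : 'cV[R]_m :=
  (imem s (imem s (n + c)))%:R *:
    \col_(k < m) rmem s (imem s (n + c) + k * n)%N.

Lemma runs_rss s (l : nat) : ireg s 0 = n -> ireg s 1 = m ->
  ireg s 4 = (m * n)%N -> ireg s 6 = l.+1 ->
  (forall c, (c < l.+1)%N -> imem s (n + c)%N < n)%N ->
  runs rss_prog s (500 * (l.+1 ^ 2 * m.+1)) (fun s' =>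
    (let r := gs_residual (@dotcol R m)
      (gram_schmidt (@dotcol R m) [seq selected_column s c | c <- iota 0 l])
      (selected_column s l) in
     rreg s' 1 = dotcol r r) /\
    forall x, (x < m * n)%N -> rmem s' x = rmem s x).
Proof.
move=> sn sm s4 s6 hl.
pose Inv (a : nat) s' := [/\ ireg s' 7 = a, ireg s' 8 = (m * n + a * m)%N,
  [seq vec s' (m * n + c * m) | c <- iota 0 a] =
    gram_schmidt (@dotcol R m) [seq selected_column s c | c <- iota 0 a] &
  forall x, (x < m * n)%N -> rmem s' x = rmem s x].
apply: (runs_weaken (Q := fun s' => (let r := gs_residual (@dotcol R m)
      (gram_schmidt (@dotcol R m) [seq selected_column s c | c <- iota 0 l])
      (selected_column s l) in
     rreg s' 1 = dotcol r r) /\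
    forall x, (x < m * n)%N -> rmem s' x = rmem s x)).
- apply: runs_straight_seq => //.
  apply: runs_seq.
    apply: (runs_while (N := l.+1) (Inv := Inv)
      (t := (40 * m.+1 + ((l * (110 * m.+1) + 100) + 20))%N)).
    + by split => //=; rewrite s4 mul0n addn0.
    + move=> a s1 al f [h1 h2 h3 h4]; split.
        by rewrite /= h1 (frame_ireg f)//= s6.
      have s1n : ireg s1 0 = n by rewrite (frame_ireg f).
      have s1m : ireg s1 1 = m by rewrite (frame_ireg f).
      have s14 : ireg s1 4 = (m * n)%N by rewrite (frame_ireg f).
      have im : imem s1 = imem s by rewrite (frame_imem f).
      have ja : (imem s (n + a) < n)%N by exact: hl.
      apply: runs_seq.
        apply: runs_copy => //; first by rewrite h2 leq_addr.
        by rewrite im h1.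
      move=> s2 f2 hc; rewrite im h1 h2 in hc.
      have r2 x : (x < m * n + a * m)%N -> rmem s2 x = rmem s1 x.
        by move=> hx; rewrite hc ifF//; lia.
      have v2 : vec s2 (m * n + a * m) = selected_column s a.
        apply/colP => k; rewrite !mxE hc.
        rewrite ifT; last by rewrite leq_addr ltn_add2l ltn_ord.
        rewrite addKn mulrC h4//.
        apply: (@leq_trans (k.+1 * n)); first by rewrite mulSn ltn_add2r.
        by rewrite leq_mul2r ltn_ord orbT.
      apply: (runs_seq (n1 := (l * (110 * m.+1) + 100)%N)).
        apply: (runs_weaken (runs_residual _ _)).
        * by rewrite (frame_ireg f2).
        * by rewrite !(frame_ireg f2)//= h1 h2 s14.
        * by rewrite (frame_ireg f2)//= h1 leq_add2r leq_mul2r -ltnS al orbT.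
        * move=> s' _ h; exact: h.
      move=> s3 f3; rewrite !(frame_ireg f2)//= h1 h2 s14 v2 => -[e1 e2].
      apply: (runs_weaken (runs_straight (Q := Inv a.+1) _ _)) => //.
      split; rewrite ?iota0_rcons /=.
      * by rewrite (frame_ireg f3)//= (frame_ireg f2)//= h1 addn1.
      * rewrite !(frame_ireg f3)//= !(frame_ireg f2)//= h2 s1m mulSn.
        by rewrite addnAC addnA.
      * have prev : [seq vec s2 (m * n + b * m) | b <- iota 0 a] =
            gram_schmidt (@dotcol R m)
              [seq selected_column s c | c <- iota 0 a].
          rewrite -h3; apply/eq_in_map => c; rewrite mem_iota => /andP[_ ca].
          have : (c * m + m <= a * m)%N
            by rewrite addnC -mulSn leq_mul2r ca orbT.
          by move=> ?; apply: eq_vec => x hx; apply: r2; lia.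
        rewrite !map_rcons gram_schmidt_rcons -prev; congr rcons => //.
        rewrite prev -h3; apply/eq_in_map => c; rewrite mem_iota => /andP[_ ca].
        have : (c * m + m <= a * m)%N by rewrite addnC -mulSn leq_mul2r ca orbT.
        move=> ?; apply: eq_vec => x hx /=; rewrite e2; last by lia.
        by apply: r2; lia.
      * by move=> x hx; rewrite e2 ?r2 ?h4//; lia.
    + by move=> s1 f [h1 _ _ _]; rewrite /= h1 (frame_ireg f)//= s6 ltnn.
  move=> s1 f [h1 h2 h3 h4].
  have s1m : ireg s1 1 = m by rewrite (frame_ireg f).
  apply: runs_straight_seq => //.
  apply: (runs_weaken (runs_dot _)) => //= s' f' [d1 _].
  split; last by move=> x hx; rewrite (frame_rmem f')//= h4.
  have veq i r im p : vec (State i r im (rmem s1)) p = vec s1 p by [].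
  rewrite d1 !veq h2 s1m mulSn [(m + _)%N]addnC addnA addnK.
  have -> : vec s1 (m * n + l * m) = gs_residual (@dotcol R m)
      (gram_schmidt (@dotcol R m) [seq selected_column s c | c <- iota 0 l])
      (selected_column s l).
    have := congr1 (fun x => last 0 x) h3.
    by rewrite iota0_rcons !map_rcons gram_schmidt_rcons !last_rcons.
  by [].
- rewrite /=; nia.
- by [].
Qed.

End gram_schmidt_program.

(** * Running time: the greedy and pruning loops *)

Definition record_best : prog :=
  Seq (SetRReg 4 (RReg 1))
 (Seq (SetIReg 16 (IReg 15))
      (SetIReg 14 (IConst 1))).

(** The candidate and i are written past the end of the list without changing register 5, so that
    clearing the mark undoes the trial. *)
Definition push_candidate : prog :=
  Seq (SetIMem (IAdd (IReg 0) (IReg 5)) (IReg 15))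
 (Seq (SetIMem (IAdd (IAdd (IReg 0) (IReg 5)) (IConst 1)) (IReg 2))
 (Seq (SetIMem (IReg 15) (IConst 1))
      (SetIReg 6 (IAdd (IReg 5) (IConst 2))))).

Definition compare_candidate : prog :=
  Seq (SetIMem (IReg 15) (IConst 0))
      (If (IEq (IReg 14) (IConst 0)) record_best
          (If (RLt (RReg 1) (RReg 4)) record_best Skip)).

Definition candidate_body : prog :=
  Seq (If (IEq (IMem (IReg 15)) (IConst 0))
          (Seq push_candidate (Seq rss_prog compare_candidate))
          Skip)
      (incr 15).

Definition select_prog : prog :=
  Seq (Seq (SetIReg 14 (IConst 0)) (SetIReg 15 (IConst 0)))
      (While (ILt (IReg 15) (IReg 0)) candidate_body).

(** Register 14 is still 0 only if every node but i is selected, the stopping case of OMP. *)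
Definition commit_candidate : prog :=
  Seq (If (IEq (IReg 14) (IConst 1))
          (Seq (SetIMem (IAdd (IReg 0) (IReg 5)) (IReg 16))
          (Seq (SetIMem (IReg 16) (IConst 1))
               (incr 5)))
          Skip)
      (incr 13).

Definition omp_prog : prog :=
  Seq (SetIReg 13 (IConst 0))
      (While (ILt (IReg 13) (IReg 3)) (Seq select_prog commit_candidate)).

Definition hat_var_exp (card : iexp) : rexp :=
  RDiv (RReg 1) (RSub (ROfNat (IReg 1)) (ROfNat card)).

Definition prune_body : prog :=
  Seq (SetIMem (IMem (IAdd (IReg 0) (IReg 18))) (IConst 0))
 (Seq rss_prog
      (Seq (SetRReg 7 (hat_var_exp (ISub (IReg 17) (IConst 1))))
      (Seq (If (RLt (RSub (RReg 7) (RReg 5)) (RReg 6))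
               (Seq (SetIReg 17 (ISub (IReg 17) (IConst 1)))
                    (SetRReg 5 (RReg 7)))
               (SetIMem (IMem (IAdd (IReg 0) (IReg 18))) (IConst 1)))
           (incr 18)))).

Definition prune_prog : prog :=
  Seq (Seq (SetIMem (IAdd (IReg 0) (IReg 5)) (IReg 2))
      (Seq (SetIReg 6 (IAdd (IReg 5) (IConst 1)))
           (SetIReg 17 (IReg 5))))
 (Seq rss_prog
 (Seq (Seq (SetRReg 5 (hat_var_exp (IReg 17)))
      (Seq (SetRReg 6 (RMul (RReg 0) (RReg 5)))
           (SetIReg 18 (IConst 0))))
      (While (ILt (IReg 18) (IReg 5)) prune_body))).

(** The address m n comes from repeated addition, as the machine does not multiply natural
    numbers. *)
Definition init_prog : prog :=
  Seq (Seq (SetIReg 4 (IConst 0)) (SetIReg 11 (IConst 0)))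
 (Seq (While (ILt (IReg 11) (IReg 1))
             (Seq (SetIReg 4 (IAdd (IReg 4) (IReg 0))) (incr 11)))
      (Seq (SetIMem (IReg 2) (IConst 1)) (SetIReg 5 (IConst 0)))).

Definition greedy_and_prune_prog : prog :=
  Seq init_prog
 (Seq omp_prog
 (Seq prune_prog
      (SetIMem (IReg 2) (IConst 0)))).

Section greedy_and_prune_program.
Context (R : realType) (n m : nat) (D : 'M[R]_(m, n)) (i : 'I_n) (nu : R)
  (T : nat).
Implicit Types (s : state R) (l : seq 'I_n) (S : {set 'I_n}).

Record env s : Prop := Env {
  env_n : ireg s 0 = n;
  env_m : ireg s 1 = m;
  env_i : ireg s 2 = i;
  env_T : ireg s 3 = T;
  env_mn : ireg s 4 = (m * n)%N;
  env_nu : rreg s 0 = nu }.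

Definition loaded s : Prop := forall (k : 'I_m) (j : 'I_n),
  rmem s (k * n + j)%N = D k j.

Definition listed s l : Prop := forall a, (a < size l)%N ->
  imem s (n + a)%N = nth i l a.

(* The mark of i stays on during the whole run, so that i is never a candidate
   and its column is never weighted by 0. *)
Definition marked s S : Prop := forall j : 'I_n,
  imem s j = (j \in S) || (j == i) :> nat.

Lemma env_frame c s s' : all (fun a => a \notin iwrites c) (iota 0 5) ->
  0%N \notin rwrites c -> frame c s s' -> env s -> env s'.
Proof.
move=> /= /and5P[h0 h1 h2 h3 /andP[h4 _]] r0 f [e0 e1 e2 e3 e4 e5].
by split; rewrite ?(frame_ireg f) ?(frame_rreg f).
Qed.

Lemma loaded_eq s s' : (forall x, (x < m * n)%N -> rmem s' x = rmem s x) ->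
  loaded s -> loaded s'.
Proof.
move=> h hs k j; rewrite h//; apply: (@leq_trans (k.+1 * n)%N).
  by rewrite mulSn addnC ltn_add2r.
by rewrite leq_mul2r ltn_ord orbT.
Qed.

(** Nodes of [l] outside S contribute zero vectors, hence nothing to the span: pruning keeps the
    list and changes only the marks. *)
Lemma min_rss_gram_schmidt (l : seq 'I_n) S : {subset S <= l} ->
  let r := gs_residual (@dotcol R m) (gram_schmidt (@dotcol R m)
     [seq (j \in S)%:R *: col j D | j <- l]) (col i D) in
  dotcol r r = min_rss D i S.
Proof.
move=> Sl; set vs := map _ _ => r.
pose W (u : 'cV[R]_m) := exists2 w : 'rV[R]_n, supported S w & u = D *m w^T.
have hW : linear_subspace W.
  split; first by exists 0; [exact: supported0|rewrite trmx0 mulmx0].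
  move=> a x y [u hu ->] [v hv ->]; exists (a *: u + v).
    by apply: supportedD => //; exact: supportedZ.
  by rewrite linearD linearZ/= mulmxDr -scalemxAr.
have [|[w hw wE] ho] := gs_projection (dotcol_psd R m) (vs := vs) (col i D) hW.
  move=> u /mapP[j _ ->]; have [jS|_] := boolP (j \in S); last first.
    by rewrite scale0r; case: hW.
  rewrite scale1r; exists 'e_j; first exact: supported_delta.
  by rewrite trmx_delta -colE.
have rE : r = D *m ('e_i - w)^T by rewrite -col_residual -wE subKr.
rewrite (@min_rss_projection _ _ _ D i S w hw).
  by rewrite /empirical_form -rE.
move=> j jS; rewrite /empirical_form -rE trmx_delta -colE; apply: ho.
by apply/mapP; exists j; [exact: Sl|rewrite jS scale1r].
Qed.

Lemma runs_min_rss s l S : env s -> loaded s -> listed s l ->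
  imem s (n + size l)%N = i -> marked s S -> {subset S <= l} ->
  i \notin l -> ireg s 6 = (size l).+1 ->
  runs rss_prog s (500 * ((size l).+1 ^ 2 * m.+1)) (fun s' =>
    rreg s' 1 = min_rss D i S /\ loaded s').
Proof.
move=> es ds ls li ms Sl il s6.
have colj (j : 'I_n) : \col_(k < m) rmem s (j + k * n)%N = col j D.
  by apply/colP => k; rewrite !mxE addnC ds.
apply: (runs_weaken (runs_rss (n := n) (m := m) _ _ _ _ _) _ _) => //.
- exact: env_n.
- exact: env_m.
- exact: env_mn.
- exact: s6.
- move=> c; rewrite ltnS leq_eqVlt => /predU1P[->|cl]; first by rewrite li.
  by rewrite ls.
move=> s' _ [h1 h2]; split; last exact: loaded_eq ds.
rewrite h1 -(min_rss_gram_schmidt Sl).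
have -> : selected_column n m s (size l) = col i D.
  by rewrite /selected_column li ms eqxx orbT scale1r colj.
have -> // : [seq selected_column n m s c | c <- iota 0 (size l)] =
    [seq (j \in S)%:R *: col j D | j <- l].
apply: (@eq_from_nth _ 0); first by rewrite !size_map size_iota.
move=> c; rewrite size_map size_iota => cl.
rewrite (nth_map 0%N) ?size_iota// nth_iota// add0n (nth_map i)//.
rewrite /selected_column ls// ms colj.
have /negPf -> : nth i l c != i by apply: contraNneq il => <-; exact: mem_nth.
by rewrite orbF.
Qed.

Definition selected_set l : {set 'I_n} := [set x in l]%SET.

Definition candidate l (c : 'I_n) : bool := (c \notin l) && (c != i).

Definition best_candidate s l (j : nat) : Prop :=
  (ireg s 14 = 0%N /\ forall c : 'I_n, (c < j)%N -> ~~ candidate l c) \/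
  (ireg s 14 = 1%N /\ exists c : 'I_n, [/\ ireg s 16 = c, candidate l c,
     rreg s 4 = min_rss D i (c |: selected_set l)%SET &
     forall c' : 'I_n, (c' < j)%N -> candidate l c' ->
       rreg s 4 <= min_rss D i (c' |: selected_set l)%SET]).

Definition select_inv l (j : nat) s : Prop :=
  [/\ env s, loaded s, listed s l & marked s (selected_set l)] /\
  [/\ ireg s 5 = size l, ireg s 15 = j & best_candidate s l j].

Lemma mem_selected_set l x : (x \in selected_set l) = (x \in l).
Proof. by rewrite finset.inE. Qed.

Lemma runs_candidate s l (j : nat) : (j < n)%N -> (size l < T)%N ->
  i \notin l ->
  select_inv l j s ->
  runs candidate_body s (600 * (T.+1 ^ 2 * m.+1)) (select_inv l j.+1).
Proof.
move=> jn lT il [[es ds ls ms] [s5 s15 best]].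
pose c := Ordinal jn.
have mc : (imem s j == 0%N) = candidate l c.
  rewrite (ms c) mem_selected_set /candidate.
  by case: (c \in l); case: (c == i).
have x0 : (0 < T.+1 ^ 2 * m.+1)%N by rewrite muln_gt0 expn_gt0.
apply: (runs_weaken (n := (5 + (500 * (T.+1 ^ 2 * m.+1) + 60) + 4)%N)
  (Q := select_inv l j.+1)); [|by move: x0; move: (_ * _)%N => x; lia|by []].
apply: (runs_seq (Q1 := fun s1 =>
  [/\ env s1, loaded s1, listed s1 l & marked s1 (selected_set l)] /\
  [/\ ireg s1 5 = size l, ireg s1 15 = j & best_candidate s1 l j.+1]));
    last first.
  move=> s1 f1 [[e1 d1 l1 m1] [s15' sj b1]].
  apply: (runs_weaken (runs_straight (Q := select_inv l j.+1) _ _)) => //.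
  split; first split => //.
    by apply: (env_frame (c := incr 15)) e1 => //; exact: straight_frame.
  by split => //=; rewrite sj addn1.
apply: runs_if; rewrite /= s15 mc; last first.
  case cc: (candidate l c) => // _.
  apply: (runs_weaken (runs_straight (c := Skip) (Q := fun s1 => s1 = s) _ _))
    => //.
  move=> _ _ ->; split; split => //.
  case: best => [[h1 h2]|[h1 [b [h2 h3 h4 h5]]]].
    left; split => // c'; rewrite ltnS leq_eqVlt => /predU1P[c'j|/h2//].
    by rewrite (_ : c' = c) ?cc//; exact: val_inj.
  right; split => //; exists b; split => // c'.
  rewrite ltnS leq_eqVlt => /predU1P[c'j|/h5//].
  by rewrite (_ : c' = c) ?cc//; exact: val_inj.
case cc: (candidate l c) => // _.
have [cl ci] := andP cc.
have SE : selected_set (rcons l c) = (c |: selected_set l)%SET.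
  by apply/setP => x; rewrite !finset.inE mem_rcons in_cons.
apply: (runs_weaken (n := (straight_cost push_candidate +
   (500 * (T.+1 ^ 2 * m.+1) + 30))%N) (Q := fun s1 =>
  [/\ env s1, loaded s1, listed s1 l & marked s1 (selected_set l)] /\
  [/\ ireg s1 5 = size l, ireg s1 15 = j & best_candidate s1 l j.+1]));
  [|by rewrite /=; move: (_ * _)%N => x; lia|by []].
apply: runs_straight_seq => //.
set s1 := run_straight push_candidate s.
have f1 : frame push_candidate s s1 by exact: straight_frame.
have e1 : env s1 by apply: (env_frame _ _ f1) es.
have sn := env_n es.
have im1 x : imem s1 x = if x == j then 1%N else
    if x == (n + size l + 1)%N then i : nat else
    if x == (n + size l)%N then j else imem s x.
  by rewrite /s1 /= s15 s5 sn (env_i es).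
have ls1 : listed s1 (rcons l c).
  move=> a; rewrite size_rcons ltnS => al; rewrite im1 nth_rcons.
  rewrite ifF; last by lia.
  rewrite ifF; last by lia.
  move: al; rewrite leq_eqVlt => /predU1P[->|al]; first by rewrite !eqxx ltnn.
  by rewrite al ifF ?ls//; lia.
have ms1 : marked s1 (selected_set (rcons l c)).
  move=> x; rewrite im1 SE !finset.inE.
  have [xj|xj] := eqVneq (x : nat) j.
    by rewrite (_ : x = c) ?eqxx//; exact: val_inj.
  have xn := ltn_ord x.
  rewrite ifF; last by lia.
  rewrite ifF; last by lia.
  by rewrite (ms x) mem_selected_set;
    have -> : (x == c) = false by exact/eqP/eqP.
apply: (runs_seq (n1 := (500 * (T.+1 ^ 2 * m.+1))%N) (n2 := 30%N)).
  apply: (runs_weaken (runs_min_rss (l := rcons l c) e1 _ ls1 _ ms1 _ _ _)).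
  - by [].
  - by rewrite size_rcons im1 ifF ?ifT//; lia.
  - by move=> x; rewrite mem_selected_set.
  - by rewrite mem_rcons in_cons negb_or eq_sym ci.
  - by rewrite /s1 /= s5 size_rcons addn2.
  - by rewrite size_rcons leq_mul2l leq_mul2r leq_exp2r ?ltnS ?lT ?orbT.
  - by move=> s' _ h; exact: h.
move=> s2 f2 [h1 d2].
have e2 : env s2 by apply: (env_frame _ _ f2) e1.
have im2 : imem s2 = imem s1 by rewrite (frame_imem f2).
have s2r a : a \notin iwrites rss_prog ++ iwrites push_candidate ->
  ireg s2 a = ireg s a.
  by rewrite mem_cat negb_or => /andP[h h'];
    rewrite (frame_ireg f2)// (frame_ireg f1).
have s2r4 : rreg s2 4 = rreg s 4 by rewrite (frame_rreg f2).
apply: (runs_weaken (runs_straight (c := compare_candidate) (Q := fun s3 =>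
  [/\ env s3, loaded s3, listed s3 l & marked s3 (selected_set l)] /\
  [/\ ireg s3 5 = size l, ireg s3 15 = j & best_candidate s3 l j.+1]) _ _)) =>
    //.
set s3 := run_straight _ _.
have r15 : ireg s2 15 = j by rewrite s2r.
have r14 : ireg s2 14 = ireg s 14 by rewrite s2r.
pose s2' := run_straight (SetIMem (IReg 15) (IConst 0)) s2.
have f3 : frame compare_candidate s2 s3 by exact: straight_frame.
have im3 x : imem s3 x = if x == j then 0%N else imem s1 x.
  by rewrite /s3 /=; case: ifP => _ /=; [|case: ifP => _ /=]; rewrite r15 im2.
split; split.
- exact: (env_frame _ _ f3) e2.
- by apply: loaded_eq d2 => x _; rewrite (frame_rmem f3).
- move=> a al; rewrite im3 ifF; last by lia.
  by rewrite ls1 ?size_rcons ?nth_rcons ?al// ltnW.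
- move=> x; rewrite im3; have [xj|xj] := eqVneq (x : nat) j.
    rewrite (_ : x = c); last exact: val_inj.
    by rewrite mem_selected_set (negPf cl) (negPf ci).
  rewrite (ms1 x) SE !finset.inE.
  by have -> : (x == c) = false by exact/eqP/eqP.
- by rewrite (frame_ireg f3)// s2r.
- by rewrite (frame_ireg f3)// s2r.
rewrite SE in h1.
have hj c' (b : R) : (c' : 'I_n) = j :> nat -> b <= rreg s2 1 ->
    b <= min_rss D i (c' |: selected_set l)%SET.
  by move=> c'j; rewrite h1 (_ : c' = c)//; exact: val_inj.
have new : ireg s3 14 = 1%N -> ireg s3 16 = j -> rreg s3 4 = rreg s2 1 ->
    (forall c' : 'I_n, (c' < j)%N -> candidate l c' ->
       rreg s2 1 <= min_rss D i (c' |: selected_set l)%SET) ->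
    best_candidate s3 l j.+1.
  move=> g1 g2 g3 g4; right; split => //; exists c; split => //.
    by rewrite g3 h1.
  move=> c'; rewrite g3 ltnS leq_eqVlt => /predU1P[c'j _|/g4//].
  exact: hj.
case: best => [[b1 b2]|[b1 [b [b2 b3 b4 b5]]]].
  have s3E : s3 = run_straight record_best s2' by rewrite /s3 /= r14 b1.
  apply: new; rewrite ?s3E//=.
  by move=> c' /b2 /negPf ->.
have [lt|le] := ltP (rreg s2 1) (rreg s2 4).
  have s3E : s3 = run_straight record_best s2' by rewrite /s3 /= r14 b1 lt.
  apply: new; rewrite ?s3E//=.
  move=> c' cj' ccc; apply: (le_trans (ltW lt)); rewrite s2r4.
  exact: b5.
have s3E : s3 = s2' by rewrite /s3 /= r14 b1 /= ltNge le.
right; rewrite s3E; split; first by rewrite /= r14.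
exists b; rewrite /= s2r// s2r4; split => // c'.
rewrite ltnS leq_eqVlt => /predU1P[c'j _|/b5//].
by apply: hj => //; rewrite -s2r4.
Qed.

Let n0 : (0 < n)%N. Proof. exact: leq_ltn_trans (ltn_ord i). Qed.

Let X := (T.+1 ^ 2 * m.+1)%N.

Let X_gt0 : (0 < X)%N. Proof. by rewrite muln_gt0 expn_gt0. Qed.

Lemma runs_select s l : (size l < T)%N -> i \notin l ->
  env s -> loaded s -> listed s l -> marked s (selected_set l) ->
  ireg s 5 = size l ->
  runs select_prog s (700 * (n * X)) (select_inv l n).
Proof.
move=> lT il es ds ls ms s5.
apply: (runs_weaken (n := (4 + (n * (3 + 600 * X) + 3))%N)
  (Q := select_inv l n)).
- apply: runs_straight_seq => //.
  apply: (runs_while (N := n) (Inv := select_inv l)).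
  + by split; split=> //=; [case: es|left].
  + move=> j s1 jn f h; split; last exact: runs_candidate.
    case: h => [[e1 _ _ _] [_ h15 _]].
    by rewrite /= h15 (env_n e1).
  + move=> s1 f [[e1 _ _ _] [_ h15 _]].
    by rewrite /= h15 (env_n e1) ltnn.
- have := X_gt0; have := n0; move: X => x n0' x0; nia.
- by [].
Qed.

Definition omp_inv (t : nat) s : Prop := exists l,
  [/\ uniq l, i \notin l, (size l <= t)%N & omp D i t (selected_set l)] /\
  [/\ env s, loaded s, listed s l & marked s (selected_set l)] /\
  [/\ ireg s 5 = size l & ireg s 13 = t].

Lemma runs_omp_body s t : (t < T)%N -> omp_inv t s ->
  runs (Seq select_prog commit_candidate) s (800 * (n * X)) (omp_inv t.+1).
Proof.
move=> tT [l [[ul il lt hl] [[es ds ls ms] [s5 s13]]]].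
apply: (runs_weaken (n := (700 * (n * X) + 30)%N) (Q := omp_inv t.+1));
  last by [].
  apply: runs_seq;
    first exact: runs_select (leq_ltn_trans lt tT) il es ds ls ms s5.
  move=> s1 f1 [[e1 d1 l1 m1] [h5 h15 best]].
  have h13 : ireg s1 13 = t by rewrite (frame_ireg f1).
  apply: (runs_weaken (runs_straight (Q := omp_inv t.+1) _ _)) => //.
  set s2 := run_straight _ _.
  have f2 : frame commit_candidate s1 s2 by exact: straight_frame.
  have e2 : env s2 by apply: (env_frame _ _ f2) e1.
  have d2 : loaded s2 by apply: loaded_eq d1 => x _; rewrite (frame_rmem f2).
  case: best => [[b1 b2]|[b1 [c [b2 cc b3 b4]]]].
    have s2E : s2 = run_straight (incr 13) s1 by rewrite /s2 /= b1.
    exists l; split; last first.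
      rewrite s2E /= in e2 d2 *; split; split => //=.
      by rewrite h13 addn1.
    split => //; first exact: leqW.
    apply: omp_stop => //; apply/setP => x; rewrite !finset.inE.
    have := b2 x (ltn_ord x); rewrite /candidate negb_and negbK.
    by have [->|xi] := eqVneq x i; [rewrite (negPf il)|rewrite orbF].
  have [cl ci] := andP cc.
  have SE : selected_set (rcons l c) = (c |: selected_set l)%SET.
    by apply/setP => x; rewrite !finset.inE mem_rcons in_cons.
  have im2 x : imem s2 x = if x == c :> nat then 1%N else
      if x == (n + size l)%N then c : nat else imem s1 x.
    by rewrite /s2 /= b1 /= b2 h5 (env_n e1).
  exists (rcons l c); split; last (split; split => //).
  - split.
    + by rewrite rcons_uniq cl.
    + by rewrite mem_rcons in_cons negb_or eq_sym ci.
    + by rewrite size_rcons.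
    + rewrite SE; apply: omp_select => //.
        apply: contraNneq cl => h; rewrite -mem_selected_set h.
        by rewrite !finset.inE.
      (* [omp_select] also compares with nodes already in [l]: adding one leaves the set unchanged,
         and a larger set has a smaller residual. *)
      move=> j ji; rewrite -b3.
      have [jl|jl] := boolP (j \in l); last first.
        by apply: b4; rewrite ?ltn_ord// /candidate jl.
      rewrite b3 (_ : (j |: selected_set l)%SET = selected_set l).
        by apply: min_rss_anti; exact: finset.subsetUr.
      by apply/setP => x; rewrite !finset.inE; case: eqP => [->|].
  - move=> a; rewrite size_rcons ltnS => al; rewrite im2 nth_rcons.
    have cn := ltn_ord c.
    rewrite ifF; last by lia.
    move: al; rewrite leq_eqVlt => /predU1P[->|al]; first by rewrite !eqxx ltnn.
    by rewrite al ifF ?l1//; lia.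
  - move=> x; rewrite im2 SE !finset.inE.
    have [xj|xj] := eqVneq (x : nat) c.
      by rewrite (_ : x = c) ?eqxx//; exact: val_inj.
    have xn := ltn_ord x.
    rewrite ifF; last by lia.
    by rewrite (m1 x) mem_selected_set;
      have -> : (x == c) = false by exact/eqP/eqP.
  - by rewrite /s2 /= b1 /= h5 size_rcons addn1.
  - by rewrite /s2 /= b1 /= h13 addn1.
have := X_gt0; have := n0; move: X => x n0' x0; nia.
Qed.

Lemma runs_omp s : env s -> loaded s -> marked s finset.set0 ->
  ireg s 5 = 0%N ->
  runs omp_prog s (900 * (T * (n * X)) + 10) (omp_inv T).
Proof.
move=> es ds ms s5.
apply: (runs_weaken (n := (2 + (T * (3 + 800 * (n * X)) + 3))%N)
  (Q := omp_inv T)).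
- apply: runs_straight_seq => //.
  apply: (runs_while (N := T) (Inv := omp_inv)).
  + have S0 : selected_set [::] = finset.set0 :> {set 'I_n}.
      by apply/setP => x; rewrite !finset.inE.
    exists [::]; rewrite S0; split; first by split => //; exact: omp_init.
    by split; split => //=; case: es.
  + move=> t s1 tT f h; split; last exact: runs_omp_body.
    case: h => [l [_ [[e1 _ _ _] [_ h13]]]].
    by rewrite /= h13 (env_T e1).
  + move=> s1 f [l [_ [[e1 _ _ _] [_ h13]]]].
    by rewrite /= h13 (env_T e1) ltnn.
- have y0 : (0 < n * X)%N by rewrite muln_gt0 n0 X_gt0.
  move: (n * X)%N y0 => y y0; rewrite mulnDr (mulnCA T 800).
  by have := leq_pmulr T y0; move: (T * y)%N => ty; lia.
- by [].
Qed.

(** * The pruning loop *)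

Section prune.
Variable l : seq 'I_n.
Hypothesis ul : uniq l.
Hypothesis il : i \notin l.
Hypothesis lT : (size l <= T)%N.

Let thr : R := nu / hat_Theta D i (selected_set l).

Let pruned (p : nat) : {set 'I_n} :=
  foldl (prune_step D i thr) (selected_set l) (take p l).

(** By the last inclusion the node about to be tested is still present, so that removing it lowers
    the cardinal by exactly one. *)
Definition prune_inv (p : nat) s : Prop :=
  [/\ env s, loaded s, listed s l, imem s (n + size l)%N = i &
     marked s (pruned p)] /\
  [/\ ireg s 5 = size l, ireg s 6 = (size l).+1, ireg s 17 = #|pruned p| &
     ireg s 18 = p] /\
  [/\ rreg s 5 = hat_var D i (pruned p), rreg s 6 = thr,
     {subset pruned p <= l} & {subset drop p l <= pruned p}].

Lemma runs_prune_body s p : (p < size l)%N -> prune_inv p s ->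
  runs prune_body s (600 * X) (prune_inv p.+1).
Proof.
move=> pl [[es ds ls li ms] [[s5 s6 s17 s18] [r5 r6 Pl dP]]].
set j := nth i l p.
have jl : j \in l by exact: mem_nth.
have ji : j != i by apply: contraNneq il => <-.
have jd : j \in drop p l by rewrite (drop_nth i pl) mem_head.
have jP : j \in pruned p by exact: dP.
have jaddr : imem s (n + p)%N = j by rewrite ls.
have Pp1 : pruned p.+1 = prune_step D i thr (pruned p) j.
  by rewrite /pruned (take_nth i pl) foldl_rcons.
have jn := ltn_ord j.
have X0 : (0 < X)%N by rewrite muln_gt0 expn_gt0.
apply: (runs_weaken
  (n := (straight_cost (SetIMem (IMem (IAdd (IReg 0) (IReg 18))) (IConst 0))
   + (500 * X + 50))%N) (Q := prune_inv p.+1));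
  [|by rewrite /=; move: X X0 => x; lia|by []].
apply: runs_straight_seq => //.
set s1 := run_straight _ _.
have f1 : frame prune_body s s1.
  by apply: (frame_sub _ _ _ _ (straight_frame s
    (c := SetIMem (IMem (IAdd (IReg 0) (IReg 18))) (IConst 0)) isT)).
have e1 : env s1 by case: es.
have im1 x : imem s1 x = if x == j :> nat then 0%N else imem s x.
  by rewrite /s1 /= (env_n es) s18 jaddr.
have l1 : listed s1 l.
  by move=> a al; rewrite im1 ifF ?ls//; lia.
have m1 : marked s1 (pruned p :\ j)%SET.
  move=> x; rewrite im1 !finset.inE.
  have [xj|xj] := eqVneq (x : nat) j.
    by rewrite (_ : x = j) ?eqxx ?(negPf ji)//; exact: val_inj.
  by rewrite ms; have -> : (x == j) = false by exact/eqP/eqP.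
apply: (runs_seq (n1 := (500 * X)%N) (n2 := 50%N)).
  apply: (runs_weaken (runs_min_rss (l := l) e1 _ l1 _ m1 _ il _)).
  - by [].
  - by rewrite im1 ifF ?li//; lia.
  - by move=> x; rewrite !finset.inE => /andP[_ /Pl].
  - by [].
  - by rewrite leq_mul2l leq_mul2r leq_exp2r ?ltnS ?lT ?orbT.
  - by move=> s' _ h; exact: h.
move=> s2 f2 [h1 d2].
have e2 : env s2 by apply: (env_frame _ _ f2) e1.
have im2 : imem s2 = imem s1 by rewrite (frame_imem f2).
apply: (runs_weaken (runs_straight (Q := prune_inv p.+1) _ _)) => //.
set s3 := run_straight _ _.
have cardE : #|pruned p| = (#|(pruned p :\ j)%SET|).+1.
  by rewrite (cardsD1 j (pruned p)) jP.
have r17 : ireg s2 17 = #|pruned p| by rewrite (frame_ireg f2).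
have r18 : ireg s2 18 = p by rewrite (frame_ireg f2).
have q5 : rreg s2 5 = hat_var D i (pruned p) by rewrite (frame_rreg f2).
have q6 : rreg s2 6 = thr by rewrite (frame_rreg f2).
have hv : rreg s2 1 / ((ireg s2 1)%:R - (ireg s2 17 - 1)%N%:R) =
    hat_var D i (pruned p :\ j)%SET.
  by rewrite h1 (env_m e2) r17 cardE subn1/= /hat_var mulrC.
have dP' : {subset drop p.+1 l <= pruned p.+1}.
  move=> x xd; have xl : x \in drop p l
    by rewrite (drop_nth i pl) in_cons xd orbT.
  have xj : x != j.
    have := ul; rewrite -(cat_take_drop p l) cat_uniq (drop_nth i pl) /= =>
      /and3P[_ _].
    by case/andP => jn' _; apply/eqP => xj; move: jn'; rewrite -/j -xj xd.
  rewrite Pp1 /prune_step; case: ifP => _; last exact: dP.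
  by rewrite !finset.inE xj dP.
have Pl' : {subset pruned p.+1 <= l}.
  move=> x; rewrite Pp1 /prune_step; case: ifP => _; last exact: Pl.
  by rewrite !finset.inE => /andP[_ /Pl].
set s2a := run_straight (SetRReg 7 (hat_var_exp (ISub (IReg 17) (IConst 1))))
  s2.
have cond : (reval s2a (RSub (RReg 7) (RReg 5)) < reval s2a (RReg 6)) =
   (hat_var D i (pruned p :\ j)%SET - hat_var D i (pruned p) < thr).
  by rewrite /s2a /= hv q5 q6.
have r5' : ireg s2 5 = size l by rewrite (frame_ireg f2).
have r6' : ireg s2 6 = (size l).+1 by rewrite (frame_ireg f2).
have jaddr2 : imem s2 (n + p)%N = j by rewrite im2 im1 ifF//; lia.
have [lt|le] := boolP
  (hat_var D i (pruned p :\ j)%SET - hat_var D i (pruned p) < thr).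
  have PE : pruned p.+1 = (pruned p :\ j)%SET by rewrite Pp1 /prune_step lt.
  have s3E : s3 = run_straight (incr 18) (run_straight
      (Seq (SetIReg 17 (ISub (IReg 17) (IConst 1))) (SetRReg 5 (RReg 7))) s2a).
    by move: cond; rewrite lt /s3 /s2a /= => ->.
  split; last split.
  - rewrite s3E; split => //=.
    + by case: e2.
    + by rewrite im2.
    + by rewrite im2 im1 ifF ?li//; lia.
    + by rewrite im2 PE.
  - by rewrite s3E; split => //=; rewrite ?r17 ?r18 ?PE ?cardE ?subn1 ?addn1.
  - by split => //; rewrite s3E /= ?hv ?PE.
have PE : pruned p.+1 = pruned p by rewrite Pp1 /prune_step (negPf le).
have s3E : s3 = run_straight (incr 18) (run_straight
    (SetIMem (IMem (IAdd (IReg 0) (IReg 18))) (IConst 1)) s2a).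
  by move: cond; rewrite (negPf le) /s3 /s2a /= => ->.
have im3 x : imem s3 x = if x == j :> nat then 1%N else imem s1 x.
  by rewrite s3E /= (env_n e2) r18 jaddr2 im2.
split; last split.
- split => //.
  + by rewrite s3E; case: e2.
  + by rewrite s3E.
  + by move=> a al; rewrite im3 ifF ?l1//; lia.
  + by rewrite im3 ifF ?im1 ?ifF ?li//; lia.
  + move=> x; rewrite im3 PE; have [xj|xj] := eqVneq (x : nat) j.
      by rewrite (_ : x = j) ?jP//; exact: val_inj.
    by rewrite im1 (negPf xj) ms.
- by rewrite s3E; split => //=; rewrite ?r17 ?r18 ?PE ?addn1.
- by split => //; rewrite s3E /= ?q5 ?q6 ?PE.
Qed.

Lemma runs_prune s : env s -> loaded s -> listed s l ->
  marked s (selected_set l) -> ireg s 5 = size l ->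
  runs prune_prog s (1300 * (T.+1 * X)) (prune_inv (size l)).
Proof.
move=> es ds ls ms s5.
have X0 : (0 < X)%N by rewrite muln_gt0 expn_gt0.
have cardl : #|selected_set l| = size l.
  by rewrite /selected_set cardsE; exact/card_uniqP.
pose c0 := Seq (SetIMem (IAdd (IReg 0) (IReg 5)) (IReg 2))
      (Seq (SetIReg 6 (IAdd (IReg 5) (IConst 1)))
           (SetIReg 17 (IReg 5))).
pose c1 := Seq (SetRReg 5 (hat_var_exp (IReg 17)))
      (Seq (SetRReg 6 (RMul (RReg 0) (RReg 5)))
           (SetIReg 18 (IConst 0))).
apply: (runs_weaken (n := (straight_cost c0 + (500 * X +
   (straight_cost c1 + (size l * (3 + 600 * X) + 3))))%N)
   (Q := prune_inv (size l))); last by [].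
  apply: runs_straight_seq => //.
  set s1 := run_straight _ _.
  have f1 : frame c0 s s1 by exact: straight_frame.
  have e1 : env s1 by case: es.
  have im1 x : imem s1 x = if x == (n + size l)%N then i : nat else imem s x.
    by rewrite /s1 /= (env_n es) s5 (env_i es).
  have l1 : listed s1 l by move=> a al; rewrite im1 ifF ?ls//; lia.
  have m1 : marked s1 (selected_set l).
    by move=> x; have xn := ltn_ord x; rewrite im1 ifF ?ms//; lia.
  have li1 : imem s1 (n + size l)%N = i by rewrite im1 eqxx.
  apply: (runs_seq (n1 := (500 * X)%N)).
    apply: (runs_weaken (runs_min_rss (l := l) e1 _ l1 li1 m1 _ il _)).
    - by [].
    - by move=> x; rewrite mem_selected_set.
    - by rewrite /s1 /= s5 addn1.
    - by rewrite leq_mul2l leq_mul2r leq_exp2r ?ltnS ?lT ?orbT.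
    - by move=> s' _ h; exact: h.
  move=> s2 f2 [h1 d2].
  have e2 : env s2 by apply: (env_frame _ _ f2) e1.
  have im2 : imem s2 = imem s1 by rewrite (frame_imem f2).
  have r17 : ireg s2 17 = size l by rewrite (frame_ireg f2).
  have r5 : ireg s2 5 = size l by rewrite (frame_ireg f2).
  have r6 : ireg s2 6 = (size l).+1 by rewrite (frame_ireg f2)//= s5 addn1.
  apply: runs_straight_seq => //.
  set s3 := run_straight _ _.
  have hv : rreg s3 5 = hat_var D i (selected_set l).
    by rewrite /s3 /= h1 (env_m e2) r17 /hat_var cardl mulrC.
  have e3 : env s3 by case: e2.
  have r36 : rreg s3 6 = nu * rreg s3 5 by rewrite /s3 /= (env_nu e2).
  apply: (runs_while (N := size l) (Inv := prune_inv) (t := (600 * X)%N)).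
  + have P0 : pruned 0 = selected_set l by rewrite /pruned take0.
    split; last split.
    * split => //; rewrite /s3 /= ?im2//.
      by move=> x; rewrite /= P0; exact: m1.
    * by split => //=; rewrite P0 cardl.
    * split; rewrite ?P0//.
      - by rewrite r36 hv /thr /hat_Theta invrK.
      - by move=> x; rewrite mem_selected_set.
      - by rewrite drop0 => x; rewrite mem_selected_set.
  + move=> p s4 pl f h; split; last exact: runs_prune_body.
    case: h => [[e4 _ _ _ _] [[h5 _ _ h18] _]].
    by rewrite /= h18 h5.
  + move=> s4 f [[e4 _ _ _ _] [[h5 _ _ h18] _]].
    by rewrite /= h18 h5 ltnn.
rewrite /=; have lX : (size l * X <= T * X)%N by rewrite leq_mul2r lT orbT.
have lX' : (size l <= size l * X)%N by rewrite leq_pmulr.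
rewrite mulnDr (mulnCA _ 600) mulSn.
move: lX lX' X0; move: (size l * X)%N (T * X)%N (size l) X => *; lia.
Qed.

End prune.

(** T steps, n candidates per step and O(T^2 m) operations per residual give the main term; the term
    in m is the computation of m n. *)
Lemma runs_greedy_and_prune_prog (K : R) : T = num_steps K ->
  runs greedy_and_prune_prog (input_state D i nu T)
    (m * 12 + 4000 * (n * (T.+1 ^ 3 * m.+1)))
    (fun s' => greedy_and_prune D i nu K (output_set s')).
Proof.
move=> TK; have X0 : (0 < X)%N by rewrite muln_gt0 expn_gt0.
set s0 := input_state D i nu T.
pose init_inv (k : nat) s := [/\ ireg s 4 = (k * n)%N, ireg s 11 = k,
   imem s = imem s0 & rmem s = rmem s0].
apply: (runs_weaken (n := (4 + (m * 11 + 3 + 5) + ((900 * (T * (n * X)) + 10) +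
    (1300 * (T.+1 * X) + 4)))%N)
   (Q := fun s' => greedy_and_prune D i nu K (output_set s'))); last by [].
  apply: (runs_seq (Q1 := fun s => [/\ env s, loaded s,
      marked s finset.set0 & ireg s 5 = 0%N])).
    apply: runs_straight_seq => //.
    apply: (runs_seq (Q1 := init_inv m)).
      apply: (runs_while (N := m) (Inv := init_inv) (t := 8%N)).
      + by split => //=.
      + move=> k s1 km f [h1 h2 h3 h4]; split.
          by rewrite /= h2 (frame_ireg f).
        apply: (runs_weaken (runs_straight (Q := init_inv k.+1) _ _)) => //.
        split => //=; rewrite ?h1 ?h2 ?addn1//.
        by rewrite (frame_ireg f)//= mulSn addnC.
      + by move=> s1 f [_ h2 _ _]; rewrite /= h2 (frame_ireg f)//= ltnn.
    move=> s1 f1 [h1 _ h3 h4].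
    apply: (runs_weaken (runs_straight (Q := fun s => [/\ env s, loaded s,
      marked s finset.set0 & ireg s 5 = 0%N]) _ _)) => //.
    split => //=.
    - by split => //=; rewrite ?(frame_ireg f1) ?(frame_rreg f1)//= h1.
    - move=> k j;
        rewrite /= h4 /= divnMDl ?n0// modnMDl divn_small// addn0 modn_small//.
      by rewrite !valK.
    - move=> x; rewrite /= h3 (frame_ireg f1)//= finset.inE.
      by rewrite (inj_eq val_inj); case: (x == i).
  move=> s1 f1 [e1 d1 m1 r1].
  apply: runs_seq; first exact: (runs_omp e1 d1 m1 r1).
  move=> s2 f2 [l [[ul il lT ho] [[e2 d2 l2 m2] [r2 _]]]].
  apply: runs_seq; first exact: (runs_prune ul il lT e2 d2 l2 m2 r2).
  move=> s3 f3 [[e3 _ _ _ m3] [_ [_ _ Pl _]]].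
  apply: (runs_weaken (runs_straight (Q := fun s' =>
    greedy_and_prune D i nu K (output_set s')) _ _)) => //.
  exists (selected_set l), l; split => //.
  - by rewrite -TK.
  - by move=> x; rewrite mem_selected_set.
  apply/setP => x; rewrite finset.inE /= (env_i e3) (inj_eq val_inj).
  rewrite take_size in m3 Pl *.
  have [->|xi] := eqVneq x i; last by rewrite m3 (negPf xi) orbF;
    case: (x \in _).
  by apply/esym/negbTE; apply: contra il; exact: Pl.
have XE : (T.+1 ^ 3 * m.+1 = T.+1 * X)%N by rewrite expnS -mulnA.
rewrite XE; have h1 : (T * (n * X) <= n * (T.+1 * X))%N.
  by rewrite mulnCA leq_mul// leq_mul.
have h2 : (T.+1 * X <= n * (T.+1 * X))%N by apply: leq_pmull; exact: n0.
have h3 : (0 < T.+1 * X)%N by rewrite muln_gt0 X0.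
move: h1 h2 h3; move: (n * (T.+1 * X))%N (T * (n * X))%N (T.+1 * X)%N => *; lia.
Qed.

End greedy_and_prune_program.

(** * The theorem *)

Lemma greedy_and_prune_sound (R : realType) (n m d : nat) (Sigma : 'M[R]_n)
    (kappa K : R) (D : 'M[R]_(m, n)) (i : 'I_n) :
  is_covariance Sigma -> Sigma \in unitmx -> 0 < kappa <= 1 ->
  nondegenerate kappa (invmx Sigma) -> attractive (invmx Sigma) ->
  (0 < m)%N ->
  (forall (S : {set 'I_n}) a b v z, i \notin S -> (#|S| <= num_steps K)%N ->
     supported S v -> z = a *: 'e_i + b *: noise Sigma i + v ->
     `|empirical_form D z z - m%:R * population_form Sigma z z| <=
     kappa / 100 * (m%:R * population_form Sigma z z)) ->
  (#|neighbors (invmx Sigma) i| <= d)%N ->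
  64 * d%:R * ln (4 / kappa ^+ 2) + 1 <= (num_steps K)%:R :> R ->
  (forall S : {set 'I_n}, i \notin S -> (#|S| <= num_steps K)%N ->
     10 * #|S|%:R <= m%:R :> R) ->
  20 <= kappa ^+ 2 * m%:R ->
  forall S, greedy_and_prune D i (kappa ^+ 2 / Num.sqrt 32) K S ->
  S = neighbors (invmx Sigma) i.
Proof.
move=> cov uS k01 nondeg attr m0 rip Nd hK size_le m_large S.
move=> [S0 [l [hS0 ul lS0 ->]]].
have [iS0 S0T] := omp_card hS0.
have NS0 := omp_neighbors cov uS k01 nondeg attr m0 rip Nd hK hS0.
have := @prune_correct _ _ _ _ _ _ _ _ cov uS k01 nondeg m0 rip size_le
  m_large S0 S0 l.
apply => //.
- by move=> x; rewrite lS0.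
- by move=> x; rewrite lS0.
Qed.

Lemma running_time_le (R : realType) (n m : nat) (K : R) : (0 < n)%N ->
  (0 < m)%N -> 1 <= K ->
  (n * (m * 12 + 4000 * (n * ((num_steps K).+1 ^ 3 * m.+1))))%N%:R <=
  600 * 600 * (K ^+ 3 * m%:R * n%:R ^+ 2).
Proof.
move=> n0 m0 K1.
have TK : (num_steps K).+1%:R <= 3 * K :> R.
  by have := num_steps_le K1; rewrite -natr1; lra.
have n1 : 1 <= n%:R :> R by rewrite ler1n.
have m1 : 1 <= m%:R :> R by rewrite ler1n.
have T3 : (num_steps K).+1%:R ^+ 3 <= 27 * K ^+ 3 :> R.
  rewrite (_ : 27 * K ^+ 3 = (3 * K) ^+ 3); last by ring.
  by apply: lerXn2r; rewrite ?nnegrE// mulr_ge0//; lra.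
have K3 : 1 <= K ^+ 3 by rewrite exprn_ege1.
have mS : m.+1%:R <= 2 * m%:R :> R by rewrite -natr1; lra.
have nK : 1 <= n%:R * K ^+ 3 by exact: mulr_ege1.
have mnK : m%:R <= m%:R * (n%:R * K ^+ 3) by rewrite ler_peMr.
have cost : n%:R * ((num_steps K).+1%:R ^+ 3 * m.+1%:R) <=
    n%:R * (27 * K ^+ 3 * (2 * m%:R)) :> R.
  by rewrite ler_wpM2l// ler_pM// exprn_ge0.
have E : (m * 12 + 4000 * (n * ((num_steps K).+1 ^ 3 * m.+1)))%N%:R =
    12 * m%:R + 4000 * (n%:R * ((num_steps K).+1%:R ^+ 3 * m.+1%:R)) :> R.
  rewrite natrD (natrM _ m) (natrM _ 4000) (natrM _ n) (natrM _ (_ ^ 3)) natrX.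
  by rewrite [12 * _]mulrC.
have -> : 600 * 600 * (K ^+ 3 * m%:R * n%:R ^+ 2) =
    n%:R * (600 * 600 * (m%:R * (n%:R * K ^+ 3))) by ring.
rewrite (natrM _ n) E; apply: ler_wpM2l => //.
have {}cost : n%:R * ((num_steps K).+1%:R ^+ 3 * m.+1%:R) <=
    54 * (m%:R * (n%:R * K ^+ 3)) :> R.
  by apply: (le_trans cost); rewrite le_eqVlt; apply/orP; left; apply/eqP; ring.
move: mnK cost; move: (m%:R * (n%:R * _)) (n%:R * (_ * _)) => x y *; lra.
Qed.

Theorem theorem7 (R : realType) :
  exists C : R, 0 < C /\
  exists (c : prog) (B : R), 0 < B /\
  forall (n m d : nat) (Sigma : 'M[R]_n) (kappa delta : R)
         (dO : measure_display) (Omega : measurableType dO)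
         (P : probability Omega R)
         (X : 'I_m -> {RV P >-> n.-tuple (measurableTypeR R)}),
  let Theta := invmx Sigma in
  let nu := kappa ^+ 2 / Num.sqrt 32 in
  let K := 64 * d%:R * ln (4 / kappa ^+ 2) + 1 in
  (0 < n)%N ->
  is_covariance Sigma -> Sigma \in unitmx ->
  0 < kappa <= 1 ->
  nondegenerate kappa Theta ->
  attractive Theta ->
  max_degree Theta = d ->
  0 < delta < 1 ->
  iid_gaussian_samples Sigma X ->
  C / kappa ^+ 2 * (K * ln n%:R + ln (4 / delta)) <= m%:R ->
  (exists E : set Omega,
     [/\ measurable E,
         ((1 - delta)%:E <= P E)%E &
         forall omega, E omega ->
         forall (i : 'I_n) (S : {set 'I_n}),
           greedy_and_prune (data_matrix X omega) i nu K S <->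
           S = neighbors Theta i]) /\
  (forall D : 'M[R]_(m, n),
     exists2 t : nat,
       runs_greedy_and_prune c D nu K t &
       t%:R <= B * (K ^+ 3 * m%:R * n%:R ^+ 2)).
Proof.
exists (200 * 300 ^+ 2); split; first by rewrite mulr_gt0 ?exprn_gt0 ?ltr0n.
exists greedy_and_prune_prog, (600 * 600); split;
  first by rewrite mulr_gt0 ?ltr0n.
move=> n m d Sigma kappa delta dO Omega P X Theta nu K.
move=> n0 cov uS k01 nondeg attr degree delta01 iidX m_ge.
have /andP[k0 k1] := k01.
have L0 : 0 <= ln (4 / kappa ^+ 2).
  apply: ln_ge0; rewrite ler_pdivlMr ?exprn_gt0// mul1r.
  by apply: le_trans (kappa2_le1 k01) _; rewrite ler1n.
have K1 : 1 <= K by rewrite /K lerDr !mulr_ge0.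
have m0 : (0 < m)%N := sample_size_gt0 n0 k01 K1 delta01 m_ge.
have time_le (D : 'M[R]_(m, n)) i := runs_greedy_and_prune_prog D i nu
  (erefl (num_steps K)).
split; last first.
  move=> D; have /choice[final hfinal] := time_le D.
  have /choice[time htime] := hfinal.
  exists (\sum_(i < n) time i)%N.
    by exists final, time; split => // i; case: (htime i).
  apply: le_trans (running_time_le n0 m0 K1); rewrite ler_nat.
  rewrite -[X in (_ <= X * _)%N](card_ord n) -sum_nat_const.
  by apply: leq_sum => i _; case: (htime i).
have [E [mE PE hE]] := good_event n0 cov uS k01 K1 delta01 iidX m_ge.
exists E; split => // omega Eo i S.
have sound : forall S', greedy_and_prune (data_matrix X omega) i nu K S' ->
    S' = neighbors Theta i.
  apply: (greedy_and_prune_sound (d := d) cov uS k01 nondeg attr m0) => //.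
  - exact: hE.
  - by rewrite -degree; exact: (leq_bigmax i).
  - exact: num_steps_ge.
  - by move=> S' iS' S'T;
      exact: (selected_le_sample n0 k01 K1 delta01 m_ge iS' S'T).
  - exact: (sample_size_large n0 k01 K1 delta01 m_ge).
split; first exact: sound.
(* The halting run of the program provides an output, which soundness identifies with the
   neighbors. *)
move=> ->; have [s' [_ [_ _ h]]] := time_le (data_matrix X omega) i.
by rewrite -(sound _ h).
Qed.
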